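(* Let $m\in C(\mathbb{R}^n)$ and set $\widetilde m(\xi):=m(-\xi)$. Assume that the Fourier multiplier operator $\phi\mapsto \widetilde m(D)\phi:=\mathcal{F}^{-1}(\widetilde m\,\widehat\phi)$ maps $C_c^\infty(\mathbb{R}^n)$ into $L^1(\mathbb{R}^n)$. Suppose $f\in L^\infty(\mathbb{R}^n)$ satisfies $m(D)f=0$ as a distribution, i.e. \[ \langle f,\widetilde m(D)\phi\rangle=0\quad\text{for all }\phi\in C_c^\infty(\mathbb{R}^n). \] If $\{\eta\in\mathbb{R}^n\mid m(\eta)=0\}\subseteq\{0\}$, then $f$ is Lebesgue almost everywhere equal to a constant. Conversely, if every $f\in L^\infty(\mathbb{R}^n)$ satisfying $\langle f,\widetilde m(D)\phi\rangle=0$ for all $\phi\in C_c^\infty(\mathbb{R}^n)$ is Lebesgue almost everywhere constant, then $\{\eta\in\mathbb{R}^n\mid m(\eta)=0\}\subseteq\{0\}$.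
   Context: Fourier transform convention: $\mathcal{F}\phi(\xi)=\widehat\phi(\xi)=(2\pi)^{-n}\int_{\mathbb{R}^n}e^{-ix\cdot\xi}\phi(x)\,dx$ and $\mathcal{F}^{-1}u(x)=\int_{\mathbb{R}^n}e^{ix\cdot\xi}u(\xi)\,d\xi$. The pairing is $\langle f,g\rangle=\int_{\mathbb{R}^n}f(x)g(x)\,dx$. *)

(* Defs.v *)
From mathcomp Require Import all_boot all_algebra all_classical all_reals all_analysis.
From mathcomp Require Import complex.
Import GRing.Theory Num.Theory numFieldNormedType.Exports.

Set Implicit Arguments.
Unset Strict Implicit.
Unset Printing Implicit Defensive.

Local Open Scope classical_set_scope.
Local Open Scope ring_scope.

(* Points of R^n are row vectors 'rV[R]_n (a normed space, used for    *)
(* continuity / derivatives / compactness).  Lebesgue measure lives on *)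
(* the measurable space n.-tuple R (product Borel sigma-algebra of the *)
(* library); the two are identified coordinatewise.                    *)

Definition row_of_tuple (R : realType) (n : nat) (t : n.-tuple R) : 'rV[R]_n :=
  \row_j tnth t j.

(* n-dimensional Lebesgue measure on Borel sets of R^n, defined as the
   iterated product measure  lambda^(n+1) = lambda \x lambda^n, i.e.
   lambda^(n+1)(A) = \int lambda(dx) lambda^n({t | (x :: t) \in A}),
   and lambda^0 = Dirac mass at the unique point of R^0. *)
Fixpoint lebn (R : realType) (n : nat) : set (n.-tuple R) -> \bar R :=
  match n return set (n.-tuple R) -> \bar R with
  | 0 => fun A => ((\1_A : _ -> R) [tuple])%:E
  | n'.+1 => fun A =>
      (\int[@lebesgue_measure R]_x @lebn R n' [set t | A (cons_tuple x t)])%E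
  end.

Definition ae_Rn (R : realType) (n : nat) (P : 'rV[R]_n -> Prop) : Prop :=
  {ae @lebn R n, forall t, P (row_of_tuple t)}.

Definition Rint_Rn (R : realType) (n : nat) (g : 'rV[R]_n -> R) : R :=
  fine (\int[@lebn R n]_t (g (row_of_tuple t))%:E)%E.

Definition Rintegrable_Rn (R : realType) (n : nat) (g : 'rV[R]_n -> R) : Prop :=
  (@lebn R n).-integrable setT (fun t => (g (row_of_tuple t))%:E).

Definition Rmeasurable_Rn (R : realType) (n : nat) (g : 'rV[R]_n -> R) : Prop :=
  measurable_fun setT (fun t => g (row_of_tuple t)).

Definition cre (R : realType) (z : R[i]) : R := complex.Re z.
Definition cim (R : realType) (z : R[i]) : R := complex.Im z.
Definition cmod (R : realType) (z : R[i]) : R :=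
  Num.sqrt (cre z ^+ 2 + cim z ^+ 2).

Definition L1 (R : realType) (n : nat) (h : 'rV[R]_n -> R[i]) : Prop :=
  Rintegrable_Rn (fun x => cre (h x)) /\ Rintegrable_Rn (fun x => cim (h x)).

Definition cint (R : realType) (n : nat) (h : 'rV[R]_n -> R[i]) : R[i] :=
  Complex (Rint_Rn (fun x => cre (h x))) (Rint_Rn (fun x => cim (h x))).

Definition Linf (R : realType) (n : nat) (f : 'rV[R]_n -> R[i]) : Prop :=
  [/\ Rmeasurable_Rn (fun x => cre (f x)), Rmeasurable_Rn (fun x => cim (f x))
    & exists M : R, ae_Rn (fun x => cmod (f x) <= M)].

Definition ccontinuous (R : realType) (n : nat) (m : 'rV[R]_n -> R[i]) : Prop :=
  continuous (fun x => cre (m x)) /\ continuous (fun x => cim (m x)).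

Definition e_ (R : realType) (n : nat) (i : 'I_n) : 'rV[R]_n := delta_mx ord0 i.

Fixpoint Ck (R : realType) (n : nat) (k : nat) (g : 'rV[R]_n -> R) : Prop :=
  continuous g /\
  match k with
  | 0 => True
  | k'.+1 => forall i : 'I_n,
      (forall x, derivable g x (e_ R i)) /\ Ck k' (fun x => 'D_(e_ R i) g x)
  end.

Definition smooth (R : realType) (n : nat) (g : 'rV[R]_n -> R) : Prop :=
  forall k, Ck k g.

Definition test_fun (R : realType) (n : nat) (phi : 'rV[R]_n -> R[i]) : Prop :=
  [/\ smooth (fun x => cre (phi x)), smooth (fun x => cim (phi x))
    & compact (closure [set x | phi x != 0])].

Definition dotRn (R : realType) (n : nat) (x xi : 'rV[R]_n) : R :=
  \sum_(j < n) x ord0 j * xi ord0 j.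

Definition expi (R : realType) (t : R) : R[i] := Complex (cos t) (sin t).

Definition fourier (R : realType) (n : nat) (h : 'rV[R]_n -> R[i]) (xi : 'rV[R]_n)
  : R[i] :=
  Complex ((2 * pi) ^- n) 0 * cint (fun x => expi (- dotRn x xi) * h x).

(* g is (the L^1 representative of) mtilde(D) phi = F^{-1}(mtilde * F phi),
   mtilde(xi) = m(-xi):  g in L^1 and F g = mtilde * F phi *)
Definition is_mult_of (R : realType) (n : nat) (m : 'rV[R]_n -> R[i])
  (phi g : 'rV[R]_n -> R[i]) : Prop :=
  L1 g /\ forall xi, fourier g xi = m (- xi) * fourier phi xi.

Definition mult_maps_Cc_L1 (R : realType) (n : nat) (m : 'rV[R]_n -> R[i]) : Prop :=
  forall phi, test_fun phi -> exists g, is_mult_of m phi g.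

Definition mD_annihilates (R : realType) (n : nat) (m f : 'rV[R]_n -> R[i]) : Prop :=
  forall phi g, test_fun phi -> is_mult_of m phi g ->
    cint (fun x => f x * g x) = 0.

Definition ae_const (R : realType) (n : nat) (f : 'rV[R]_n -> R[i]) : Prop :=
  exists c : R[i], ae_Rn (fun x => f x = c).

(* Main.v *)
(** Let [f] be bounded and [m(D) f = 0].  Test functions [phi] and the functions
    [g] with [F g = m~ F phi] may be translated, so the convolution of [f] with
    [g] vanishes.  Near a frequency [xi] with [m xi <> 0] a narrow modulated
    kernel [w] of de la Vallee-Poussin type satisfies
    [g * w ~ (F g)(xi) w] in [L^1]; since [w] reproduces the modulated Fejer
    kernel [v] of the same width, this gives [f * v = 0] (a local form of
    Wiener's lemma).  A wide Fejer kernel [K] is a finite combination of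
    narrow ones centred at lattice frequencies, so [u = f * K] only keeps frequencies
    arbitrarily close to [0]: [u = u * W_r] for all [r > 0], whence [u] is
    constant because [W_r] is nearly translation invariant for small [r].
    As [K] is an approximate identity, [f] is constant.  Conversely, a zero
    [eta <> 0] of [m] is witnessed by the character [x |-> expi (x . eta)]. *)
From HB Require Import structures.
Require Import Defs.
From mathcomp Require Import all_boot all_order all_algebra all_classical all_reals all_analysis.
From mathcomp Require Import measurable_realfun complex ring lra.
Import Order.TTheory GRing.Theory Num.Theory numFieldNormedType.Exports.

Set Implicit Arguments.
Unset Strict Implicit.
Unset Printing Implicit Defensive.

Local Open Scope classical_set_scope.
Local Open Scope ring_scope.
Local Open Scope complex_scope.

Local Notation Re := complex.Re.
Local Notation Im := complex.Im.

(** A bounded [f] has no transform as a function, so no spectrum of [f] is ever formed. That the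
    transform of [w] equals [1] wherever that of [k] is nonzero is replaced by the kernel identity
    [k * w = k], which is proved without Fourier inversion, by approximating Fejer kernels with
    trigonometric polynomials. Wiener's inversion is replaced by a contraction: a sup bound of
    [u = f * v] can be halved again and again, so [u = 0]. The obstacle is uniformity. The lattice
    frequencies move with the width of the narrow kernels, so this width must be fixed before they
    are known. Hence [1 / m] is bounded on a whole compact annulus, and one bump, so narrow that its
    transform has no zero in the whole cube of frequencies, provides a single [g] for all of
    them. *)

Fact row_display : measure_display.
Proof. exact: default_measure_display. Qed.

(** * Row vectors as a measurable space *)

Section row_measurable.
Context (R : realType) (n : nat).

(** Transporting the sigma-algebra of tuples along [row_of_tuple] makes that map measurable by
    definition and lets measure theory take place on row vectors, which carry the vector space
    operations. *)
Let mrow : set (set 'rV[R]_n) :=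
  [set A | measurable (@row_of_tuple R n @^-1` A)].

Let mrow0 : mrow set0.
Proof. by rewrite /mrow /= preimage_set0. Qed.

Let mrowC A : mrow A -> mrow (~` A).
Proof. by rewrite /mrow /= preimage_setC; exact: measurableC. Qed.

Let mrow_bigcup (F : (set 'rV[R]_n)^nat) :
  (forall i, mrow (F i)) -> mrow (\bigcup_i F i).
Proof. by rewrite /mrow /= preimage_bigcup => h; exact: bigcupT_measurable. Qed.

HB.instance Definition _ := @isMeasurable.Build
  row_display 'rV[R]_n mrow mrow0 mrowC mrow_bigcup.
End row_measurable.

Definition tuple_of_row (R : realType) (n : nat) (v : 'rV[R]_n) : n.-tuple R :=
  [tuple v ord0 i | i < n].

Definition consr (R : realType) (n : nat) (p : R * 'rV[R]_n) : 'rV[R]_n.+1 :=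
  \row_j (if unlift ord0 j is Some k then p.2 ord0 k else p.1).

Section row_theory.
Context (R : realType).

Lemma row_of_tupleK n : cancel (@row_of_tuple R n) (@tuple_of_row R n).
Proof. by move=> t; apply: eq_from_tnth => i; rewrite tnth_mktuple mxE. Qed.

Lemma tuple_of_rowK n : cancel (@tuple_of_row R n) (@row_of_tuple R n).
Proof. by move=> v; apply/rowP => i; rewrite mxE tnth_mktuple. Qed.

Lemma row_of_cons n (x : R) (t : n.-tuple R) :
  row_of_tuple (cons_tuple x t) = consr (x, row_of_tuple t).
Proof.
apply/rowP => j; rewrite !mxE; case: unliftP => [k ->|->] /=.
  by rewrite mxE tnthS.
by rewrite tnth0.
Qed.

Lemma consr0 n (p : R * 'rV[R]_n) : consr p ord0 ord0 = p.1.
Proof. by rewrite mxE unlift_none. Qed.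

Lemma consrS n (p : R * 'rV[R]_n) i : consr p ord0 (lift ord0 i) = p.2 ord0 i.
Proof. by rewrite mxE liftK. Qed.

Lemma measurable_row_of_tuple n : measurable_fun setT (@row_of_tuple R n).
Proof. by move=> _ Y mY; rewrite setTI. Qed.

Lemma measurable_tuple_of_row n : measurable_fun setT (@tuple_of_row R n).
Proof.
move=> _ Y mY; rewrite setTI /measurable /=.
rewrite -comp_preimage (_ : _ \o _ = id) ?preimage_id//.
by apply/funext => t /=; rewrite row_of_tupleK.
Qed.

Lemma measurable_coord n (i : 'I_n) :
  measurable_fun setT (fun v : 'rV[R]_n => v ord0 i).
Proof.
rewrite (_ : (fun v => _) = (fun t => tnth t i) \o @tuple_of_row R n); last first.
  by apply/funext => v /=; rewrite tnth_mktuple.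
apply: measurableT_comp; first exact: measurable_tnth.
exact: measurable_tuple_of_row.
Qed.

Lemma measurable_rowP d (T : measurableType d) n (f : T -> 'rV[R]_n) :
  (forall i, measurable_fun setT (fun x => f x ord0 i)) -> measurable_fun setT f.
Proof.
move=> h; rewrite (_ : f = @row_of_tuple R n \o (@tuple_of_row R n \o f)); last first.
  by apply/funext => v /=; rewrite tuple_of_rowK.
apply: measurableT_comp; first exact: measurable_row_of_tuple.
apply/measurable_fun_tnthP => i; rewrite (_ : _ \o _ = fun x => f x ord0 i)//.
by apply/funext => x /=; rewrite tnth_mktuple.
Qed.

Lemma measurable_consr n : measurable_fun setT (@consr R n).
Proof.
apply: measurable_rowP => i; case: (unliftP ord0 i) => [j ->|->].
  under eq_fun do rewrite consrS.
  by apply: (measurableT_comp (@measurable_coord n j)); exact: measurable_snd.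
by under eq_fun do rewrite consr0; exact: measurable_fst.
Qed.

Lemma row0_eq (v w : 'rV[R]_0) : v = w.
Proof. by apply/rowP => -[]. Qed.

End row_theory.

(** * Lebesgue measure on row vectors *)

Lemma product_sigma_finite d1 d2 (T1 : measurableType d1) (T2 : measurableType d2)
  (R : realType) (m1 : {sigma_finite_measure set T1 -> \bar R})
  (m2 : {sigma_finite_measure set T2 -> \bar R}) : sigma_finite setT (m1 \x m2)%E.
Proof.
have /sigma_finiteP[F [TF ndF Foo]] := sigma_finiteT m1.
have /sigma_finiteP[G [TG ndG Goo]] := sigma_finiteT m2.
exists (fun n => F n `*` G n).
  apply/seteqP; split => // -[x y] _.
  have [i _ Fx] : (\bigcup_i F i) x by rewrite -TF.
  have [j _ Gy] : (\bigcup_i G i) y by rewrite -TG.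
  exists (maxn i j) => //; split => /=.
    by move: x Fx; exact/subsetPset/ndF/leq_maxl.
  by move: y Gy; exact/subsetPset/ndG/leq_maxr.
move=> k; have [? ?] := Foo k; have [? ?] := Goo k; split; first exact: measurableX.
by rewrite product_measure1E// lte_mul_pinfty// ge0_fin_numE.
Qed.

Section pushforward_cancel.
Context d1 d2 (T1 : measurableType d1) (T2 : measurableType d2) (R : realType).
Context (mu : {measure set T1 -> \bar R}) (muT : sigma_finite setT mu).
Context (f : T1 -> T2) (g : T2 -> T1).
Hypotheses (mf : measurable_fun setT f) (mg : measurable_fun setT g) (fK : cancel f g).

Let nu : set T2 -> \bar R := pushforward mu f.

Let nu0 : nu set0 = 0%E.
Proof. by rewrite /nu /pushforward preimage_set0 measure0. Qed.

Let nu_ge0 A : (0 <= nu A)%E.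
Proof.
exact: (@measure_ge0 _ _ _
  (measure_function_pushforward__canonical__measure_function_Measure mu mf)).
Qed.

Let nu_sigma_additive : semi_sigma_additive nu.
Proof.
exact: (@measure_semi_sigma_additive _ _ _
  (measure_function_pushforward__canonical__measure_function_Measure mu mf)).
Qed.

HB.instance Definition _ := isMeasure.Build _ _ _ nu nu0 nu_ge0 nu_sigma_additive.

Let nu_sigma_finite : sigma_finite setT nu.
Proof.
have /sigma_finiteP[F [TF ndF Foo]] := muT.
exists (fun k => g @^-1` F k); first by rewrite -preimage_bigcup -TF preimage_setT.
move=> k; have [mF Fk] := Foo k; split.
  by rewrite -[X in measurable X]setTI; exact: mg.
rewrite /nu /pushforward -comp_preimage (_ : _ \o _ = id) ?preimage_id//.
by apply/funext => p /=; rewrite fK.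
Qed.

HB.instance Definition _ := Measure_isSigmaFinite.Build _ _ _ nu nu_sigma_finite.

(** Sigma-finiteness may fail for a general image measure. Here the left inverse [g] pulls an
    exhaustion of [T1] back to one of [T2], with the same measures because [g \o f] is the
    identity. *)
Lemma pushforward_sigma_finite : exists M : {sigma_finite_measure set T2 -> \bar R},
  forall A, M A = mu (f @^-1` A).
Proof. by exists nu. Qed.

End pushforward_cancel.

Section lebesgue_row.
Context (R : realType).

Definition head_behead n (v : 'rV[R]_n.+1) : R * 'rV[R]_n :=
  (v ord0 ord0, \row_i v ord0 (lift ord0 i)).

Lemma consrK n : cancel (@consr R n) (@head_behead n).
Proof.
move=> p; rewrite /head_behead consr0 [RHS]surjective_pairing; congr pair.
by apply/rowP => i; rewrite mxE consrS.
Qed.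

Lemma measurable_head_behead n : measurable_fun setT (@head_behead n).
Proof.
apply: measurable_fun_pair; first exact: measurable_coord.
apply: measurable_rowP => i; under eq_fun do rewrite mxE; exact: measurable_coord.
Qed.

(** [lebn] is a bare set function defined by recursion. The induction has to carry a sigma-finite
    measure, since the next product is formed from it; [consr] then turns that product into a
    measure on row vectors. *)
Lemma row_lebesgue_exists n : exists M : {sigma_finite_measure set 'rV[R]_n -> \bar R},
  forall A, M A = lebn (@row_of_tuple R n @^-1` A).
Proof.
elim: n => [|n [M ME]].
  exists (@dirac _ 'rV[R]_0 0 R) => A; rewrite /dirac /= !indicE.
  congr (_%:R%:E); apply: congr1; apply/idP/idP => /set_mem h; apply/mem_set; rewrite /preimage /= in h *.
    by rewrite (row0_eq (row_of_tuple _) 0).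
  by rewrite (row0_eq 0 (row_of_tuple [tuple])).
have [N NE] := pushforward_sigma_finite (product_sigma_finite (@lebesgue_measure R) M)
  (@measurable_consr R n) (@measurable_head_behead n) (@consrK n).
exists N => A; rewrite NE /= /product_measure1; apply: eq_integral => x _ /=.
rewrite ME; congr (lebn _); apply/funext => t /=; rewrite /preimage /=; apply/propext.
by rewrite row_of_cons; split=> [/xsectionP|h]; last exact/xsectionP.
Qed.

Definition leb n : {sigma_finite_measure set 'rV[R]_n -> \bar R} := sval (cid (row_lebesgue_exists n)).

Lemma lebE n A : leb n A = lebn (@row_of_tuple R n @^-1` A).
Proof. by rewrite /leb; case: cid. Qed.

Lemma lebnE n : @lebn R n = pushforward (leb n) (@tuple_of_row R n).
Proof.
apply/funext => A; rewrite /pushforward lebE -comp_preimage (_ : _ \o _ = id) ?preimage_id//.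
by apply/funext => p /=; rewrite row_of_tupleK.
Qed.

Lemma leb_cons n : forall A, leb n.+1 A = pushforward (@lebesgue_measure R \x leb n)%E (@consr R n) A.
Proof.
move=> A; rewrite lebE /= /pushforward /product_measure1; apply: eq_integral => x _ /=.
rewrite lebE; congr (lebn _); apply/funext => t /=; rewrite /preimage /=; apply/propext.
by rewrite row_of_cons; split=> [h|/xsectionP]; first exact/xsectionP.
Qed.

End lebesgue_row.

(** * Complex-valued integrals, limits and Fubini *)

Section nrm1.
Context (R : realType).
Implicit Types (z w : R[i]).

(** The sum norm replaces the modulus in all estimates: it is submultiplicative, and measurability
    and integrability are read off the two real components. The price is harmless constants, such as
    the [2] in [nrm1_expi]. *)
Definition nrm1 z : R := `|Re z| + `|Im z|.

Lemma cReM z w : Re (z * w) = Re z * Re w - Im z * Im w.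
Proof. by case: z w => [a b] [c d]. Qed.

Lemma cImM z w : Im (z * w) = Re z * Im w + Im z * Re w.
Proof. by case: z w => [a b] [c d]. Qed.

Lemma cReD z w : Re (z + w) = Re z + Re w.
Proof. by case: z w => [a b] [c d]. Qed.

Lemma cImD z w : Im (z + w) = Im z + Im w.
Proof. by case: z w => [a b] [c d]. Qed.

Lemma cReN z : Re (- z) = - Re z.
Proof. by case: z. Qed.

Lemma cImN z : Im (- z) = - Im z.
Proof. by case: z. Qed.

Lemma complexE2 z w : Re z = Re w -> Im z = Im w -> z = w.
Proof. by case: z w => [a b] [c d] /= -> ->. Qed.

Lemma nrm1_ge0 z : 0 <= nrm1 z.
Proof. by rewrite addr_ge0. Qed.

Lemma nrm1_eq0 z : nrm1 z = 0 -> z = 0.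
Proof.
move=> /eqP; rewrite paddr_eq0// !normr_eq0 => /andP[/eqP a /eqP b].
exact: complexE2.
Qed.

Lemma nrm10 : nrm1 0 = 0.
Proof. by rewrite /nrm1 /= normr0 addr0. Qed.

Lemma nrm1N z : nrm1 (- z) = nrm1 z.
Proof. by rewrite /nrm1 cReN cImN !normrN. Qed.

Lemma nrm1D z w : nrm1 (z + w) <= nrm1 z + nrm1 w.
Proof.
rewrite /nrm1 cReD cImD; have := ler_normD (Re z) (Re w).
have := ler_normD (Im z) (Im w); lra.
Qed.

Lemma nrm1B z w : nrm1 (z - w) <= nrm1 z + nrm1 w.
Proof. by rewrite -(nrm1N w) nrm1D. Qed.

Lemma nrm1_sum I (r : seq I) (P : pred I) (F : I -> R[i]) :
  nrm1 (\sum_(i <- r | P i) F i) <= \sum_(i <- r | P i) nrm1 (F i).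
Proof.
elim/big_rec2: _ => [|i y1 y2 _ h]; first by rewrite nrm10.
by apply: le_trans (nrm1D _ _) _; rewrite lerD2l.
Qed.

Lemma nrm1M z w : nrm1 (z * w) <= nrm1 z * nrm1 w.
Proof.
rewrite /nrm1 cReM cImM.
have := ler_normB (Re z * Re w) (Im z * Im w).
have := ler_normD (Re z * Im w) (Im z * Re w).
rewrite !normrM; nra.
Qed.

Lemma nrm1Z (a : R) z : nrm1 (a%:C * z) = `|a| * nrm1 z.
Proof. by rewrite /nrm1 cReM cImM /= !mul0r subr0 addr0 !normrM mulrDr. Qed.

Lemma nrm1r (a : R) : nrm1 a%:C = `|a|.
Proof. by rewrite /nrm1 /= normr0 addr0. Qed.

Lemma Re_nrm1 z : `|Re z| <= nrm1 z.
Proof. by rewrite lerDl. Qed.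

Lemma Im_nrm1 z : `|Im z| <= nrm1 z.
Proof. by rewrite lerDr. Qed.

Lemma nrm1_prod I (r : seq I) (F : I -> R[i]) :
  nrm1 (\prod_(i <- r) F i) <= \prod_(i <- r) nrm1 (F i).
Proof.
elim: r => [|i r ih]; first by rewrite !big_nil /nrm1 /= normr1 normr0 addr0.
rewrite !big_cons; apply: le_trans (nrm1M _ _) _.
by rewrite ler_wpM2l// nrm1_ge0.
Qed.

End nrm1.

Section cintegral.
Context d (T : measurableType d) (R : realType).
Variable mu : {measure set T -> \bar R}.
Implicit Types (h f g : T -> R[i]).

Definition cI h : R[i] :=
  Complex (\int[mu]_x Re (h x)) (\int[mu]_x Im (h x)).

Definition cmeas h :=
  measurable_fun setT (fun x => Re (h x)) /\ measurable_fun setT (fun x => Im (h x)).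

Definition cintg h :=
  mu.-integrable setT (EFin \o (fun x => Re (h x))) /\
  mu.-integrable setT (EFin \o (fun x => Im (h x))).

Lemma eq_cI h g : h =1 g -> cI h = cI g.
Proof. by move=> /funext ->. Qed.

Lemma cintg_cmeas h : cintg h -> cmeas h.
Proof. by move=> [/measurable_int/measurable_EFinP ? /measurable_int/measurable_EFinP ?]. Qed.

Lemma cmeasM f g : cmeas f -> cmeas g -> cmeas (fun x => f x * g x).
Proof.
move=> [a b] [c e]; split.
  by under eq_fun do rewrite cReM; apply: measurable_funB; exact: measurable_funM.
by under eq_fun do rewrite cImM; apply: measurable_funD; exact: measurable_funM.
Qed.

Lemma cmeasD f g : cmeas f -> cmeas g -> cmeas (fun x => f x + g x).
Proof.
move=> [a b] [c e]; split.
  by under eq_fun do rewrite cReD; apply: measurable_funD.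
by under eq_fun do rewrite cImD; apply: measurable_funD.
Qed.

Lemma cmeasN f : cmeas f -> cmeas (fun x => - f x).
Proof.
move=> [a b]; split.
  by under eq_fun do rewrite cReN; exact: measurable_funN.
by under eq_fun do rewrite cImN; exact: measurable_funN.
Qed.

Lemma cmeasB f g : cmeas f -> cmeas g -> cmeas (fun x => f x - g x).
Proof. by move=> a b; apply: cmeasD => //; exact: cmeasN. Qed.

Lemma cmeas_cst c : cmeas (fun=> c).
Proof. by split; exact: measurable_cst. Qed.

Lemma cmeas_real (f : T -> R) : measurable_fun setT f -> cmeas (fun x => (f x)%:C).
Proof. by move=> mf; split => //; exact: measurable_cst. Qed.

Lemma measurable_nrm1 f : cmeas f -> measurable_fun setT (fun x => nrm1 (f x)).
Proof. by move=> [a b]; apply: measurable_funD; exact: measurableT_comp. Qed.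

Lemma cintg_dom h (H : T -> R) : cmeas h -> mu.-integrable setT (EFin \o H) ->
  (forall x, nrm1 (h x) <= H x) -> cintg h.
Proof.
move=> [a b] iH hH; split; apply: le_integrable iH => //; first exact/measurable_EFinP.
- move=> x _ /=; rewrite lee_fin; apply: le_trans (Re_nrm1 _) _.
  by apply: le_trans (hH x) _; exact: ler_norm.
- exact/measurable_EFinP.
- move=> x _ /=; rewrite lee_fin; apply: le_trans (Im_nrm1 _) _.
  by apply: le_trans (hH x) _; exact: ler_norm.
Qed.

Lemma cintg_nrm1 h : cintg h -> mu.-integrable setT (EFin \o (fun x => nrm1 (h x))).
Proof.
move=> [a b].
have -> : EFin \o (fun x => nrm1 (h x)) =
   ((EFin \o (fun x => `|Re (h x)|%R)) \+ (EFin \o (fun x => `|Im (h x)|%R)))%E.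
  by apply/funext => x /=; rewrite EFinD.
by apply: integrableD => //; exact: integrable_norm.
Qed.

Lemma cintg_real (f : T -> R) : mu.-integrable setT (EFin \o f) ->
  cintg (fun x => (f x)%:C).
Proof.
move=> mf; split => //=.
by rewrite (_ : _ \o _ = cst 0%E); [exact: integrable0|exact/funext].
Qed.

Lemma cI_real (f : T -> R) : cI (fun x => (f x)%:C) = (\int[mu]_x f x)%:C.
Proof. by congr Complex; rewrite /Rintegral integral0. Qed.

Lemma cintgD f g : cintg f -> cintg g -> cintg (fun x => f x + g x).
Proof.
move=> [a b] [c e]; split.
  apply: eq_integrable (integrableD measurableT a c) => // x _ /=.
  by rewrite cReD EFinD.
apply: eq_integrable (integrableD measurableT b e) => // x _ /=.
by rewrite cImD EFinD.
Qed.

Lemma cIcD f g : cintg f -> cintg g -> cI (fun x => f x + g x) = cI f + cI g.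
Proof.
move=> [a b] [c e]; apply: complexE2 => /=; rewrite -RintegralD//.
  by apply: eq_Rintegral => x _; rewrite cReD.
by apply: eq_Rintegral => x _; rewrite cImD.
Qed.

Lemma cintgMb f g B : cmeas f -> (forall x, nrm1 (f x) <= B) -> cintg g ->
  cintg (fun x => f x * g x).
Proof.
move=> mf fB ig; have iB := integrableZl measurableT B (cintg_nrm1 ig).
apply: (@cintg_dom _ (fun x => B * nrm1 (g x))) => // [|x].
  by apply: cmeasM => //; exact: cintg_cmeas.
 apply: le_trans (nrm1M _ _) _.
by rewrite ler_wpM2r ?nrm1_ge0.
Qed.

Lemma cintgZ c g : cintg g -> cintg (fun x => c * g x).
Proof. by apply: (@cintgMb (fun=> c) g (nrm1 c)) => //; exact: cmeas_cst. Qed.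

Lemma cIZ c g : cintg g -> cI (fun x => c * g x) = c * cI g.
Proof.
move=> [a b]; apply: complexE2.
  rewrite cReM /= -!RintegralZl// -RintegralB//.
  - by apply: eq_Rintegral => x _; rewrite cReM.
  - by apply: eq_integrable (integrableZl measurableT (Re c) a) => // x _ /=.
  - by apply: eq_integrable (integrableZl measurableT (Im c) b) => // x _ /=.
rewrite cImM /= -!RintegralZl// -RintegralD//.
- by apply: eq_Rintegral => x _; rewrite cImM.
- by apply: eq_integrable (integrableZl measurableT (Re c) b) => // x _ /=.
- by apply: eq_integrable (integrableZl measurableT (Im c) a) => // x _ /=.
Qed.

Lemma cintgN f : cintg f -> cintg (fun x => - f x).
Proof. by move=> /(cintgZ (-1)); under eq_fun do rewrite mulN1r. Qed.

Lemma cintgB f g : cintg f -> cintg g -> cintg (fun x => f x - g x).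
Proof. by move=> a b; apply: cintgD => //; exact: cintgN. Qed.

Lemma cIcB f g : cintg f -> cintg g -> cI (fun x => f x - g x) = cI f - cI g.
Proof.
move=> a b; rewrite cIcD//; last exact: cintgN.
congr (_ + _); rewrite -mulN1r -cIZ//; apply: eq_cI => x.
by rewrite mulN1r.
Qed.

Lemma cintg0 : cintg (fun=> 0).
Proof.
by split; rewrite (_ : _ \o _ = cst 0%E); do ?[exact: integrable0|exact/funext].
Qed.

Lemma cI0 : cI (fun=> 0) = 0.
Proof. by apply: complexE2; rewrite /= /Rintegral integral0. Qed.

Lemma cintg_sum I (r : seq I) (F : I -> T -> R[i]) : (forall i, cintg (F i)) ->
  cintg (fun x => \sum_(i <- r) F i x).
Proof.
move=> iF; elim: r => [|i r ih].
  by under eq_fun do rewrite big_nil; exact: cintg0.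
by under eq_fun do rewrite big_cons; exact: cintgD.
Qed.

Lemma cI_sum I (r : seq I) (F : I -> T -> R[i]) : (forall i, cintg (F i)) ->
  cI (fun x => \sum_(i <- r) F i x) = \sum_(i <- r) cI (F i).
Proof.
move=> iF; elim: r => [|i r ih].
  by under eq_cI do rewrite big_nil; rewrite big_nil cI0.
under eq_cI do rewrite big_cons; rewrite big_cons cIcD ?ih//.
exact: cintg_sum.
Qed.

Lemma nrm1_cI f : cintg f -> nrm1 (cI f) <= \int[mu]_x nrm1 (f x).
Proof.
move=> [a b]; rewrite /nrm1 /= RintegralD//; [|exact: integrable_norm..].
by apply: lerD; exact: le_normr_Rintegral.
Qed.

Lemma nrm1_cI_le f (H : T -> R) : cmeas f -> mu.-integrable setT (EFin \o H) ->
  (forall x, nrm1 (f x) <= H x) -> nrm1 (cI f) <= \int[mu]_x H x.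
Proof.
move=> mf iH fH; have fi := cintg_dom mf iH fH.
apply: le_trans (nrm1_cI fi) _; apply: le_Rintegral => //; exact: cintg_nrm1.
Qed.

End cintegral.

Lemma cmeas_comp d d' (T : measurableType d) (T' : measurableType d') (R : realType)
  (h : T' -> R[i]) (p : T -> T') :
  cmeas h -> measurable_fun setT p -> cmeas (fun x => h (p x)).
Proof.
by move=> [a b] mp; split; [exact: (measurableT_comp a)|exact: (measurableT_comp b)].
Qed.

Section limits.
Context d (T : measurableType d) (R : realType).
Variable mu : {measure set T -> \bar R}.

Lemma Rintegral_dct (h : (T -> R)^nat) (g H : T -> R) :
  (forall k, measurable_fun setT (h k)) -> measurable_fun setT g ->
  (forall x, h k x @[k --> \oo] --> g x) ->
  mu.-integrable setT (EFin \o H) ->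
  (forall k x, `|h k x| <= H x) ->
  \int[mu]_x h k x @[k --> \oo] --> \int[mu]_x g x.
Proof.
move=> mh mg hg iH hH.
have [|||||ig _ cv] := @dominated_convergence _ _ _ mu setT measurableT
  (fun k => EFin \o h k) (EFin \o g) (EFin \o H) => //.
- by move=> k; apply/measurable_EFinP.
- exact/measurable_EFinP.
- by apply: aeW => x _ /=; apply: cvg_EFin; [apply: nearW|exact: hg].
- by apply: aeW => x k _ /=; rewrite lee_fin.
have gf : (\int[mu]_x (g x)%:E)%E \is a fin_num by exact: integrable_fin_num ig.
rewrite /Rintegral -[X in _ --> X]/(fine _).
by apply: fine_cvg => /=; rewrite fineK//; exact: cv.
Qed.

Lemma nrm1_dct (h : (T -> R[i])^nat) (g : T -> R[i]) (H : T -> R) :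
  (forall k, cmeas (h k)) -> cmeas g ->
  (forall x, nrm1 (h k x - g x) @[k --> \oo] --> 0) ->
  mu.-integrable setT (EFin \o H) ->
  (forall k x, nrm1 (h k x - g x) <= H x) ->
  \int[mu]_x nrm1 (h k x - g x) @[k --> \oo] --> 0.
Proof.
move=> mh mg hg iH hH.
have -> : 0 = \int[mu]_x (fun=> 0 : R) x by rewrite /Rintegral integral0.
apply: (@Rintegral_dct _ _ H) => //.
- by move=> k; apply: measurable_nrm1; exact: cmeasB.
- by move=> k x; rewrite ger0_norm ?nrm1_ge0.
Qed.

Lemma cI_dct (h : (T -> R[i])^nat) (g : T -> R[i]) (H : T -> R) :
  (forall k, cmeas (h k)) -> cmeas g ->
  (forall x, nrm1 (h k x - g x) @[k --> \oo] --> 0) ->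
  mu.-integrable setT (EFin \o H) ->
  (forall k x, nrm1 (h k x) <= H x) -> cintg mu g ->
  nrm1 (cI mu (h k) - cI mu g) @[k --> \oo] --> 0.
Proof.
move=> mh mg hg iH hH ig.
have ih k : cintg mu (h k) by exact: cintg_dom iH _.
apply: (@squeeze_cvgr _ _ _ _ (cst 0) (fun k => \int[mu]_x nrm1 (h k x - g x))).
- apply: nearW => k; rewrite nrm1_ge0 /= -cIcB//.
  by apply: nrm1_cI; exact: cintgB.
- exact: cvg_cst.
apply: (nrm1_dct mh mg hg (H := fun x => H x + nrm1 (g x))) => //.
  by apply: eq_integrable (integrableD measurableT iH (cintg_nrm1 ig)) => // x _.
by move=> k x; apply: le_trans (nrm1B _ _) _; rewrite lerD2r.
Qed.

Lemma nrm1_cvg_unique (u : nat -> R[i]) l l' :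
  nrm1 (u k - l) @[k --> \oo] --> 0 -> nrm1 (u k - l') @[k --> \oo] --> 0 -> l = l'.
Proof.
move=> ul ul'; apply/eqP; rewrite -subr_eq0; apply/eqP/nrm1_eq0.
apply/eqP; rewrite eq_le nrm1_ge0 andbT.
have : nrm1 (u k - l) + nrm1 (u k - l') @[k --> \oo] --> 0 + 0 by exact: cvgD.
rewrite addr0 => c0; apply: (cvgr_to_ge c0); apply: nearW => k.
rewrite (_ : l - l' = (u k - l') - (u k - l)); last by ring.
by rewrite [leRHS]addrC; exact: nrm1B.
Qed.

End limits.

Section fubini.
Context d1 d2 (T1 : measurableType d1) (T2 : measurableType d2) (R : realType).
Variables (m1 : {sigma_finite_measure set T1 -> \bar R})
  (m2 : {sigma_finite_measure set T2 -> \bar R}).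

(** Tonelli is applied to the positive and negative parts separately, so [h] may fail to be
    integrable; [fine] then turns an infinite value into [0] without harming measurability. *)
Lemma measurable_int_param (h : T1 * T2 -> R) : measurable_fun setT h ->
  measurable_fun setT (fun x => \int[m2]_y h (x, y)).
Proof.
move=> mh; rewrite /Rintegral; apply: measurableT_comp => //.
under eq_fun do rewrite integralE.
have mE : measurable_fun setT (EFin \o h) by exact/measurable_EFinP.
apply: emeasurable_funB.
  rewrite [X in measurable_fun _ X](_ : _ = (fun x => \int[m2]_y ((EFin \o h)^\+ (x, y)))%E).
    by apply: measurable_fun_fubini_tonelli_F => //; exact: measurable_funepos.
  by apply/funext => x; apply: eq_integral => y _; rewrite !funeposE.
rewrite [X in measurable_fun _ X](_ : _ = (fun x => \int[m2]_y ((EFin \o h)^\- (x, y)))%E).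
  by apply: measurable_fun_fubini_tonelli_F => //; exact: measurable_funeneg.
by apply/funext => x; apply: eq_integral => y _; rewrite !funenegE.
Qed.

Lemma cmeas_int_param (h : T1 * T2 -> R[i]) : cmeas h ->
  cmeas (fun x => cI m2 (fun y => h (x, y))).
Proof.
move=> [a b]; split => /=; first exact: (measurable_int_param a).
exact: (measurable_int_param b).
Qed.

Lemma Rintegral_prod1 (h : T1 * T2 -> R) :
  (m1 \x m2)%E.-integrable setT (EFin \o h) ->
  \int[m1]_x (\int[m2]_y h (x, y)) = \int[(m1 \x m2)%E]_p h p.
Proof.
move=> ih; rewrite /Rintegral; congr fine.
rewrite -[RHS](integral12_prod_meas1 ih); apply: ae_eq_integral => //.
- apply: measurableT_comp => //; apply: measurable_int_param.
  by apply/measurable_EFinP; exact: measurable_int ih.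
- exact: (measurable_fubini_F ih).
(* The inner integral is finite for almost every [x], and there [fine] leaves it unchanged. *)
- apply: filterS (ae_integrable1 ih) => x ix _; rewrite fineK//.
  exact: integrable_fin_num ix.
Qed.

Lemma Rintegral_fubini (h : T1 * T2 -> R) :
  (m1 \x m2)%E.-integrable setT (EFin \o h) ->
  \int[m1]_x (\int[m2]_y h (x, y)) = \int[m2]_y (\int[m1]_x h (x, y)).
Proof.
move=> ih; rewrite Rintegral_prod1// /Rintegral; congr fine.
rewrite -[LHS](integral21_prod_meas1 ih); apply: ae_eq_integral => //.
- exact: (measurable_fubini_G ih).
- apply: measurableT_comp => //; apply: (@measurableT_comp _ _ _ _ _ _ (@fine R)) => //.
  exact: (measurable_fubini_G ih).
- apply: filterS (ae_integrable2 ih) => x ix _; rewrite fineK//.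
  exact: integrable_fin_num ix.
Qed.

Lemma cI_fubini (h : T1 * T2 -> R[i]) :
  cintg (m1 \x m2)%E h ->
  cI m1 (fun x => cI m2 (fun y => h (x, y))) = cI m2 (fun y => cI m1 (fun x => h (x, y))).
Proof.
by move=> [a b]; apply: complexE2 => /=; rewrite (Rintegral_fubini a) || rewrite (Rintegral_fubini b).
Qed.

Lemma integrable_prodM (u : T1 -> R) (v : T2 -> R) :
  m1.-integrable setT (EFin \o u) -> m2.-integrable setT (EFin \o v) ->
  (m1 \x m2)%E.-integrable setT (EFin \o (fun p => u p.1 * v p.2)).
Proof.
move=> iu iv.
have mu' : measurable_fun setT u by apply/measurable_EFinP; exact: measurable_int iu.
have mv : measurable_fun setT v by apply/measurable_EFinP; exact: measurable_int iv.
apply/integrable12ltyP.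
  apply/measurable_EFinP; apply: measurable_funM.
    by apply: (measurableT_comp mu').
  by apply: (measurableT_comp mv).
under eq_integral => x _ do under eq_integral => y _ do
  rewrite /= normrM EFinM.
have av := integrable_norm iv.
have fv := integrable_fin_num measurableT av.
under eq_integral => x _.
  rewrite integralZl//=.
  over.
rewrite -(fineK fv) integralZr//.
  have au := integrable_norm iu.
  apply: lte_mul_pinfty; [exact: integral_ge0|exact: integrable_fin_num au|exact: ltry].
exact: integrable_norm iu.
Qed.

End fubini.

(** * Translations, dilations and iterated integrals *)

Section change_of_variables.
Context d (T : measurableType d) (R : realType) (mu : {measure set T -> \bar R}).

(** The change of variables is required for nonnegative functions only. The integrable and complex
    cases follow once and for all, for translations and dilations on the line and on row vectors
    alike. *)
Definition scales_measure (phi : T -> T) (c : R) := [/\ measurable_fun setT phi, 0 < c &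
  forall f : T -> \bar R, measurable_fun setT f -> (forall x, 0 <= f x)%E ->
    (\int[mu]_x f x = c%:E * \int[mu]_x f (phi x))%E].

Context (phi : T -> T) (c : R) (sc : scales_measure phi c).

Lemma integrable_scales (f : T -> \bar R) :
  mu.-integrable setT f -> mu.-integrable setT (fun x => f (phi x)).
Proof.
have [mphi c0 H] := sc; move=> /integrableP[mf fi].
have mfa : measurable_fun setT (fun x => f (phi x)) by exact: measurableT_comp.
apply/integrableP; split => //.
rewrite H in fi => //; last exact: measurableT_comp.
by rewrite lt_neqAle leey andbT; apply: contraTneq fi => ->; rewrite gt0_muley.
Qed.

Lemma integral_scales (f : T -> \bar R) : mu.-integrable setT f ->
  (\int[mu]_x f x = c%:E * \int[mu]_x f (phi x))%E.
Proof.
have [mphi c0 H] := sc; move=> fi; have mf := measurable_int _ fi.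
have fai := integrable_scales fi.
rewrite [LHS]integralE [in RHS]integralE.
rewrite H//; last exact: measurable_funepos.
rewrite (H (f^\-)%E)//; last exact: measurable_funeneg.
rewrite [RHS]muleBr//; last by rewrite fin_num_adde_defl// fin_numN; exact: integrable_neg_fin_num.
by congr (_ * _ - _ * _)%E; apply: eq_integral => v _; rewrite ?funeposE ?funenegE.
Qed.

Lemma Rintegral_scales (f : T -> R) : mu.-integrable setT (EFin \o f) ->
  \int[mu]_x f x = c * \int[mu]_x f (phi x).
Proof.
move=> fi; rewrite /Rintegral (integral_scales fi) fineM//.
by apply: integrable_fin_num (integrable_scales fi).
Qed.

Lemma cintg_scales (h : T -> R[i]) : cintg mu h -> cintg mu (fun x => h (phi x)).
Proof. by move=> [a b]; split; [exact: (integrable_scales a)|exact: (integrable_scales b)]. Qed.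

Lemma cI_scales (h : T -> R[i]) : cintg mu h ->
  cI mu h = c%:C * cI mu (fun x => h (phi x)).
Proof.
move=> [a b]; apply: complexE2; rewrite ?cReM ?cImM /= ?mul0r ?subr0 ?addr0.
  exact: (Rintegral_scales a).
exact: (Rintegral_scales b).
Qed.

End change_of_variables.

Section affine_line.
Context (R : realType).
Local Notation mu := (@lebesgue_measure R).

Let aff (a b : R) : measurableTypeR R -> measurableTypeR R := fun x => a * x + b.

Lemma measurable_affine (a b : R) : measurable_fun setT (fun x : R => a * x + b).
Proof. by apply: measurable_funD => //; exact: measurable_funM. Qed.

Let maff a b : measurable_fun setT (aff a b) := measurable_affine a b.

(** Lebesgue measure is determined by its values on the intervals []u, v]], so the rescaled image
    measure need only be compared there. A negative [a] exchanges the closed and open ends of the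
    preimage, which does not affect its length. *)
Lemma lebesgue_affine_set (a b : R) (A : set R) : a != 0 -> measurable A ->
  mu A = (`|a|%:E * mu ((fun x => a * x + b)%R @^-1` A))%E.
Proof.
move=> a0 mA.
pose push := measure_function_pushforward__canonical__measure_function_Measure mu (maff a b).
rewrite -[RHS]/(mscale (NngNum (normr_ge0 a)) push A).
apply: lebesgue_measure_unique => // _ [[u v] uv <-].
rewrite -[RHS]/(`|a|%:E * mu (aff a b @^-1` `]u, v]%classic))%E.
have [a_gt0|a_lt0|aE0] := ltgtP a 0; last by rewrite aE0 eqxx in a0.
  rewrite (_ : _ @^-1` _ = `[(v - b) / a, (u - b) / a[%classic); last first.
    apply/seteqP; split => x /=; rewrite /aff !in_itv /=.
      by rewrite ler_ndivrMr// ltr_ndivlMr// mulrC => ?; lra.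
    by rewrite ler_ndivrMr// ltr_ndivlMr// mulrC => ?; lra.
  rewrite !lebesgue_measure_itv /= !lte_fin.
  have -> : ((v - b) / a < (u - b) / a) = (u < v).
    by rewrite ltr_nM2r ?invr_lt0// ltrD2r.
  case: ifPn => _; last by rewrite mule0.
  by rewrite -!EFinD -EFinM ltr0_norm//; congr EFin; field.
rewrite (_ : _ @^-1` _ = `](u - b) / a, (v - b) / a]%classic); last first.
  apply/seteqP; split => x /=; rewrite /aff !in_itv /=.
    by rewrite ler_pdivlMr// ltr_pdivrMr// mulrC => ?; lra.
  by rewrite ler_pdivlMr// ltr_pdivrMr// mulrC => ?; lra.
rewrite !lebesgue_measure_itv /= !lte_fin.
have -> : ((u - b) / a < (v - b) / a) = (u < v).
  by rewrite ltr_pM2r ?invr_gt0// ltrD2r.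
case: ifPn => _; last by rewrite mule0.
by rewrite -!EFinD -EFinM gtr0_norm//; congr EFin; field.
Qed.

Lemma ge0_integral_affine (a b : R) (f : R -> \bar R) : a != 0 ->
  measurable_fun setT f -> (forall x, 0 <= f x)%E ->
  (\int[mu]_x f x = `|a|%:E * \int[mu]_x f (a * x + b)%R)%E.
Proof.
move=> a0 mf f0.
pose push := measure_function_pushforward__canonical__measure_function_Measure mu (maff a b).
transitivity (\int[mscale (NngNum (normr_ge0 a)) push]_x f x)%E.
  by apply: eq_measure_integral => A mA _; exact: lebesgue_affine_set.
rewrite ge0_integral_mscale//; congr (_ * _)%E.
by rewrite ge0_integral_pushforward//; exact: maff.
Qed.

Lemma scales_affine (a b : R) : a != 0 ->
  scales_measure mu (fun x => a * x + b) `|a|.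
Proof.
move=> a0; split; [exact: measurable_affine|by rewrite normr_gt0|].
by move=> f mf f0; exact: ge0_integral_affine.
Qed.

End affine_line.

Section row_integral.
Context (R : realType).
Local Notation mu := (@lebesgue_measure R).

Lemma ge0_integral_leb_cons n (f : 'rV[R]_n.+1 -> \bar R) :
  measurable_fun setT f -> (forall x, 0 <= f x)%E ->
  (\int[leb R n.+1]_v f v = \int[mu]_x \int[leb R n]_v f (consr (x, v)))%E.
Proof.
move=> mf f0.
pose push := measure_function_pushforward__canonical__measure_function_Measure
  (mu \x leb R n)%E (@measurable_consr R n).
transitivity (\int[push]_v f v)%E.
  by apply: eq_measure_integral => A mA _; exact: leb_cons.
rewrite ge0_integral_pushforward//; last exact: measurable_consr.
unshelve (rewrite fubini_tonelli1//); last by move=> x; exact: f0.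
by apply: measurableT_comp => //; exact: measurable_consr.
Qed.

Lemma measurable_row_affine n (a : R) (b : 'rV[R]_n) :
  measurable_fun setT (fun v : 'rV[R]_n => a *: v + b).
Proof.
apply: measurable_rowP => i; under eq_fun do rewrite !mxE.
apply: measurable_funD => //; apply: measurable_funM => //; exact: measurable_coord.
Qed.

Lemma ge0_integral_row_affine n (a : R) (b : 'rV[R]_n) (f : 'rV[R]_n -> \bar R) :
  a != 0 -> measurable_fun setT f -> (forall x, 0 <= f x)%E ->
  (\int[leb R n]_v f v = (`|a| ^+ n)%:E * \int[leb R n]_v f (a *: v + b)%R)%E.
Proof.
move=> a0; elim: n b f => [|n ih] b f mf f0.
  rewrite expr0 mul1e; apply: eq_integral => v _; congr f; exact: row0_eq.
rewrite ge0_integral_leb_cons// ge0_integral_leb_cons//; last first.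
  by apply: measurableT_comp => //; exact: measurable_row_affine.
set b' := \row_i b ord0 (lift ord0 i).
pose g x v := f (consr (a * x + b ord0 ord0, v)).
have mg : measurable_fun setT (fun p : R * 'rV[R]_n => f (consr p)).
  by apply: measurableT_comp => //; exact: measurable_consr.
have mg' x : measurable_fun setT (fun v => f (consr (x, v))).
  apply: (measurableT_comp mg); exact: measurable_fun_pair.
rewrite (@ge0_integral_affine _ a (b ord0 ord0))//; last 2 first.
  by apply: (measurable_fun_fubini_tonelli_F (fun p : R * 'rV[R]_n => f (consr p))).
  by move=> x; exact: integral_ge0.
rewrite exprS EFinM -muleA; congr (_ * _)%E.
rewrite -ge0_integralZl//; last 2 first.
- apply: (measurable_fun_fubini_tonelli_F (fun p : R * 'rV[R]_n => f (a *: consr p + b))) => //.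
  apply: (measurableT_comp mf).
  exact: (measurableT_comp (measurable_row_affine a b) (@measurable_consr R n)).
- by move=> x _; exact: integral_ge0.
apply: eq_integral => x _; rewrite (ih b' (fun v => f (consr (a * x + b ord0 ord0, v))))//.
congr (_ * _)%E; apply: eq_integral => v _; congr f.
by apply/rowP => j; case: (unliftP ord0 j) => [k|] ->; rewrite !mxE ?liftK ?unlift_none ?mxE.
Qed.

Lemma scales_row_affine n (a : R) (b : 'rV[R]_n) : a != 0 ->
  scales_measure (leb R n) (fun v : 'rV[R]_n => a *: v + b) (`|a| ^+ n).
Proof.
move=> a0; split; [exact: measurable_row_affine|by rewrite exprn_gt0// normr_gt0|].
by move=> f mf f0; exact: ge0_integral_row_affine.
Qed.

Lemma scales_row_shift n (b : 'rV[R]_n) :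
  scales_measure (leb R n) (fun v : 'rV[R]_n => v + b) 1.
Proof.
have := scales_row_affine b (oner_neq0 R); rewrite normr1 expr1n.
by under eq_fun do rewrite scale1r.
Qed.

Lemma cI_leb_cons n (h : 'rV[R]_n.+1 -> R[i]) : cintg (leb R n.+1) h ->
  cI (leb R n.+1) h = cI mu (fun x => cI (leb R n) (fun v => h (consr (x, v)))).
Proof.
pose push := measure_function_pushforward__canonical__measure_function_Measure
  (mu \x leb R n)%E (@measurable_consr R n).
suff H (f : 'rV[R]_n.+1 -> R) : (leb R n.+1).-integrable setT (EFin \o f) ->
    \int[leb R n.+1]_v f v = \int[mu]_x (\int[leb R n]_v f (consr (x, v))).
  by move=> [a b]; congr Complex; rewrite H.
move=> fi; have mf := measurable_int _ fi.
have fi2 : (mu \x leb R n)%E.-integrable setT (EFin \o (f \o @consr R n)).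
  apply/integrable12ltyP; first exact: (measurableT_comp mf (@measurable_consr R n)).
  move/integrableP : fi => [_]; rewrite ge0_integral_leb_cons//.
  exact: measurableT_comp.
rewrite (Rintegral_prod1 fi2) /Rintegral; congr fine.
transitivity (\int[push]_v (f v)%:E)%E.
  by apply: eq_measure_integral => A mA _; exact: leb_cons.
exact: (@integral_pushforward _ _ (measurableTypeR R * 'rV[R]_n)%type _ _ _ (@measurable_consr R n) (mu \x leb R n)%E setT _ mf fi2 measurableT).
Qed.

Lemma measurable_tensor n (u : 'I_n -> R -> R) : (forall i, measurable_fun setT (u i)) ->
  measurable_fun setT (fun v : 'rV[R]_n => \prod_i u i (v ord0 i)).
Proof.
move=> mu_; apply: measurable_prod => i _.
exact: (measurableT_comp (mu_ i) (@measurable_coord R n i)).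
Qed.

Lemma tensor_consr (A : comPzRingType) n (u : 'I_n.+1 -> R -> A) x (v : 'rV[R]_n) :
  \prod_i u i (consr (x, v) ord0 i) =
  u ord0 x * \prod_i u (lift ord0 i) (v ord0 i).
Proof.
rewrite big_ord_recl consr0; congr (_ * _).
by apply: eq_bigr => i _; rewrite consrS.
Qed.

Lemma integral_leb0 (f : 'rV[R]_0 -> R) : (\int[leb R 0]_v (f v)%:E)%E = (f 0)%:E.
Proof.
rewrite (eq_integral (cst (f 0)%:E)); last by move=> v _; rewrite (row0_eq v 0).
have h : leb R 0 setT = 1%E by rewrite lebE /= indicE mem_set.
by rewrite integral_cst// [X in (_ * X)%E]h mule1.
Qed.

Lemma integrable_tensor n (u : 'I_n -> R -> R) :
  (forall i, mu.-integrable setT (EFin \o u i)) ->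
  (leb R n).-integrable setT (EFin \o (fun v : 'rV[R]_n => \prod_i u i (v ord0 i))).
Proof.
elim: n u => [|n ih] u iu.
  apply/integrableP; split.
    by apply/measurable_EFinP; apply: measurable_tensor => -[].
  by rewrite (integral_leb0 (fun v => `|_|)) ltry.
have mu_ i : measurable_fun setT (u i) by apply/measurable_EFinP; exact: measurable_int (iu i).
have mten := measurable_tensor mu_.
apply/integrableP; split; first exact/measurable_EFinP.
rewrite ge0_integral_leb_cons//; last by apply: measurableT_comp => //; exact/measurable_EFinP.
have /integrable12ltyP := integrable_prodM (iu ord0) (ih (fun i => u (lift ord0 i)) (fun i => iu _)).
rewrite /=; under [in X in _ -> X]eq_integral do under eq_integral do rewrite /= tensor_consr.
apply; apply/measurable_EFinP; apply: measurable_funM.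
  exact: (measurableT_comp (mu_ _)).
by apply: (measurableT_comp (measurable_tensor (fun i => mu_ (lift ord0 i)))).
Qed.

Definition tensor n (h : 'I_n -> R -> R[i]) (v : 'rV[R]_n) : R[i] :=
  \prod_i h i (v ord0 i).

Lemma cmeas_tensor n (h : 'I_n -> R -> R[i]) : (forall i, cmeas (h i)) -> cmeas (tensor h).
Proof.
move=> mh; rewrite /tensor.
elim: (index_enum _) => [|i r ih]; first by under eq_fun do rewrite big_nil; exact: cmeas_cst.
under eq_fun do rewrite big_cons; apply: cmeasM => //.
exact: (cmeas_comp (mh i) (@measurable_coord R n i)).
Qed.

Lemma cintg_tensor n (h : 'I_n -> R -> R[i]) : (forall i, cintg mu (h i)) ->
  cintg (leb R n) (tensor h).
Proof.
move=> ih; apply: (cintg_dom _ (integrable_tensor (fun i => cintg_nrm1 (ih i)))).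
  by apply: cmeas_tensor => i; exact: (cintg_cmeas (ih i)).
by move=> v; exact: nrm1_prod.
Qed.

Lemma cI_tensor n (h : 'I_n -> R -> R[i]) : (forall i, cintg mu (h i)) ->
  cI (leb R n) (tensor h) = \prod_i cI mu (h i).
Proof.
elim: n h => [|n ih] h hi.
  rewrite big_ord0; under eq_cI do rewrite /tensor big_ord0.
  by rewrite -[1]/(1%:C) cI_real /Rintegral (integral_leb0 (fun=> 1)).
rewrite cI_leb_cons; last exact: cintg_tensor.
have h0 i := hi (lift ord0 i).
transitivity (cI mu (fun x => \prod_i cI mu (h (lift ord0 i)) * h ord0 x)).
  apply: eq_cI => x; under eq_cI do rewrite /tensor tensor_consr.
  rewrite (@cIZ _ _ _ _ _ (tensor (fun i => h (lift ord0 i)))); last exact: cintg_tensor.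
  by rewrite ih// mulrC.
by rewrite cIZ// big_ord_recl mulrC.
Qed.

End row_integral.

(** * Convolution of bounded functions with integrable kernels *)

Section convolution.
Context (R : realType) (n : nat).
Local Notation V := 'rV[R]_n.
Local Notation mu := (leb R n).
Implicit Types (f u v w g k : V -> R[i]).

(** Written with [y + x], this is convolution with the reflection of [k]. The sign makes the value
    at [y] the pairing of [f] with the translate [x |-> k (x - y)], which is what the hypothesis on
    [f] controls. *)
Definition conv f k (y : V) : R[i] := cI mu (fun x => f (y + x) * k x).

(** The bound holds everywhere, not merely almost everywhere, so that it can be used at every point;
    [Linf_bmeas] changes [f] on a null set to obtain it. *)
Definition bmeas f (B : R) := cmeas f /\ forall x, nrm1 (f x) <= B.

Lemma measurable_row_add : measurable_fun setT (fun p : V * V => p.1 + p.2).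
Proof.
apply: measurable_rowP => i; under eq_fun do rewrite mxE.
have mc := @measurable_coord R n i.
by apply: measurable_funD; [apply: (measurableT_comp mc)|apply: (measurableT_comp mc)].
Qed.

Lemma measurable_addl (y : V) : measurable_fun setT (fun x : V => y + x).
Proof.
apply: measurable_rowP => i; under eq_fun do rewrite mxE.
by apply: measurable_funD => //; exact: measurable_coord.
Qed.

Lemma measurable_addr (y : V) : measurable_fun setT (fun x : V => x + y).
Proof. by under eq_fun do rewrite addrC; exact: measurable_addl. Qed.

Lemma cI_shift (b : V) (h : V -> R[i]) : cintg mu h -> cI mu h = cI mu (fun x => h (x + b)).
Proof. by move=> /(cI_scales (scales_row_shift b)); rewrite mul1r. Qed.

Lemma cintg_shift (b : V) (h : V -> R[i]) : cintg mu h -> cintg mu (fun x => h (x + b)).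
Proof. exact: (cintg_scales (scales_row_shift b)). Qed.

Lemma bmeas_shift f B (y : V) : bmeas f B -> bmeas (fun x => f (y + x)) B.
Proof. by move=> [mf fB]; split=> //; apply: (cmeas_comp mf); exact: measurable_addl. Qed.

Lemma cintg_conv f B k y : bmeas f B -> cintg mu k -> cintg mu (fun x => f (y + x) * k x).
Proof. by move=> /(bmeas_shift y)[mf fB] ik; exact: cintgMb fB ik. Qed.

Lemma Rintegral_nrm1_ge0 k : 0 <= \int[mu]_x nrm1 (k x).
Proof. by apply: Rintegral_ge0 => x _; exact: nrm1_ge0. Qed.

Lemma nrm1_cI_bound f B k : bmeas f B -> cintg mu k ->
  nrm1 (cI mu (fun x => f x * k x)) <= B * \int[mu]_x nrm1 (k x).
Proof.
move=> [mf fB] ik; have ink := cintg_nrm1 ik.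
rewrite -RintegralZl//; apply: nrm1_cI_le.
- by apply: cmeasM => //; exact: cintg_cmeas ik.
- exact: (integrableZl measurableT B ink).
- by move=> x; apply: le_trans (nrm1M _ _) _; rewrite ler_wpM2r ?nrm1_ge0.
Qed.

Lemma cmeas_fun_add f : cmeas f -> cmeas (fun p : V * V => f (p.1 + p.2)).
Proof. by move=> mf; exact: (cmeas_comp mf measurable_row_add). Qed.

Lemma bmeas_conv f B k : bmeas f B -> cintg mu k ->
  bmeas (conv f k) (B * \int[mu]_x nrm1 (k x)).
Proof.
move=> fB ik; split.
  apply: (@cmeas_int_param _ _ _ _ _ mu (fun p : V * V => f (p.1 + p.2) * k p.2)).
  apply: cmeasM; first by apply: cmeas_fun_add; case: fB.
  exact: (cmeas_comp (cintg_cmeas ik) measurable_snd).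
by move=> y; exact: (nrm1_cI_bound (bmeas_shift y fB) ik).
Qed.

(** Both sides equal the double integral of [f (y + x + z) * k1 z * k2 x], to which Fubini applies
    because [f] is bounded and [k1], [k2] are integrable. *)
Lemma conv_convC f B k1 k2 : bmeas f B -> cintg mu k1 -> cintg mu k2 ->
  conv (conv f k1) k2 =1 conv (conv f k2) k1.
Proof.
move=> fB i1 i2 y; rewrite /conv.
transitivity (cI mu (fun x => cI mu (fun z => f (y + (x + z)) * (k2 x * k1 z)))).
  apply: eq_cI => x; rewrite mulrC -cIZ; last exact: cintg_conv fB i1.
  by apply: eq_cI => z; rewrite -addrA; ring.
transitivity (cI mu (fun z => cI mu (fun x => f (y + (x + z)) * (k2 x * k1 z)))); last first.
  apply: eq_cI => x; rewrite mulrC -cIZ; last exact: cintg_conv fB i2.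
  by apply: eq_cI => z; rewrite -addrA [z + x]addrC; ring.
have [mf bf] := fB.
apply: (@cI_fubini _ _ _ _ _ mu mu (fun p : V * V => f (y + (p.1 + p.2)) * (k2 p.1 * k1 p.2))).
apply: (@cintgMb _ _ _ _ (fun p : V * V => f (y + (p.1 + p.2))) _ B) => //.
  exact: (cmeas_comp (cmeas_comp mf (measurable_addl y)) measurable_row_add).
apply: (cintg_dom _ (integrable_prodM (cintg_nrm1 i2) (cintg_nrm1 i1))).
  apply: cmeasM; first exact: (cmeas_comp (cintg_cmeas i2) measurable_fst).
  exact: (cmeas_comp (cintg_cmeas i1) measurable_snd).
by move=> p; exact: nrm1M.
Qed.

(** Integrating in [p.2] first gives, by translation invariance, the norm of [k1] whatever [p.1]
    is. *)
Lemma cintg_prod_shift k1 k2 : cintg mu k1 -> cintg mu k2 ->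
  cintg (mu \x mu)%E (fun p : V * V => k1 (p.2 - p.1) * k2 p.1).
Proof.
move=> i1 i2.
have msub : measurable_fun setT (fun p : V * V => p.2 - p.1).
  apply: measurable_rowP => i; under eq_fun do rewrite !mxE.
  have mc := @measurable_coord R n i.
  apply: measurable_funB; first exact: (measurableT_comp mc measurable_snd).
  exact: (measurableT_comp mc measurable_fst).
have mk : cmeas (fun p : V * V => k1 (p.2 - p.1) * k2 p.1).
  apply: cmeasM; first exact: (cmeas_comp (cintg_cmeas i1) msub).
  exact: (cmeas_comp (cintg_cmeas i2) measurable_fst).
pose H (p : V * V) : R := nrm1 (k1 (p.2 - p.1)) * nrm1 (k2 p.1).
apply: (@cintg_dom _ _ _ _ _ H mk); last by move=> p; exact: nrm1M.
have mH : measurable_fun setT H.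
  apply: measurable_funM; apply: measurable_nrm1.
    exact: (cmeas_comp (cintg_cmeas i1) msub).
  exact: (cmeas_comp (cintg_cmeas i2) measurable_fst).
apply/integrable12ltyP; first exact/measurable_EFinP.
have n1 := cintg_nrm1 i1; have n2 := cintg_nrm1 i2.
have n1s (x : V) : mu.-integrable setT (EFin \o (fun z => nrm1 (k1 (z - x)))).
  exact: (integrable_scales (scales_row_shift (- x)) n1).
rewrite (eq_integral (fun x => ((\int[mu]_z nrm1 (k1 z)) * nrm1 (k2 x))%:E)); last first.
  move=> x _; rewrite /H /=.
  transitivity (\int[mu]_z (nrm1 (k2 x) * nrm1 (k1 (z - x)))%:E)%E.
    apply: eq_integral => z _; rewrite ger0_norm ?mulr_ge0 ?nrm1_ge0//.
    by rewrite mulrC.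
  under eq_integral do rewrite EFinM.
  rewrite (integralZl _ (n1s x))//= mulrC EFinM; congr (_ * _)%E.
  rewrite /Rintegral fineK; last exact: integrable_fin_num n1.
  by rewrite [RHS](integral_scales (scales_row_shift (- x)) n1) mul1e.
under eq_integral do rewrite EFinM.
have N := n2; rewrite (integralZl _ N)//.
apply: lte_mul_pinfty; rewrite ?lee_fin ?Rintegral_nrm1_ge0//.
by rewrite ltey_eq (integrable_fin_num _ n2).
Qed.

(** The last hypothesis is the ordinary convolution identity [k1 * k2 = k1], the substitute for a
    transform of [k2] equal to [1] where that of [k1] is nonzero. The shift by [x] is moved onto
    [k1], and Fubini lets the identity act. Boundedness of [k1] makes the inner integral converge
    for every [z]. *)
Lemma conv_repr f B k1 B1 k2 : bmeas f B -> cintg mu k1 -> bmeas k1 B1 -> cintg mu k2 ->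
  (forall z, cI mu (fun x => k1 (z - x) * k2 x) = k1 z) ->
  conv (conv f k1) k2 =1 conv f k1.
Proof.
move=> fB i1 [mk1 bk1] i2 rep y; rewrite /conv.
transitivity (cI mu (fun x => cI mu (fun z => f (y + z) * (k1 (z - x) * k2 x)))).
  apply: eq_cI => x; rewrite mulrC -cIZ; last exact: cintg_conv fB i1.
  rewrite (cI_shift (- x)); last by apply: cintgZ; exact: cintg_conv fB i1.
  by apply: eq_cI => z; rewrite addrACA subrr addr0; ring.
have [mf bf] := fB.
rewrite (@cI_fubini _ _ _ _ _ mu mu (fun p : V * V => f (y + p.2) * (k1 (p.2 - p.1) * k2 p.1))).
  apply: eq_cI => z; rewrite /= cIZ ?rep//.
  apply: (@cintgMb _ _ _ mu (fun x : V => k1 (z - x)) k2 B1) => //.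
  apply: (cmeas_comp mk1); apply: measurable_rowP => i; under eq_fun do rewrite !mxE.
  by apply: measurable_funB => //; exact: measurable_coord.
apply: (@cintgMb _ _ _ _ (fun p : V * V => f (y + p.2)) _ B) => //.
  exact: (cmeas_comp (cmeas_comp mf (measurable_addl y)) measurable_snd).
exact: cintg_prod_shift.
Qed.

Lemma eq_convl f g k : f =1 g -> conv f k = conv g k.
Proof. by move=> /funext ->. Qed.

(* If [u = conv u w], [conv u g = 0] and translating [w] by [z] nearly multiplies
   it by [e z], then [(cI mu (e * g)) u] is small compared with the bound of [u];
   the estimate can therefore be iterated. *)
Lemma conv_local_vanish u B w g (e : V -> R[i]) (H : V -> R) :
  bmeas u B -> cintg mu w -> cintg mu g -> bmeas e 2 ->
  conv u w =1 u -> conv u g =1 (fun=> 0) ->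
  mu.-integrable setT (EFin \o (fun z => nrm1 (g z) * H z)) ->
  (forall z, \int[mu]_x nrm1 (e z * w x - w (x - z)) <= H z) ->
  cI mu (fun z => e z * g z) != 0 ->
  nrm1 (cI mu (fun z => e z * g z))^-1 * \int[mu]_z (nrm1 (g z) * H z) <= 2^-1 ->
  u =1 (fun=> 0).
Proof.
move=> uB iw ig [me be] uw ug iH wH G0 small.
set G := cI mu _ in G0 small.
have ie : cintg mu (fun z => e z * g z) by exact: cintgMb be ig.
have H0 z : 0 <= H z by apply: le_trans (wH z); exact: Rintegral_nrm1_ge0.
(* As [conv u g] vanishes, [G * u y] is the integral of [g z * (e z * u y - u (y + z))]. Expanding
   [u y] and [u (y + z)] by the reproducing kernel moves the difference onto [w]. *)
have key y : G * u y = cI mu (fun z => g z *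
    cI mu (fun x => u (y + x) * (e z * w x - w (x - z)))).
  have -> : G * u y = cI mu (fun z => u y * (e z * g z)) - cI mu (fun z => u (y + z) * g z).
    by rewrite cIZ// -/(conv u g y) ug subr0 mulrC.
  rewrite -cIcB; [|exact: cintgZ|exact: cintg_conv uB ig].
  apply: eq_cI => z.
  have -> : u (y + z) = cI mu (fun x => u (y + x) * w (x - z)).
    rewrite -uw /conv (cI_shift (- z)); last exact: cintg_conv uB iw.
    by apply: eq_cI => x; congr (u _ * _); rewrite addrACA subrr addr0.
  have -> : u y * (e z * g z) = g z * cI mu (fun x => u (y + x) * (e z * w x)).
    under eq_cI => x do rewrite mulrCA.
    by rewrite cIZ; [rewrite -/(conv u w y) uw; ring|exact: cintg_conv uB iw].
  rewrite [X in _ - X]mulrC -mulrBr -cIcB//.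
  - by congr (_ * _); apply: eq_cI => x; rewrite mulrBr.
  - by apply: (cintg_conv y uB); exact: cintgZ.
  - by apply: (cintg_conv y uB); exact: cintg_shift.
have halve C : bmeas u C -> bmeas u (C * 2^-1).
  move=> uC; split; first by case: uC.
  have C0 : 0 <= C by case: uC => _ /(_ 0); apply: le_trans; exact: nrm1_ge0.
  move=> y; rewrite -[u y](mulKf G0).
  apply: le_trans (nrm1M _ _) _.
  have : nrm1 (G * u y) <= C * \int[mu]_z (nrm1 (g z) * H z).
    rewrite -RintegralZl// key; apply: nrm1_cI_le.
    - apply: cmeasM; first exact: cintg_cmeas ig.
      apply: (@cmeas_int_param _ _ _ _ _ mu
        (fun p : V * V => u (y + p.2) * (e p.1 * w p.2 - w (p.2 - p.1)))).
      have mw := cintg_cmeas iw; have [mu_ _] := uC.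
      apply: cmeasM; first exact: (cmeas_comp (cmeas_comp mu_ (measurable_addl y)) measurable_snd).
      apply: cmeasB.
        by apply: cmeasM; [exact: (cmeas_comp me measurable_fst)|exact: (cmeas_comp mw measurable_snd)].
      apply: (cmeas_comp mw); apply: measurable_rowP => i; under eq_fun do rewrite !mxE.
      have mc := @measurable_coord R n i.
      apply: measurable_funB; first exact: (measurableT_comp mc measurable_snd).
      exact: (measurableT_comp mc measurable_fst).
    - exact: (integrableZl measurableT C iH).
    - move=> z; apply: le_trans (nrm1M _ _) _; rewrite mulrCA ler_wpM2l ?nrm1_ge0//.
      apply: le_trans (nrm1_cI_bound (bmeas_shift y uC) _) _.
        by apply: cintgB; [exact: cintgZ|exact: cintg_shift].
      by rewrite ler_wpM2l.
  move=> /(ler_wpM2l (nrm1_ge0 G^-1)) /le_trans; apply.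
  by rewrite mulrCA ler_wpM2l.
have iter (k : nat) : bmeas u (B * 2^-1 ^+ k).
  by elim: k => [|k ih]; rewrite ?expr0 ?mulr1// exprSr mulrA; exact: halve.
move=> y; apply: nrm1_eq0; apply/eqP; rewrite eq_le nrm1_ge0 andbT.
have c0 : B * 2^-1 ^+ j @[j --> \oo] --> B * 0.
  apply: cvgM; first exact: cvg_cst.
  by apply: cvg_expr; rewrite gtr0_norm ?invr_gt0// invf_lt1// ltr1n.
rewrite mulr0 in c0; apply: (cvgr_to_ge c0); apply: nearW => j.
by case: (iter j).
Qed.

(** Nothing is known about the regularity of [u], so the shift is transferred to [w] through the
    reproducing identity. *)
Lemma conv_shift_le u B w y h : bmeas u B -> cintg mu w -> conv u w =1 u ->
  nrm1 (u (y + h) - u y) <= B * \int[mu]_x nrm1 (w x - w (x - h)).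
Proof.
move=> uB iw uw.
have -> : u (y + h) - u y = cI mu (fun x => u (y + x) * - (w x - w (x - h))).
  rewrite -(uw (y + h)) -(uw y) /conv (cI_shift (- h)); last exact: cintg_conv uB iw.
  rewrite -cIcB; last exact: cintg_conv uB iw.
    by apply: eq_cI => x; rewrite opprB mulrBr addrACA subrr addr0.
  apply: (cintg_shift (- h) (h := fun x => u (y + h + x) * w x)).
  exact: cintg_conv uB iw.
apply: le_trans (nrm1_cI_bound (bmeas_shift y uB) _) _.
  by apply: cintgN; apply: cintgB => //; exact: cintg_shift.
by under eq_Rintegral do rewrite nrm1N.
Qed.

End convolution.

(** * Fejer and de la Vallee-Poussin kernels on the line *)

Section fejer_line.
Context (R : realType).
Local Notation mu := (@lebesgue_measure R).

(** The integrable majorant of all kernels on the line. Shifting it by at most one unit costs a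
    constant factor, which makes dominated convergence available for small translations. *)
Definition lorentz (x : R) : R := (1 + x ^+ 2)^-1.

Lemma lorentz_gt0 x : 0 < lorentz x.
Proof. by rewrite invr_gt0 ltr_pwDl// sqr_ge0. Qed.

Lemma continuous_lorentz : continuous lorentz.
Proof. exact: continuous_oneDsqrV. Qed.

Lemma measurable_lorentz : measurable_fun setT lorentz.
Proof. exact: continuous_measurable_fun continuous_lorentz. Qed.

Lemma integrable_lorentz : mu.-integrable setT (EFin \o lorentz).
Proof.
apply/integrableP; split; first by apply/measurable_EFinP; exact: measurable_lorentz.
under eq_integral do rewrite /= ger0_norm ?(ltW (lorentz_gt0 _))//.
rewrite ge0_symfun_integralT.
- by rewrite -set_itvcy [X in (_ * X)%E](@integral0y_oneDsqr R) -EFinM ltry.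
- by move=> x; rewrite ltW// lorentz_gt0.
- exact: continuous_lorentz.
- by move=> x; rewrite /= /lorentz sqrrN.
Qed.

Lemma integrable_le_lorentz (f : R -> R) (D : R) : measurable_fun setT f ->
  (forall x, `|f x| <= D * lorentz x) -> mu.-integrable setT (EFin \o f).
Proof.
move=> mf fD; apply: le_integrable (integrableZl measurableT D integrable_lorentz) => //.
  exact/measurable_EFinP.
by move=> x _; rewrite /= lee_fin; apply: le_trans (fD x) _; exact: ler_norm.
Qed.

Lemma integral_gt0_continuous (f : R -> R) (x0 : R) : (forall x, 0 <= f x) ->
  mu.-integrable setT (EFin \o f) -> {for x0, continuous f} -> 0 < f x0 ->
  0 < \int[mu]_x f x.
Proof.
move=> f0 fi fc fx0.
have /fc [e /= e0 He] : nbhs (f x0) [set y | f x0 / 2 < y].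
  by apply: open_nbhs_nbhs; split; [exact: open_gt|rewrite /=]; rewrite ltr_pdivrMr// ltr_pMr// ltr1n.
have fin := integrable_fin_num measurableT fi.
rewrite /Rintegral -lte_fin fineK//.
pose g x := (f x0 / 2) * \1_(ball x0 e) x.
have mb : measurable (ball x0 e : set R) by exact: measurable_ball.
apply: (@lt_le_trans _ _ (\int[mu]_x (g x)%:E)%E).
  rewrite /g; under eq_integral do rewrite EFinM.
  rewrite ge0_integralZl//=; last 2 first.
  - by apply/measurable_EFinP.
  - by rewrite lee_fin divr_ge0// ltW.
  rewrite integral_indic// setIT [X in (_ * X)%E](lebesgue_measure_ball x0 (ltW e0)).
  by rewrite -EFinM lte_fin mulr_gt0// ?divr_gt0// mulrn_wgt0.
apply: ge0_le_integral => //.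
- by move=> x _; rewrite lee_fin mulr_ge0// divr_ge0// ltW.
- by apply/measurable_EFinP; apply: measurable_funM.
- exact: measurable_int fi.
- move=> x _; rewrite lee_fin /g indicE.
  case: (boolP (x \in _)) => [|_]; last by rewrite mulr0.
  by rewrite inE => /He /= h; rewrite mulr1 ltW.
Qed.

Definition sinc (x : R) : R := if x == 0 then 1 else sin x / x.

Lemma sincE x : x * sinc x = sin x.
Proof.
by rewrite /sinc; case: eqVneq => [->|x0]; [rewrite mul0r sin0|field].
Qed.

Lemma abs_sin_le (x : R) : `|sin x| <= `|x|.
Proof.
wlog x0 : x / 0 <= x.
  move=> h; have [/h//|/ltW x0] := leP 0 x.
  by rewrite -normrN -[in leRHS]normrN -sinN; apply: h; rewrite oppr_ge0.
have [|//|c _ e] := @MVT_segment R sin cos 0 x.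
  exact: x0.
  by move=> y; apply: continuous_subspaceT; exact: continuous_sin.
by move: e; rewrite sin0 !subr0 => ->; rewrite normrM ler_piMl// cos_max.
Qed.

Lemma abs_sinc_le1 x : `|sinc x| <= 1.
Proof.
rewrite /sinc; case: eqVneq => [_|x0]; first by rewrite normr1.
by rewrite normrM normfV ler_pdivrMr ?normr_gt0// mul1r abs_sin_le.
Qed.

Lemma continuous_sinc : continuous sinc.
Proof.
move=> x; have [->|x0] := eqVneq x 0; last first.
  have h : \forall y \near x, sin y / y = sinc y.
    have : \forall y \near x, y != 0 by apply: open_nbhs_nbhs; split => //; exact: open_neq.
    by apply: filterS => y /negbTE y0; rewrite /sinc y0.
  apply: cvg_trans; first exact: (near_eq_cvg h).
  rewrite /sinc (negbTE x0); apply: cvgM; first exact: continuous_sin.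
  exact: cvgV.
rewrite /continuous_at {2}/sinc eqxx.
apply/cvgrPdist_lt => e e0.
have : derivable (@sin R) 0 1 by exact: ex_derive.
move=> /cvg_ex[/= l hl].
have le : l = 1 by
  have := @derive_val _ _ _ _ _ _ _ (is_derive_sin (0:R)); rewrite cos0 => <-; apply/esym/cvg_lim.
move: hl; rewrite le => /cvgrPdist_lt/(_ e e0).
rewrite !near_withinE /=; apply: filterS => y hy.
have [->|y0] := eqVneq y 0; first by rewrite /sinc eqxx subrr normr0.
have := hy y0; rewrite sin0 subr0 addr0 /sinc (negbTE y0) /GRing.scale /= mulr1.
by rewrite mulrC.
Qed.
(** This is [(1 - cos x) / x^2], with value [1/2] at [0]. The form with [sinc] shows positivity and
    continuity; the transform is a multiple of the triangle [max (1 - |t|, 0)]. *)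
Definition fejer (x : R) : R := 2^-1 * sinc (x / 2) ^+ 2.

Lemma fejerE x : x ^+ 2 * fejer x = 1 - cos x.
Proof.
have -> : x ^+ 2 * fejer x = 2 * (x / 2 * sinc (x / 2)) ^+ 2 by rewrite /fejer; field.
rewrite sincE sin2cos2 [in RHS](_ : x = (x / 2) *+ 2); last by rewrite mulr2n; field.
by rewrite cos_mulr2n mulr2n; ring.
Qed.

Lemma fejer0 : fejer 0 = 2^-1.
Proof. by rewrite /fejer mul0r /sinc eqxx expr1n mulr1. Qed.

Lemma fejer_ge0 x : 0 <= fejer x.
Proof. by rewrite mulr_ge0// sqr_ge0. Qed.

Lemma fejer_le_half x : fejer x <= 2^-1.
Proof.
rewrite /fejer ler_piMr// -real_normK ?num_real// expr_le1//.
exact: abs_sinc_le1.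
Qed.

Lemma fejerN x : fejer (- x) = fejer x.
Proof.
by rewrite /fejer mulNr /sinc oppr_eq0 sinN invrN mulrNN.
Qed.

(** The constant is [1/2 + 2]: [fejer x] is at most [1/2], and [x^2 * fejer x = 1 - cos x] is at
    most [2]. *)
Lemma fejer_le x : fejer x <= 5%:R / 2 * lorentz x.
Proof.
rewrite /lorentz ler_pdivlMr ?ltr_pwDl ?sqr_ge0// mulrDr mulr1 [_ * x ^+ 2]mulrC.
have := fejerE x; have := cos_geN1 x; have := fejer_le_half x; lra.
Qed.

Lemma continuous_fejer : continuous fejer.
Proof.
have cs : continuous (fun y : R => sinc (y / 2)).
  move=> y; apply: (@continuous_comp _ _ _ (fun y : R => y / 2)); last exact: continuous_sinc.
  by apply: cvgM; [exact: cvg_id|exact: cvg_cst].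
rewrite (_ : fejer = fun y => 2^-1 * (sinc (y / 2) * sinc (y / 2))); last first.
  by apply/funext => y; rewrite -expr2.
by move=> x; apply: cvgM; [exact: cvg_cst|apply: cvgM; exact: cs].
Qed.

Lemma measurable_fejer : measurable_fun setT fejer.
Proof. exact: continuous_measurable_fun continuous_fejer. Qed.

Lemma integrable_fejer : mu.-integrable setT (EFin \o fejer).
Proof.
apply: (integrable_le_lorentz (D := 5%:R / 2)); first exact: measurable_fejer.
by move=> x; rewrite ger0_norm ?fejer_ge0// fejer_le.
Qed.

(** Kept as an abstract positive constant: [vallee] is divided by it, and the integral of
    [fejer_row] is its [n]-th power. *)
Definition fejer_mass : R := \int[mu]_x fejer x.

Lemma fejer_mass_gt0 : 0 < fejer_mass.
Proof.
apply: (@integral_gt0_continuous _ 0); [exact: fejer_ge0|exact: integrable_fejer| |].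
  exact: continuous_fejer.
by rewrite fejer0 invr_gt0.
Qed.

Lemma scales_dilate (b : R) : b != 0 -> scales_measure mu (fun x => b * x) `|b|.
Proof. by move=> /(scales_affine 0); under eq_fun do rewrite addr0. Qed.

(* [kap b x] is [(1 - cos (b x)) / x ^ 2], extended by continuity to [x = 0]. *)
Definition kap (b x : R) : R := b ^+ 2 * fejer (b * x).

Lemma kapE b x : x ^+ 2 * kap b x = 1 - cos (b * x).
Proof. by rewrite -fejerE /kap; ring. Qed.

Lemma kap_x0 b : kap b 0 = b ^+ 2 / 2.
Proof. by rewrite /kap mulr0 fejer0. Qed.

Lemma kap_sym b x : kap b (- x) = kap b x.
Proof. by rewrite /kap mulrN fejerN. Qed.

Lemma integrable_kap b : mu.-integrable setT (EFin \o kap b).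
Proof.
have [->|b0] := eqVneq b 0.
  rewrite (_ : _ \o _ = cst 0%E); first exact: integrable0.
  by apply/funext => x; rewrite /= /kap expr0n mul0r.
apply: eq_integrable (integrableZl measurableT (b ^+ 2)
  (integrable_scales (scales_dilate b0) integrable_fejer)) => // x _.
Qed.

Lemma integral_kap b : \int[mu]_x kap b x = `|b| * fejer_mass.
Proof.
have [->|b0] := eqVneq b 0.
  rewrite normr0 mul0r; under eq_Rintegral do rewrite /kap expr0n mul0r.
  by rewrite /Rintegral integral0.
rewrite /fejer_mass (Rintegral_scales (scales_dilate b0) integrable_fejer).
rewrite mulrA -expr2 real_normK ?num_real// /kap RintegralZl//.
exact: (integrable_scales (scales_dilate b0) integrable_fejer).
Qed.

(** After multiplication by [x^2] this is the product formula for cosines. It reduces the transform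
    of [kap b] to the masses of three such kernels. *)
Lemma kapM_cos b t x : kap b x * cos (t * x) =
  (kap (b + t) x + kap (b - t) x) / 2 - kap t x.
Proof.
have [->|x0] := eqVneq x 0.
  by rewrite !kap_x0 mulr0 cos0; field.
have x2 : x ^+ 2 != 0 by rewrite expf_neq0.
apply: (mulfI x2); rewrite mulrA kapE mulrBr mulrA mulrDr !kapE.
by rewrite [(b + t) * x]mulrDl [(b - t) * x]mulrBl cosD cosB; field.
Qed.

(** The coefficient is the triangle [max (|b| - |t|, 0)], in the form in which the three masses
    produce it. *)
Lemma integral_kapM_cos b t : \int[mu]_x (kap b x * cos (t * x)) =
  ((`|b + t| + `|b - t|) / 2 - `|t|) * fejer_mass.
Proof.
under eq_Rintegral do rewrite kapM_cos.
have i1 := integrable_kap (b + t); have i2 := integrable_kap (b - t).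
have i12 : mu.-integrable setT (EFin \o (fun x => (kap (b + t) x + kap (b - t) x) / 2)).
  apply: eq_integrable (integrableZl measurableT 2^-1 (integrableD measurableT i1 i2)) => // x _.
  by rewrite /= -EFinD -EFinM mulrC.
rewrite RintegralB//; last exact: integrable_kap.
under eq_Rintegral do rewrite mulrC.
rewrite RintegralZl//; last by apply: eq_integrable (integrableD measurableT i1 i2).
by rewrite RintegralD// !integral_kap; ring.
Qed.

End fejer_line.

Section expi_theory.
Context (R : realType).
Implicit Types s t : R.

Lemma expiD s t : expi (s + t) = expi s * expi t.
Proof. by rewrite /expi cosD sinD; apply: complexE2; rewrite ?cReM ?cImM /=; ring. Qed.

Lemma expi0 : expi (0 : R) = 1.
Proof. by rewrite /expi cos0 sin0. Qed.

Lemma expiK t : expi t * expi (- t) = 1.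
Proof. by rewrite -expiD subrr expi0. Qed.

Lemma nrm1_expi t : nrm1 (expi t) <= 2.
Proof.
by rewrite /nrm1 /=; have := cos_max t; have := sin_max t; lra.
Qed.

Lemma expi_sum n (a : 'I_n -> R) : expi (\sum_i a i) = \prod_i expi (a i).
Proof. by apply: (big_morph (@expi R)) => [s t|]; rewrite ?expiD ?expi0. Qed.

Lemma cmeas_expi d (T : measurableType d) (a : T -> R) : measurable_fun setT a ->
  cmeas (fun x => expi (a x)).
Proof.
move=> ma; split => /=.
  exact: (measurableT_comp (continuous_measurable_fun (@continuous_cos R)) ma).
exact: (measurableT_comp (continuous_measurable_fun (@continuous_sin R)) ma).
Qed.

End expi_theory.

Section kernels_line.
Context (R : realType).
Local Notation mu := (@lebesgue_measure R).
Local Notation C := (fejer_mass R).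

(** The de la Vallee-Poussin kernel: its transform is the difference of the triangles of half-widths
    [2] and [1], a trapezoid equal to [1] on [[-1, 1]]. *)
Definition vallee (x : R) : R := (kap 2 x - kap 1 x) / C.

Let C0 : C != 0. Proof. by rewrite gt_eqF// fejer_mass_gt0. Qed.

Lemma continuous_kap (b : R) : continuous (kap b).
Proof.
move=> x; apply: cvgM; first exact: cvg_cst.
apply: (@continuous_comp _ _ _ (fun y : R => b * y)); last exact: continuous_fejer.
by apply: cvgM; [exact: cvg_cst|exact: cvg_id].
Qed.

Lemma continuous_vallee : continuous vallee.
Proof.
move=> x; apply: cvgM; last exact: cvg_cst.
by apply: cvgB; exact: continuous_kap.
Qed.

Lemma measurable_vallee : measurable_fun setT vallee.
Proof. exact: continuous_measurable_fun continuous_vallee. Qed.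

Lemma vallee_le : exists D : R, 0 <= D /\ forall x, `|vallee x| <= D * lorentz x.
Proof.
(* The dilated term contributes [4 * 5/2 = 10] and the other one [5/2]; [13] exceeds their sum. *)
exists (13%:R / C); split=> [|x]; first by rewrite divr_ge0// ltW// fejer_mass_gt0.
rewrite /vallee normrM (ger0_norm (_ : 0 <= C^-1)); last by rewrite invr_ge0 ltW// fejer_mass_gt0.
rewrite [leRHS]mulrAC ler_wpM2r ?invr_ge0 ?(ltW (fejer_mass_gt0 _))//.
rewrite /kap expr1n !mul1r.
have k0 := fejer_ge0 x; have k1 := fejer_le x; have k2 := fejer_ge0 (2 * x).
have k3 : fejer (2 * x) <= 5%:R / 2 * lorentz x.
  apply: le_trans (fejer_le _) _; rewrite ler_wpM2l// ?divr_ge0//.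
  by rewrite /lorentz lef_pV2 ?posrE ?ltr_pwDl ?sqr_ge0// lerD2l exprMn; have := sqr_ge0 x; lra.
have l0 := lorentz_gt0 x.
rewrite ler_norml; apply/andP; split; lra.
Qed.

Lemma integrable_vallee : mu.-integrable setT (EFin \o vallee).
Proof.
have [D [_ vD]] := vallee_le.
by apply: (integrable_le_lorentz (D := D)) => //; exact: measurable_vallee.
Qed.

Lemma valleeN x : vallee (- x) = vallee x.
Proof. by rewrite /vallee !kap_sym. Qed.

Let cintg_expiM (f : R -> R) (t : R) : mu.-integrable setT (EFin \o f) ->
  cintg mu (fun x => expi (t * x) * (f x)%:C).
Proof.
move=> fi; apply: (@cintgMb _ _ _ mu (fun x => expi (t * x)) _ 2); last exact: cintg_real.
  by apply: cmeas_expi; exact: measurable_funM.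
by move=> x; exact: nrm1_expi.
Qed.

Lemma vallee_fourier (t : R) : `|t| <= 1 ->
  cI mu (fun x => expi (t * x) * (vallee x)%:C) = 1.
Proof.
move=> t1; have [iR iI] := cintg_expiM t integrable_vallee.
have eR : (fun x => Re (expi (t * x) * (vallee x)%:C)) = (fun x => vallee x * cos (t * x)).
  by apply/funext => x; rewrite cReM /=; ring.
have eI : (fun x => Im (expi (t * x) * (vallee x)%:C)) = (fun x => vallee x * sin (t * x)).
  by apply/funext => x; rewrite cImM /=; ring.
rewrite eR in iR; rewrite eI in iI.
have icos b : mu.-integrable setT (EFin \o (fun x => kap b x * cos (t * x))).
  have [+ _] := cintg_expiM t (integrable_kap b).
  by apply: eq_integrable => // x _ /=; congr EFin; rewrite /expi /=; ring.
apply: complexE2; rewrite /= ?eR ?eI.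
  transitivity (\int[mu]_x (C^-1 * (kap 2 x * cos (t * x) - kap 1 x * cos (t * x)))).
    by apply: eq_Rintegral => x _; rewrite /vallee; ring.
  rewrite RintegralZl//; last by apply: eq_integrable (integrableB measurableT (icos 2) (icos 1)).
  rewrite RintegralB// !integral_kapM_cos -mulrBl mulrC mulfK//.
  move: t1; rewrite ler_norml => /andP[t1 t2].
  rewrite (ger0_norm (_ : 0 <= 2 + t)) ?(ger0_norm (_ : 0 <= 2 - t)) ?(ger0_norm (_ : 0 <= 1 + t)) ?(ger0_norm (_ : 0 <= 1 - t)); lra.
(* The imaginary part integrates an odd function: reflection shows it to be its own negative. *)
have N1 : (-1 : R) != 0 by rewrite oppr_eq0 oner_neq0.
have := Rintegral_scales (scales_dilate N1) iI.
rewrite normrN1 mul1r.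
under [in RHS]eq_Rintegral do rewrite mulN1r valleeN mulrN sinN mulrN -mulN1r.
by rewrite RintegralZl// => e; lra.
Qed.

Definition vallee_scaled (r x : R) : R := r * vallee (r * x).

Lemma integrable_vallee_scaled r : r != 0 -> mu.-integrable setT (EFin \o vallee_scaled r).
Proof.
move=> r0; have := integrableZl measurableT r
  (integrable_scales (scales_dilate r0) integrable_vallee).
by apply: eq_integrable.
Qed.

Lemma vallee_scaled_fourier (r t : R) : 0 < r -> `|t| <= r ->
  cI mu (fun x => expi (t * x) * (vallee_scaled r x)%:C) = 1.
Proof.
move=> r0 tr; have rn0 : r != 0 by rewrite gt_eqF.
have tr1 : `|t / r| <= 1 by rewrite normrM normfV (gtr0_norm r0) ler_pdivrMr// mul1r.
rewrite -(vallee_fourier tr1) [RHS](cI_scales (scales_dilate rn0)); last exact: (cintg_expiM (t / r) integrable_vallee).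
rewrite gtr0_norm// -cIZ; last first.
  exact: (cintg_scales (scales_dilate rn0) (cintg_expiM (t / r) integrable_vallee)).
apply: eq_cI => x; rewrite /vallee_scaled rmorphM /= mulrCA.
by rewrite (_ : t / r * (r * x) = t * x)//; field.
Qed.

Definition dirichlet (N : nat) (t : R) : R[i] := \sum_(a < N) expi (a%:R * t).

(* [\sum_(a, b < N) expi ((a - b) t)], the square modulus of the Dirichlet sum. *)
Definition dirichlet2 (N : nat) (t : R) : R[i] := dirichlet N t * dirichlet N (- t).

Lemma dirichletE N t : dirichlet N t * (expi t - 1) = expi (N%:R * t) - 1.
Proof.
elim: N => [|N ih]; first by rewrite /dirichlet big_ord0 !mul0r expi0 subrr.
rewrite /dirichlet big_ord_recr /= mulrDl ih -addn1 natrD mulrDl mul1r expiD; ring.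
Qed.

Let expi_sub1 (t : R) : (expi t - 1) * (expi (- t) - 1) = (2 * (1 - cos t))%:C.
Proof.
have -> : (expi t - 1) * (expi (- t) - 1) = expi t * expi (- t) + 1 - (expi t + expi (- t)) by ring.
rewrite expiK; apply: complexE2; rewrite ?cReD ?cImD ?cReN ?cImN ?cReD ?cImD /= ?cosN ?sinN; ring.
Qed.

(** Multiplied by [t^2], this says that the square modulus of the geometric sum times [1 - cos t] is
    [1 - cos (N t)]. The identity both splits a wide Fejer kernel into narrow modulated ones and
    yields the approximations [fejer_trig]. *)
Lemma dirichlet2_fejer N t :
  dirichlet2 N t * (fejer t)%:C = (N%:R ^+ 2 * fejer (N%:R * t))%:C.
Proof.
have [->|t0] := eqVneq t 0.
  rewrite mulr0 /dirichlet2 /dirichlet oppr0.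
  under eq_bigr do rewrite mulr0 expi0.
  by rewrite sumr_const card_ord [RHS]rmorphM [X in _ = X * _]rmorphXn rmorph_nat expr2.
have t2 : (t ^+ 2)%:C != 0 :> R[i] by rewrite fmorph_eq0 expf_neq0.
apply: (mulfI t2); rewrite mulrCA -!rmorphM /= fejerE.
have -> : t ^+ 2 * (N%:R ^+ 2 * fejer (N%:R * t)) = 1 - cos (N%:R * t).
  by rewrite -fejerE; ring.
have n2 : (2 : R)%:C != 0 :> R[i] by rewrite fmorph_eq0.
apply: (mulfI n2); rewrite mulrCA -!rmorphM /= -!expi_sub1 -mulrN -!dirichletE /dirichlet2; ring.
Qed.

Lemma dirichlet2_sum N t :
  dirichlet2 N t = \sum_(p : 'I_N * 'I_N) expi ((p.1%:R - p.2%:R) * t).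
Proof.
rewrite /dirichlet2 /dirichlet big_distrlr /= pair_bigA /=.
by apply: eq_bigr => p _; rewrite -expiD; congr expi; ring.
Qed.

Lemma nrm1_dirichlet2 N t : nrm1 (dirichlet2 N t) <= 4%:R * N%:R ^+ 2.
Proof.
have h s : nrm1 (dirichlet N s) <= 2 * N%:R.
  apply: le_trans (nrm1_sum _ _ _) _.
  apply: le_trans (ler_sum _ (fun i _ => nrm1_expi _)) _.
  by rewrite sumr_const card_ord mulr_natr.
apply: le_trans (nrm1M _ _) _.
apply: le_trans (ler_pM (nrm1_ge0 _) (nrm1_ge0 _) (h _) (h _)) _.
by rewrite le_eqVlt; apply/orP; left; apply/eqP; ring.
Qed.

Definition fejer_scaled (l x : R) : R := l * fejer (l * x).

Lemma fejer_scaled_ge0 l x : 0 <= l -> 0 <= fejer_scaled l x.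
Proof. by move=> l0; rewrite mulr_ge0// fejer_ge0. Qed.

Lemma integrable_fejer_scaled l : l != 0 -> mu.-integrable setT (EFin \o fejer_scaled l).
Proof.
move=> l0; have := integrableZl measurableT l
  (integrable_scales (scales_dilate l0) (integrable_fejer R)).
by apply: eq_integrable.
Qed.

Lemma fejer_scaled_natM N l x : (0 < N)%N ->
  (fejer_scaled (N%:R * l) x)%:C = (N%:R^-1)%:C * dirichlet2 N (l * x) * (fejer_scaled l x)%:C.
Proof.
move=> N0; have Nn0 : N%:R != 0 :> R by rewrite pnatr_eq0 -lt0n.
transitivity ((N%:R^-1 * l)%:C * (dirichlet2 N (l * x) * (fejer (l * x))%:C)).
  rewrite dirichlet2_fejer -rmorphM; congr (_%:C).
  by rewrite /fejer_scaled (_ : N%:R * l * x = N%:R * (l * x)); [field|ring].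
by rewrite /fejer_scaled !rmorphM; ring.
Qed.

(** A trigonometric polynomial with frequencies in [[-l, l]]. By [dirichlet2_fejer] it is
    [fejer_scaled l x] times [fejer 0 / fejer (l x / N)] where the denominator is nonzero, so it
    tends to [fejer_scaled l x] as [N] grows. *)
Definition fejer_trig (N : nat) (l x : R) : R[i] :=
  (l / 2 / N%:R ^+ 2)%:C * dirichlet2 N (l * x / N%:R).

Lemma nrm1_fejer_trig N l x : (0 < N)%N -> 0 < l -> nrm1 (fejer_trig N l x) <= 2 * l.
Proof.
move=> N0 l0; have Nn0 : 0 < N%:R :> R by rewrite ltr0n.
rewrite /fejer_trig nrm1Z gtr0_norm; last by rewrite !divr_gt0// exprn_gt0.
apply: le_trans (ler_wpM2l _ (nrm1_dirichlet2 _ _)) _.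
  by rewrite ltW// !divr_gt0// exprn_gt0.
by rewrite le_eqVlt; apply/orP; left; apply/eqP; field; rewrite gt_eqF.
Qed.

Lemma fejer_trig_cvg l x : 0 < l ->
  nrm1 (fejer_trig N.+1 l x - (fejer_scaled l x)%:C) @[N --> \oo] --> 0.
Proof.
move=> l0.
pose th (N : nat) := l * x / N.+1%:R.
have thE N : nrm1 (fejer_trig N.+1 l x - (fejer_scaled l x)%:C) <= 4%:R * l * `|fejer 0 - fejer (th N)|.
  have Nn0 : N.+1%:R != 0 :> R by rewrite pnatr_eq0.
  have -> : (fejer_scaled l x)%:C = (l / N.+1%:R ^+ 2 * fejer (th N))%:C * dirichlet2 N.+1 (th N).
    rewrite [in RHS]rmorphM -mulrA [X in _ = _ * X]mulrC dirichlet2_fejer -rmorphM.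
    congr (_%:C); rewrite /fejer_scaled (_ : N.+1%:R * th N = l * x); last by rewrite /th; field.
    by field.
  rewrite /fejer_trig -/(th N) -mulrBl -rmorphB /= nrm1Z.
  have -> : l / 2 / N.+1%:R ^+ 2 - l / N.+1%:R ^+ 2 * fejer (th N) =
    l / N.+1%:R ^+ 2 * (fejer 0 - fejer (th N)) by rewrite fejer0; field.
  rewrite normrM gtr0_norm ?divr_gt0 ?exprn_gt0//.
  apply: le_trans (ler_wpM2l _ (nrm1_dirichlet2 _ _)) _.
    by rewrite mulr_ge0// ltW// divr_gt0// exprn_gt0.
  by rewrite le_eqVlt; apply/orP; left; apply/eqP; field.
have th0 : th N @[N --> \oo] --> 0.
  rewrite -(mulr0 (l * x)); apply: cvgM; first exact: cvg_cst.
  exact: cvg_harmonic.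
have f0 : fejer (th N) @[N --> \oo] --> fejer (0 : R).
  exact: (@continuous_cvg _ _ _ _ _ th (@fejer R) 0 (@continuous_fejer R 0) th0).
apply: (@squeeze_cvgr _ _ _ _ (cst 0) (fun N => 4%:R * l * `|fejer 0 - fejer (th N)|)).
- by apply: nearW => N; rewrite nrm1_ge0 thE.
- exact: cvg_cst.
- rewrite -[X in _ --> X](mulr0 (4%:R * l)); apply: cvgM; first exact: cvg_cst.
  have := cvg_norm (cvgB (cvg_cst (fejer (0 : R))) f0).
  by rewrite subrr normr0; apply.
Qed.

(** All frequencies [th p] have absolute value at most [|c| + l <= r], where the transform of
    [vallee_scaled r] is [1]; so each exponential of the finite sum is reproduced separately. *)
Lemma vallee_trig_repr (N : nat) (c l r x : R) : (0 < N)%N -> 0 < l -> 0 < r -> `|c| + l <= r ->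
  cI mu (fun z => (expi (- (c * (x - z))) * fejer_trig N l (x - z)) * (vallee_scaled r z)%:C) =
  expi (- (c * x)) * fejer_trig N l x.
Proof.
move=> N0 l0 r0 clr.
have Nn0 : 0 < N%:R :> R by rewrite ltr0n.
pose th (p : 'I_N * 'I_N) := (p.1%:R - p.2%:R) * (l / N%:R) - c.
have E y : expi (- (c * y)) * fejer_trig N l y =
    \sum_p (l / 2 / N%:R ^+ 2)%:C * expi (th p * y).
  rewrite /fejer_trig dirichlet2_sum mulrCA -mulr_sumr; congr (_ * _).
  rewrite mulr_sumr; apply: eq_bigr => p _; rewrite -expiD; congr expi.
  by rewrite /th; field; rewrite gt_eqF.
have thr p : `|- th p| <= r.
  apply: le_trans clr; rewrite normrN /th; apply: le_trans (ler_normB _ _) _.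
  rewrite addrC lerD2l normrM (gtr0_norm (_ : 0 < l / N%:R)) ?divr_gt0//.
  rewrite mulrCA ler_piMr// ?(ltW l0)// ler_pdivrMr// mul1r ler_norml.
  have [a1 b1] : p.1%:R <= N%:R :> R /\ p.2%:R <= N%:R :> R by rewrite !ler_nat; split; apply: ltnW; exact: ltn_ord.
  have [a0 b0] : 0 <= p.1%:R :> R /\ 0 <= p.2%:R :> R by rewrite !ler0n.
  by apply/andP; split; lra.
have iW t : cintg mu (fun z => expi (t * z) * (vallee_scaled r z)%:C).
  by apply: cintg_expiM; apply: integrable_vallee_scaled; rewrite gt_eqF.
transitivity (cI mu (fun z => \sum_p ((l / 2 / N%:R ^+ 2)%:C * expi (th p * x)) *
    (expi (- th p * z) * (vallee_scaled r z)%:C))).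
  apply: eq_cI => z; rewrite E mulr_suml; apply: eq_bigr => p _.
  by rewrite mulrA -[in RHS](mulrA _%:C) -expiD mulNr -mulrBr.
rewrite cI_sum; last by move=> p; exact: cintgZ.
rewrite E; apply: eq_bigr => p _; rewrite cIZ//.
by rewrite vallee_scaled_fourier ?mulr1.
Qed.

(** Both sides of [vallee_trig_repr] converge as [N] grows, the integrals by dominated convergence.
    This replaces writing the Fejer kernel as an integral of exponentials over [[-l, l]]. *)
Lemma vallee_fejer_repr (c l r x : R) : 0 < l -> 0 < r -> `|c| + l <= r ->
  cI mu (fun z => (expi (- (c * (x - z))) * (fejer_scaled l (x - z))%:C) * (vallee_scaled r z)%:C) =
  expi (- (c * x)) * (fejer_scaled l x)%:C.
Proof.
move=> l0 r0 clr.
have mx : measurable_fun setT (fun z : R => x - z) by apply: measurable_funB.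
have me : cmeas (fun z : R => expi (- (c * (x - z)))).
  by apply: cmeas_expi; apply: measurable_funN; exact: measurable_funM.
have iW : mu.-integrable setT (EFin \o vallee_scaled r).
  by apply: integrable_vallee_scaled; rewrite gt_eqF.
have iWc := cintg_real iW.
have mW := cintg_cmeas iWc.
have mT N : cmeas (fun z : R => fejer_trig N l (x - z)).
  rewrite /fejer_trig; apply: cmeasM; first exact: cmeas_cst.
  have md N' (s : R -> R) : measurable_fun setT s -> cmeas (fun z : R => dirichlet N' (s z)).
    move=> ms; rewrite /dirichlet; elim: (index_enum _) => [|i r' ih].
      by under eq_fun do rewrite big_nil; exact: cmeas_cst.
    under eq_fun do rewrite big_cons; apply: cmeasD => //; apply: cmeas_expi.
    exact: measurable_funM.
  have m1 : measurable_fun setT (fun z : R => l * (x - z) / N%:R).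
    by apply: measurable_funM => //; exact: measurable_funM.
  by rewrite /dirichlet2; apply: cmeasM; apply: md => //; exact: measurable_funN.
have mF : cmeas (fun z : R => (fejer_scaled l (x - z))%:C).
  apply: cmeas_real; apply: measurable_funM => //.
  by apply: (measurableT_comp (@measurable_fejer R)); exact: measurable_funM.
have bF y : nrm1 (fejer_scaled l y)%:C <= l.
  rewrite nrm1r ger0_norm ?fejer_scaled_ge0 ?(ltW l0)//.
  rewrite /fejer_scaled ger_pMr//; apply: le_trans (fejer_le_half _) _.
  by rewrite invf_le1// ler1n.
apply: (@nrm1_cvg_unique _ (fun N => cI mu (fun z =>
  (expi (- (c * (x - z))) * fejer_trig N.+1 l (x - z)) * (vallee_scaled r z)%:C))).
  (* The majorant collects [2] from the phase and [2 * l] from [nrm1_fejer_trig]. *)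
  apply: (@cI_dct _ _ _ mu (fun N z => (expi (- (c * (x - z))) * fejer_trig N.+1 l (x - z)) *
    (vallee_scaled r z)%:C) _ (fun z => 4%:R * l * `|vallee_scaled r z|)).
  - by move=> N; exact: (cmeasM (cmeasM me (mT N.+1)) mW).
  - exact: (cmeasM (cmeasM me mF) mW).
  - move=> z; apply: (@squeeze_cvgr _ _ _ _ (cst 0) (fun N =>
      nrm1 (fejer_trig N.+1 l (x - z) - (fejer_scaled l (x - z))%:C) * (2 * `|vallee_scaled r z|))).
    + apply: nearW => N; rewrite nrm1_ge0 /= -mulrBl -mulrBr.
      rewrite [X in nrm1 (X * _)]mulrC -mulrA; apply: le_trans (nrm1M _ _) _.
      rewrite ler_wpM2l ?nrm1_ge0//; apply: le_trans (nrm1M _ _) _.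
      by rewrite nrm1r ler_wpM2r// nrm1_expi.
    + exact: cvg_cst.
    + rewrite -[X in _ --> X](mul0r (2 * `|vallee_scaled r z|)).
      by apply: cvgM; [exact: fejer_trig_cvg|exact: cvg_cst].
  - by apply: eq_integrable (integrableZl measurableT (4%:R * l) (integrable_norm iW)).
  - move=> N z; apply: le_trans (nrm1M _ _) _; rewrite nrm1r ler_wpM2r//.
    apply: le_trans (nrm1M _ _) _.
    rewrite (_ : 4%:R * l = 2 * (2 * l)); last by ring.
    by rewrite ler_pM ?nrm1_ge0 ?nrm1_expi// nrm1_fejer_trig.
  - apply: (@cintgMb _ _ _ mu _ _ (2 * l)) => //; first exact: (cmeasM me mF).
    move=> z; apply: le_trans (nrm1M _ _) _.
    by rewrite ler_pM ?nrm1_ge0 ?nrm1_expi.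
apply: (@squeeze_cvgr _ _ _ _ (cst 0) (fun N =>
   2 * nrm1 (fejer_trig N.+1 l x - (fejer_scaled l x)%:C))).
- apply: nearW => N; rewrite nrm1_ge0 /= vallee_trig_repr// -mulrBr.
  by apply: le_trans (nrm1M _ _) _; rewrite ler_wpM2r ?nrm1_ge0// nrm1_expi.
- exact: cvg_cst.
- rewrite -[X in _ --> X](mulr0 2).
  by apply: cvgM; [exact: cvg_cst|exact: fejer_trig_cvg].
Qed.

End kernels_line.

Lemma expr_prod_ord (A : pzSemiRingType) (a : A) k : a ^+ k = \prod_(i < k) a.
Proof. by rewrite prodr_const card_ord. Qed.

(** * Tensor-product kernels and their translation moduli *)

Section kernels_row.
Context (R : realType) (n : nat).
Local Notation V := 'rV[R]_n.
Local Notation mu := (leb R n).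
Local Notation C := (fejer_mass R).

Definition rtensor (u : 'I_n -> R -> R) (x : V) : R := \prod_i u i (x ord0 i).

Lemma rtensorE u x : (rtensor u x)%:C = tensor (fun i y => (u i y)%:C) x.
Proof. by rewrite /rtensor /tensor rmorph_prod. Qed.

Lemma measurable_rtensor u : (forall i, measurable_fun setT (u i)) -> measurable_fun setT (rtensor u).
Proof. exact: measurable_tensor. Qed.

Lemma integrable_rtensor u : (forall i, (@lebesgue_measure R).-integrable setT (EFin \o u i)) ->
  mu.-integrable setT (EFin \o rtensor u).
Proof. exact: integrable_tensor. Qed.

Lemma cvg_rtensor u (s : nat -> V) (x : V) : (forall i, continuous (u i)) ->
  (forall i, s k ord0 i @[k --> \oo] --> x ord0 i) ->
  rtensor u (s k) @[k --> \oo] --> rtensor u x.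
Proof.
move=> cu sx; rewrite /rtensor; elim: (index_enum _) => [|i r ih].
  by rewrite big_nil; under eq_fun do rewrite big_nil; exact: cvg_cst.
rewrite big_cons; under eq_fun do rewrite big_cons.
apply: cvgM => //.
exact: (@continuous_cvg _ _ _ _ _ (fun k => s k ord0 i) (u i) _ (cu i _) (sx i)).
Qed.

(** The one-dimensional factors for which the tensor product is integrable and moves continuously in
    [L^1] under translation. *)
Definition lorentz_dominated (u : R -> R) := continuous u /\
  exists D : R, 0 <= D /\ forall x, `|u x| <= D * lorentz x.

(** The constant comes from [x^2 <= 2 * (x - s)^2 + 2 * s^2] together with [s^2 <= 1]. *)
Lemma lorentz_shift (x s : R) : `|s| <= 1 -> lorentz (x - s) <= 3%:R * lorentz x.
Proof.
rewrite ler_norml => /andP[s1 s2]; rewrite /lorentz.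
have p1 : 0 < 1 + x ^+ 2 by rewrite ltr_pwDl// sqr_ge0.
have p2 : 0 < 1 + (x - s) ^+ 2 by rewrite ltr_pwDl// sqr_ge0.
rewrite -div1r ler_pdivrMr// mulrAC ler_pdivlMr// mul1r.
have : 0 <= (2 * (x - s) - s) ^+ 2 + (x - s) ^+ 2 by rewrite addr_ge0// sqr_ge0.
have : s ^+ 2 <= 1 by nra.
have : 0 <= (x - s *+ 2) ^+ 2 by rewrite sqr_ge0.
rewrite !expr2 mulr2n; nra.
Qed.

Definition shift_modulus (H : V -> R) (z : V) : R := \int[mu]_x `|H x - H (x - z)|.

Section dominated.
Variables (u : 'I_n -> R -> R) (du : forall i, lorentz_dominated (u i)).

Let mu_ i : measurable_fun setT (u i).
Proof. by apply: continuous_measurable_fun; have [] := du i. Qed.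

Let iu i : (@lebesgue_measure R).-integrable setT (EFin \o u i).
Proof. by have [_ [D [_ uD]]] := du i; apply: (integrable_le_lorentz (D := D)). Qed.

Lemma integrable_dominated : mu.-integrable setT (EFin \o rtensor u).
Proof. exact: integrable_rtensor. Qed.

Lemma integrable_dominated_shift z : mu.-integrable setT (EFin \o (fun x => rtensor u (x - z))).
Proof. exact: (integrable_scales (scales_row_shift (- z)) integrable_dominated). Qed.

Lemma shift_modulus_ge0 z : 0 <= shift_modulus (rtensor u) z.
Proof. exact: Rintegral_ge0. Qed.

Lemma shift_modulus_le z :
  shift_modulus (rtensor u) z <= 2 * \int[mu]_x `|rtensor u x|.
Proof.
have i1 := integrable_norm integrable_dominated.
have i2 := integrable_norm (integrable_dominated_shift z).
have -> : 2 * \int[mu]_x `|rtensor u x| =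
    \int[mu]_x (`|rtensor u x| + `|rtensor u (x - z)|).
  rewrite RintegralD// [X in _ = _ + X](_ : _ = \int[mu]_x `|rtensor u x|); first by ring.
  by rewrite (Rintegral_scales (scales_row_shift (- z)) i1) mul1r.
apply: le_Rintegral => //.
- apply: (@integrable_norm _ _ _ _ _ (fun x => rtensor u x - rtensor u (x - z))).
  by apply: eq_integrable (integrableB measurableT integrable_dominated (integrable_dominated_shift z)).
- by apply: eq_integrable (integrableD measurableT i1 i2).
- by move=> x _; exact: ler_normB.
Qed.

(** Shifts with entries at most [1] leave all translates below one integrable majorant [H], so the
    pointwise continuity of the factors passes to [L^1] by dominated convergence. *)
Lemma shift_modulus_cvg0 (s : nat -> V) : (forall k i, `|s k ord0 i| <= 1) ->
  (forall i, s k ord0 i @[k --> \oo] --> (0 : R)) ->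
  shift_modulus (rtensor u) (s k) @[k --> \oo] --> (0 : R).
Proof.
move=> s1 s0.
have [D DP] : {D : 'I_n -> R & forall i, 0 <= D i /\ forall x, `|u i x| <= D i * lorentz x}.
  by apply: (@choice _ _ (fun i D => 0 <= D /\ forall x, `|u i x| <= D * lorentz x)) => i; have [] := du i.
pose H (x : V) := rtensor (fun i y => 3%:R * D i * lorentz y) x.
have iH : mu.-integrable setT (EFin \o H).
  apply: integrable_rtensor => i.
  by apply: eq_integrable (integrableZl measurableT (3%:R * D i) (integrable_lorentz R)).
have bound (x z : V) : (forall i, `|z ord0 i| <= 1) -> `|rtensor u (x - z)| <= H x.
  move=> z1; rewrite /rtensor normr_prod; apply: ler_prod => i _; rewrite normr_ge0 /=.
  have [D0 uD] := DP i; apply: le_trans (uD _) _.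
  by rewrite -mulrA mulrCA ler_wpM2l// !mxE lorentz_shift.
have -> : (0 : R) = \int[mu]_x (fun=> 0 : R) x by rewrite /Rintegral integral0.
have mr := measurable_rtensor mu_.
apply: (@Rintegral_dct _ _ _ mu _ _ (fun x => 2 * H x)).
- move=> k; apply: measurableT_comp => //; apply: measurable_funB => //.
  exact: (measurableT_comp mr (measurable_addr (- s k))).
- exact: measurable_cst.
- move=> x; rewrite -(normr0 R) -(subrr (rtensor u x)).
  apply: cvg_norm; apply: cvgB; first exact: cvg_cst.
  apply: cvg_rtensor => [i|i]; first by have [] := du i.
  rewrite (_ : (fun k => _) = (fun k => x ord0 i - s k ord0 i)); last first.
    by apply/funext => k; rewrite !mxE.
  by rewrite -[X in _ --> X]subr0; apply: cvgB => //; exact: cvg_cst.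
- by apply: eq_integrable (integrableZl measurableT 2 iH).
- move=> k x; rewrite normr_id; apply: le_trans (ler_normB _ _) _.
  rewrite mulr2n mulrDl !mul1r lerD//; last exact: bound.
  by rewrite -{1}(subr0 x); apply: bound => i; rewrite mxE normr0 ler01.
Qed.

Lemma shift_modulus_measurable :
  measurable_fun setT (shift_modulus (rtensor u)).
Proof.
have mr := measurable_rtensor mu_.
apply: (@measurable_int_param _ _ _ _ _ mu
  (fun p : V * V => `|rtensor u p.2 - rtensor u (p.2 - p.1)|)).
apply: measurableT_comp => //; apply: measurable_funB.
  exact: (measurableT_comp mr measurable_snd).
apply: (measurableT_comp mr); apply: measurable_rowP => i; under eq_fun do rewrite !mxE.
have mc := @measurable_coord R n i.
apply: measurable_funB; first exact: (measurableT_comp mc measurable_snd).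
exact: (measurableT_comp mc measurable_fst).
Qed.

End dominated.

Definition vallee_row (r : R) : V -> R := rtensor (fun=> vallee_scaled r).

Lemma vallee_dominated : lorentz_dominated (@vallee R).
Proof. by split; [exact: continuous_vallee|exact: vallee_le]. Qed.

Lemma integrable_vallee_row r : r != 0 -> mu.-integrable setT (EFin \o vallee_row r).
Proof. by move=> r0; apply: integrable_rtensor => i; exact: integrable_vallee_scaled. Qed.

Lemma vallee_row_scale r x : vallee_row r x = r ^+ n * rtensor (fun=> @vallee R) (r *: x).
Proof.
rewrite /vallee_row /rtensor /vallee_scaled big_split /= prodr_const card_ord.
by congr (_ * _); apply: eq_bigr => i _; rewrite mxE.
Qed.

Local Notation Omega := (shift_modulus (rtensor (fun=> @vallee R))).

(** The dilation [x |-> r^n H (r x)] preserves the [L^1] norm and rescales shifts. So a fixed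
    translation hardly affects the kernel when [r] is small; both the contraction and the constancy
    argument rest on this. *)
Lemma vallee_row_modulus r z : 0 < r ->
  shift_modulus (vallee_row r) z = Omega (r *: z).
Proof.
move=> r0; have rn0 : r != 0 by rewrite gt_eqF.
have dv : forall i : 'I_n, lorentz_dominated (@vallee R) := fun=> vallee_dominated.
rewrite /shift_modulus.
have i1 : mu.-integrable setT (EFin \o (fun x => `|rtensor (fun=> @vallee R) x -
    rtensor (fun=> @vallee R) (x - r *: z)|)).
  apply: (@integrable_norm _ _ _ _ _ (fun x => rtensor (fun=> @vallee R) x -
    rtensor (fun=> @vallee R) (x - r *: z))).
  by apply: eq_integrable (integrableB measurableT (integrable_dominated dv)
    (integrable_dominated_shift dv (r *: z))).
rewrite [RHS](Rintegral_scales (scales_row_affine 0 rn0) i1) -RintegralZl//; last first.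
  exact: (integrable_scales (scales_row_affine 0 rn0) i1).
apply: eq_Rintegral => x _; rewrite !vallee_row_scale addr0 -mulrBr normrM normrX.
by rewrite scalerBr.
Qed.

Definition fejer_row (l : R) : V -> R := rtensor (fun=> fejer_scaled l).

(** The phase has a minus sign because [conv] reflects the kernel: [conv f (fejer_mod l xi)] retains
    the frequencies of [f] near [xi] itself. *)
Definition fejer_mod (l : R) (xi x : V) : R[i] := expi (- dotRn x xi) * (fejer_row l x)%:C.

Definition vallee_mod (l : R) (xi x : V) : R[i] := expi (- dotRn x xi) * (vallee_row l x)%:C.

Lemma expi_dot (x xi : V) : expi (- dotRn x xi) = \prod_i expi (- (xi ord0 i * x ord0 i)).
Proof.
by rewrite /dotRn -sumrN expi_sum; apply: eq_bigr => i _; rewrite mulrC.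
Qed.

Lemma fejer_modE l xi x : fejer_mod l xi x =
  tensor (fun i y => expi (- (xi ord0 i * y)) * (fejer_scaled l y)%:C) x.
Proof. by rewrite /fejer_mod expi_dot rtensorE /tensor -big_split. Qed.

Lemma dotRnDl (x y xi : V) : dotRn (x + y) xi = dotRn x xi + dotRn y xi.
Proof. by rewrite /dotRn -big_split /=; apply: eq_bigr => i _; rewrite mxE mulrDl. Qed.

Lemma dotRnNl (x xi : V) : dotRn (- x) xi = - dotRn x xi.
Proof. by rewrite /dotRn -sumrN; apply: eq_bigr => i _; rewrite mxE mulNr. Qed.

Lemma dotRnNr (x xi : V) : dotRn x (- xi) = - dotRn x xi.
Proof. by rewrite /dotRn -sumrN; apply: eq_bigr => i _; rewrite mxE mulrN. Qed.

Lemma measurable_dotRn (xi : V) : measurable_fun setT (fun x : V => dotRn x xi).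
Proof.
rewrite /dotRn; apply: measurable_sum => i.
by apply: measurable_funM => //; exact: measurable_coord.
Qed.

Lemma bmeas_expi_dot (xi : V) : bmeas (fun x : V => expi (dotRn x xi)) 2.
Proof.
by split; [apply: cmeas_expi; exact: measurable_dotRn|move=> x; exact: nrm1_expi].
Qed.

Lemma bmeas_expiN_dot (xi : V) : bmeas (fun x : V => expi (- dotRn x xi)) 2.
Proof.
split; [apply: cmeas_expi|by move=> x; exact: nrm1_expi].
by apply: measurable_funN; exact: measurable_dotRn.
Qed.

Lemma cintg_fejer_row l : l != 0 -> cintg mu (fun x => (fejer_row l x)%:C).
Proof.
move=> l0; apply: cintg_real; apply: integrable_rtensor => i.
exact: integrable_fejer_scaled.
Qed.

Lemma cintg_fejer_mod l xi : l != 0 -> cintg mu (fejer_mod l xi).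
Proof. by move=> l0; have [me be] := bmeas_expiN_dot xi; apply: cintgMb be (cintg_fejer_row l0). Qed.

Lemma cintg_vallee_row l : l != 0 -> cintg mu (fun x => (vallee_row l x)%:C).
Proof. by move=> l0; apply: cintg_real; exact: integrable_vallee_row. Qed.

Lemma cintg_vallee_mod l xi : l != 0 -> cintg mu (vallee_mod l xi).
Proof. by move=> l0; have [me be] := bmeas_expiN_dot xi; apply: cintgMb be (cintg_vallee_row l0). Qed.

Lemma bmeas_fejer_mod l xi : 0 < l -> bmeas (fejer_mod l xi) (2 * l ^+ n).
Proof.
move=> l0; split; first by apply: cintg_cmeas; apply: cintg_fejer_mod; rewrite gt_eqF.
move=> x; apply: le_trans (nrm1M _ _) _; rewrite nrm1r.
apply: ler_pM => //; [exact: nrm1_ge0|exact: nrm1_expi|].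
rewrite /fejer_row /rtensor normr_prod expr_prod_ord.
apply: ler_prod => i _; rewrite normr_ge0 /=.
rewrite ger0_norm ?fejer_scaled_ge0 ?(ltW l0)//.
rewrite /fejer_scaled ger_pMr//; apply: le_trans (fejer_le_half _) _.
by rewrite invf_le1// ler1n.
Qed.

(** In each coordinate this is [vallee_fejer_repr] with [c = xi_i], and the integral of a tensor
    product factorises. The condition places the cube of half-width [l] around [xi] inside the cube
    of half-width [r] around [0]. *)
Lemma fejer_mod_vallee_row l r (xi : V) : 0 < l -> 0 < r -> (forall i, `|xi ord0 i| + l <= r) ->
  forall z, cI mu (fun x => fejer_mod l xi (z - x) * (vallee_row r x)%:C) = fejer_mod l xi z.
Proof.
move=> l0 r0 xir z.
rewrite [RHS]fejer_modE /tensor.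
under [RHS]eq_bigr => i _ do rewrite -(vallee_fejer_repr _ l0 r0 (xir i)).
rewrite -cI_tensor.
  apply: eq_cI => x; rewrite fejer_modE rtensorE /tensor -big_split /=.
  by apply: eq_bigr => i _; rewrite !mxE.
move=> i.
have mx : measurable_fun setT (fun y : R => z ord0 i - y) by apply: measurable_funB.
have rn0 : r != 0 by rewrite gt_eqF.
apply: (@cintgMb _ _ _ (@lebesgue_measure R) _ _ (2 * l)); last exact: cintg_real (integrable_vallee_scaled rn0).
  apply: cmeasM.
    by apply: cmeas_expi; apply: measurable_funN; exact: measurable_funM.
  apply: cmeas_real; apply: measurable_funM => //.
  by apply: (measurableT_comp (@measurable_fejer R)); exact: measurable_funM.
move=> y; apply: le_trans (nrm1M _ _) _; rewrite nrm1r.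
apply: ler_pM => //; [exact: nrm1_ge0|exact: nrm1_expi|].
rewrite ger0_norm ?fejer_scaled_ge0 ?(ltW l0)//.
rewrite /fejer_scaled ger_pMr//; apply: le_trans (fejer_le_half _) _.
by rewrite invf_le1// ler1n.
Qed.

Lemma fejer_mod_vallee_mod l xi : 0 < l ->
  forall z, cI mu (fun x => fejer_mod l xi (z - x) * vallee_mod l xi x) = fejer_mod l xi z.
Proof.
move=> l0 z; have ln0 : l != 0 by rewrite gt_eqF.
(* At frequency [0] with [r = l] the cube condition is an equality; the phase belonging to [xi]
   factors out of the convolution afterwards. *)
have z0 : forall i, `|(0 : V) ord0 i| + l <= l by move=> i; rewrite mxE normr0 add0r.
have f0 x : fejer_mod l 0 x = (fejer_row l x)%:C.
  rewrite /fejer_mod (_ : dotRn x 0 = 0) ?oppr0 ?expi0 ?mul1r//.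
  by rewrite /dotRn big1// => i _; rewrite mxE mulr0.
have := fejer_mod_vallee_row l0 l0 z0 z; under eq_cI do rewrite f0; rewrite f0 => e.
rewrite /fejer_mod -e -cIZ.
  apply: eq_cI => x; rewrite /vallee_mod mulrACA -expiD; congr (_ * _); congr expi.
  by rewrite dotRnDl dotRnNl; ring.
apply: (@cintgMb _ _ _ mu _ _ (2 * l ^+ n)); last exact: cintg_vallee_row.
  have [m0 _] := bmeas_fejer_mod 0 l0.
  under eq_fun do rewrite -f0; apply: (cmeas_comp m0).
  apply: measurable_rowP => i; under eq_fun do rewrite !mxE.
  by apply: measurable_funB => //; exact: measurable_coord.
by move=> x; rewrite -f0; case: (bmeas_fejer_mod 0 l0).
Qed.

(** Translation by [z] multiplies the phase of the kernel by exactly [expi (dotRn z xi)]. Only the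
    envelope [vallee_row l] differs, so the bound does not depend on [xi]; the factor [2] is the
    [nrm1] bound of a phase. *)
Lemma vallee_mod_shift l xi z : 0 < l ->
  \int[mu]_x nrm1 (expi (dotRn z xi) * vallee_mod l xi x - vallee_mod l xi (x - z)) <=
  2 * Omega (l *: z).
Proof.
move=> l0; have ln0 : l != 0 by rewrite gt_eqF.
rewrite -vallee_row_modulus// /shift_modulus.
have i1 : mu.-integrable setT (EFin \o (fun x => `|vallee_row l x - vallee_row l (x - z)|)).
  apply: (@integrable_norm _ _ _ _ _ (fun x => vallee_row l x - vallee_row l (x - z))).
  apply: eq_integrable (integrableB measurableT (integrable_vallee_row ln0)
    (integrable_scales (scales_row_shift (- z)) (integrable_vallee_row ln0))) => //.
rewrite -RintegralZl//; apply: le_Rintegral => //.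
- apply: cintg_nrm1; apply: cintgB; first by apply: cintgZ; exact: cintg_vallee_mod.
  by apply: cintg_shift; exact: cintg_vallee_mod.
- exact: (integrableZl measurableT 2 i1).
- move=> x _.
  have -> : expi (dotRn z xi) * vallee_mod l xi x - vallee_mod l xi (x - z) =
    expi (dotRn z xi - dotRn x xi) * (vallee_row l x - vallee_row l (x - z))%:C.
    rewrite rmorphB /= mulrBr /vallee_mod mulrA -expiD; congr (_ - expi _ * _).
    by rewrite dotRnDl dotRnNl; ring.
  apply: le_trans (nrm1M _ _) _; rewrite nrm1r.
  by rewrite ler_wpM2r// nrm1_expi.
Qed.

(* The frequencies of the exponentials into which [fejer_row (N * l)] splits. *)
Definition lattice_freq (N : nat) (l : R) (p : {ffun 'I_n -> 'I_N * 'I_N}) : V :=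
  \row_i (- ((p i).1%:R - (p i).2%:R) * l).

Lemma lattice_freq_le N l p i : 0 <= l -> `|@lattice_freq N l p ord0 i| <= N%:R * l.
Proof.
move=> l0; rewrite mxE normrM (ger0_norm l0) ler_wpM2r// normrN ler_norml.
have [a1 b1] : (p i).1%:R <= N%:R :> R /\ (p i).2%:R <= N%:R :> R by rewrite !ler_nat; split; apply: ltnW; exact: ltn_ord.
have [a0 b0] : 0 <= (p i).1%:R :> R /\ 0 <= (p i).2%:R :> R by rewrite !ler0n.
by apply/andP; split; lra.
Qed.

(** Each coordinate contributes a sum over pairs; expanding the product of these sums leaves one
    modulated kernel for every family [p] of pairs. *)
Lemma fejer_row_natM N l x : (0 < N)%N -> (fejer_row (N%:R * l) x)%:C =
  \sum_(p : {ffun 'I_n -> 'I_N * 'I_N}) ((N%:R^-1) ^+ n)%:C * fejer_mod l (lattice_freq l p) x.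
Proof.
move=> N0; rewrite rtensorE /tensor.
under eq_bigr => i _.
  rewrite fejer_scaled_natM// dirichlet2_sum mulr_sumr mulr_suml.
  over.
rewrite bigA_distr_bigA /=; apply: eq_bigr => p _.
rewrite fejer_modE /tensor expr_prod_ord rmorph_prod /= -big_split /=.
apply: eq_bigr => i _; rewrite -mulrA; congr (_ * (expi _ * _)).
by rewrite mxE; ring.
Qed.

Lemma integral_fejer_row l : 0 < l -> cI mu (fun x => (fejer_row l x)%:C) = (C ^+ n)%:C.
Proof.
move=> l0; have ln0 : l != 0 by rewrite gt_eqF.
under eq_cI do rewrite rtensorE.
rewrite cI_tensor => [|i]; last exact: cintg_real (integrable_fejer_scaled ln0).
rewrite expr_prod_ord rmorph_prod /=; apply: eq_bigr => i _.
rewrite cI_real; congr (_%:C).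
rewrite /fejer_mass (Rintegral_scales (scales_dilate ln0) (integrable_fejer R)).
rewrite gtr0_norm// -RintegralZl//.
exact: (integrable_scales (scales_dilate ln0) (integrable_fejer R)).
Qed.

End kernels_row.

(** * The Tauberian argument *)

Section tauberian.
Context (R : realType) (n : nat).
Local Notation V := 'rV[R]_n.
Local Notation mu := (leb R n).
Local Notation C := (fejer_mass R).
Local Notation Omega := (shift_modulus (rtensor (fun _ : 'I_n => @vallee R))).
Implicit Types f u : V -> R[i].

Lemma shift_modulus_dilate (h : 'I_n -> R -> R) (a : R) (z : V) :
  (forall i, lorentz_dominated (h i)) -> 0 <= a ->
  shift_modulus (rtensor h) ((a / k.+1%:R) *: z) @[k --> \oo] --> (0 : R).
Proof.
move=> dh a0.
(* [K] bounds the entries of [a *: z], so from index [K] on the scaled shifts meet the size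
   condition of [shift_modulus_cvg0]. *)
have [K zK] : exists K : nat, forall i, a * `|z ord0 i| <= K%:R.
  exists (Num.bound (\sum_i a * `|z ord0 i|)) => i.
  have S0 : 0 <= \sum_i a * `|z ord0 i| by apply: sumr_ge0 => j _; exact: mulr_ge0.
  apply: le_trans (ltW (archi_boundP S0)).
  by rewrite (bigD1 i)//= lerDl sumr_ge0// => j _; exact: mulr_ge0.
rewrite -(cvg_shiftn K) /=; apply: shift_modulus_cvg0 => //.
  move=> k i; rewrite mxE normrM ger0_norm ?divr_ge0// mulrAC ler_pdivrMr// mul1r.
  by apply: le_trans (zK i) _; rewrite ler_nat leqW// leq_addl.
move=> i; rewrite (_ : (fun k => _) = (fun k => (a * z ord0 i) * (k + K).+1%:R^-1)); last first.
  by apply/funext => k; rewrite mxE mulrAC.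
rewrite -[X in _ --> X](mulr0 (a * z ord0 i)); apply: cvgM; first exact: cvg_cst.
by rewrite (cvg_shiftn K (fun k => k.+1%:R^-1 : R)); exact: cvg_harmonic.
Qed.

(** [shift_modulus_le] is uniform in [z], so a multiple of [G] is a majorant. With [G] the norm of
    [g] the limit supplies the smallness for [conv_local_vanish]; with [G] a Fejer kernel it makes
    the dilates an approximate identity. *)
Lemma integral_shift_modulus_cvg0 (h : 'I_n -> R -> R) (a : R) (G : V -> R) :
  (forall i, lorentz_dominated (h i)) -> 0 <= a -> (forall z, 0 <= G z) ->
  mu.-integrable setT (EFin \o G) ->
  (forall k, mu.-integrable setT (EFin \o
     (fun z => G z * shift_modulus (rtensor h) ((a / k.+1%:R) *: z)))) /\
  \int[mu]_z (G z * shift_modulus (rtensor h) ((a / k.+1%:R) *: z)) @[k --> \oo] --> (0 : R).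
Proof.
move=> dh a0 G0 iG; set B := 2 * \int[mu]_x `|rtensor h x|.
have mG : measurable_fun setT G by apply/measurable_EFinP; exact: measurable_int iG.
have m1 b : measurable_fun setT (fun z : V => G z * shift_modulus (rtensor h) (b *: z)).
  apply: measurable_funM => //; apply: (measurableT_comp (shift_modulus_measurable dh)).
  by have := @measurable_row_affine R n b 0; under eq_fun do rewrite addr0.
have iB : mu.-integrable setT (EFin \o (fun z => B * G z)).
  by apply: eq_integrable (integrableZl measurableT B iG).
have bd b (z : V) : `|G z * shift_modulus (rtensor h) (b *: z)| <= B * G z.
  rewrite ger0_norm ?mulr_ge0 ?shift_modulus_ge0// mulrC ler_wpM2r//.
  exact: shift_modulus_le.
split.
  move=> k; apply: le_integrable iB => //; first exact/measurable_EFinP.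
  by move=> z _; rewrite /= lee_fin; apply: le_trans (bd _ _) _; exact: ler_norm.
have -> : (0 : R) = \int[mu]_x (fun=> 0 : R) x by rewrite /Rintegral integral0.
apply: (@Rintegral_dct _ _ _ mu (fun k z => G z * shift_modulus (rtensor h) ((a / k.+1%:R) *: z)) _ _ _ _ _ iB) => //.
move=> z; rewrite -[X in _ --> X](mulr0 (G z)); apply: cvgM; first exact: cvg_cst.
exact: shift_modulus_dilate.
Qed.

Lemma conv_sumZ f M I (s : seq I) (c : I -> R[i]) (k : I -> V -> R[i]) y : bmeas f M ->
  (forall i, cintg mu (k i)) ->
  conv f (fun x => \sum_(i <- s) c i * k i x) y = \sum_(i <- s) c i * conv f (k i) y.
Proof.
move=> fM ik; rewrite /conv.
transitivity (cI mu (fun x => \sum_(i <- s) c i * (f (y + x) * k i x))).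
  by apply: eq_cI => x; rewrite mulr_sumr; apply: eq_bigr => i _; rewrite mulrCA.
rewrite cI_sum => [|i]; last by apply: cintgZ; exact: cintg_conv fM (ik i).
by apply: eq_bigr => i _; rewrite cIZ//; exact: cintg_conv fM (ik i).
Qed.

Lemma conv0 k : conv (fun=> 0 : R[i]) k = (fun=> 0 : R[i]) :> (V -> R[i]).
Proof. by apply/funext => y; rewrite /conv; under eq_cI do rewrite mul0r; exact: cI0. Qed.

(** The annulus is taken in the maximum norm, to fit cubes of frequencies. The integral is, up to a
    factor, the transform of [g] at [- xi], and one [A] serves all [xi]. *)
Definition fourier_bounded_below (g : V -> R[i]) (A a b : R) := forall xi : V,
  (forall i, `|xi ord0 i| <= b) -> (exists i, a <= `|xi ord0 i|) ->
  cI mu (fun z => expi (dotRn z xi) * g z) != 0 /\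
  nrm1 (cI mu (fun z => expi (dotRn z xi) * g z))^-1 <= A.

Lemma conv_fejer_vallee f M g A r b : bmeas f M -> 0 < r -> 0 < b -> 0 <= A ->
  cintg mu g -> conv f g =1 (fun=> 0) -> fourier_bounded_below g A (r / 2) b ->
  conv (conv f (fun x => (fejer_row b x)%:C)) (fun x => (vallee_row r x)%:C) =1
  conv f (fun x => (fejer_row b x)%:C).
Proof.
move=> fM r0 b0 A0 ig fg gA.
have dv : forall i : 'I_n, lorentz_dominated (@vallee R) by move=> i; exact: vallee_dominated.
have [iH cH] := integral_shift_modulus_cvg0 dv (ltW b0) (fun z => nrm1_ge0 (g z)) (cintg_nrm1 ig).
(* By the first condition, a lattice cube that leaves the cube of half-width [r] has a centre with
   some coordinate beyond [r / 2]. The second is the smallness required by [conv_local_vanish], with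
   [A] for the inverse transform and the [2] of [vallee_mod_shift]. *)
have [N [Nr NA]] : exists N : nat, b / N.+1%:R <= r / 2 /\
    A * (\int[mu]_z (nrm1 (g z) * Omega ((b / N.+1%:R) *: z)) * 2) <= 2^-1.
  have c1 : b / k.+1%:R @[k --> \oo] --> (0 : R).
    by rewrite -[X in _ --> X](mulr0 b); apply: cvgM; [exact: cvg_cst|exact: cvg_harmonic].
  have c2 : A * (\int[mu]_z (nrm1 (g z) * Omega ((b / k.+1%:R) *: z)) * 2) @[k --> \oo] --> (0 : R).
    rewrite -[X in _ --> X](mulr0 A) -[in X in _ --> X](mul0r (2 : R)).
    by apply: cvgM; [exact: cvg_cst|apply: cvgM => //; exact: cvg_cst].
  have e1 : \forall k \near \oo, b / k.+1%:R <= r / 2.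
    by apply: (cvgr_le _ c1); rewrite divr_gt0.
  have e2 : \forall k \near \oo, A * (\int[mu]_z (nrm1 (g z) * Omega ((b / k.+1%:R) *: z)) * 2) <= 2^-1.
    by apply: (cvgr_le _ c2); rewrite invr_gt0.
  have [N _ /(_ N (leqnn N)) []] : \forall k \near \oo, b / k.+1%:R <= r / 2 /\
    A * (\int[mu]_z (nrm1 (g z) * Omega ((b / k.+1%:R) *: z)) * 2) <= 2^-1 by near=> k; split; near: k.
  by exists N.
set l := b / N.+1%:R in Nr NA.
have l0 : 0 < l by rewrite divr_gt0.
have ln0 : l != 0 by rewrite gt_eqF.
have rn0 : r != 0 by rewrite gt_eqF.
have bE : b = N.+1%:R * l by rewrite /l mulrCA divff ?mulr1// pnatr_eq0.
have iW := cintg_vallee_row n rn0.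
have loc p : conv (conv f (fejer_mod l (lattice_freq l p))) (fun x => (vallee_row r x)%:C) =1
    conv f (fejer_mod l (@lattice_freq R n N.+1 l p)).
  set xi := lattice_freq l p.
  have iv := cintg_fejer_mod xi ln0.
  (* A kernel whose cube fits is reproduced by [vallee_row r]; any other centre lies in the annulus,
     where both sides vanish. *)
  have [small|] := pselect (forall i, `|xi ord0 i| + l <= r).
    apply: (conv_repr fM iv (bmeas_fejer_mod xi l0) iW).
    exact: fejer_mod_vallee_row.
  move=> /existsNP[i /negP]; rewrite -ltNge => big.
  suff -> : conv f (fejer_mod l xi) = (fun=> 0) by rewrite conv0.
  have xib j : `|xi ord0 j| <= b by rewrite bE; apply: lattice_freq_le; exact: ltW.
  have xia : r / 2 <= `|xi ord0 i| by lra.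
  have [G0 GA] := gA xi xib (ex_intro _ i xia).
  apply/funext; apply: (@conv_local_vanish _ _ _ _ (vallee_mod l xi) g
    (fun z => expi (dotRn z xi)) (fun z => 2 * Omega (l *: z)) (bmeas_conv fM iv)) => //.
  - exact: cintg_vallee_mod.
  - exact: bmeas_expi_dot.
  - apply: (conv_repr fM iv (bmeas_fejer_mod xi l0)); first exact: cintg_vallee_mod.
    exact: fejer_mod_vallee_mod.
  - move=> y; rewrite (conv_convC fM iv ig).
    by rewrite (eq_convl _ fg) conv0.
  - apply: eq_integrable (integrableZl measurableT 2 (iH N)) => // z _ /=.
    by rewrite -EFinM; congr EFin; ring.
  - by move=> z; exact: vallee_mod_shift.
  - apply: le_trans NA.
    rewrite (_ : \int[mu]_z (nrm1 (g z) * (2 * Omega (l *: z))) =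
      \int[mu]_z (nrm1 (g z) * Omega (l *: z)) * 2).
      rewrite ler_wpM2r// mulr_ge0//; apply: Rintegral_ge0 => z _.
      by rewrite mulr_ge0 ?nrm1_ge0// shift_modulus_ge0.
    rewrite mulrC -RintegralZl//; last exact: (iH N).
    by apply: eq_Rintegral => z _; ring.
have dec : (fun x => (fejer_row b x)%:C) = (fun x : V =>
    \sum_(p : {ffun 'I_n -> 'I_N.+1 * 'I_N.+1}) ((N.+1%:R^-1) ^+ n)%:C * fejer_mod l (lattice_freq l p) x).
  by apply/funext => x; rewrite bE fejer_row_natM.
have iv p := cintg_fejer_mod (@lattice_freq R n N.+1 l p) ln0.
have bn0 : b != 0 by rewrite gt_eqF.
move=> y; rewrite (conv_convC fM (cintg_fejer_row n bn0) iW).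
rewrite dec (conv_sumZ _ _ _ (bmeas_conv fM iW) iv) (conv_sumZ _ _ _ fM iv).
by apply: eq_bigr => p _; rewrite (conv_convC fM iW (iv p)) loc.
Unshelve. all: by end_near.
Qed.

Lemma conv_vallee_cst u B : bmeas u B ->
  (forall r, 0 < r -> conv u (fun x => (vallee_row r x)%:C) =1 u) -> forall y, u y = u 0.
Proof.
move=> uB uW y; apply/eqP; rewrite -subr_eq0; apply/eqP/nrm1_eq0.
apply/eqP; rewrite eq_le nrm1_ge0 andbT.
have dv : forall i : 'I_n, lorentz_dominated (@vallee R) by move=> i; exact: vallee_dominated.
have c0 : B * Omega ((1 / k.+1%:R) *: y) @[k --> \oo] --> (0 : R).
  rewrite -[X in _ --> X](mulr0 B); apply: cvgM; first exact: cvg_cst.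
  exact: (@shift_modulus_dilate (fun=> @vallee R)).
apply: (cvgr_to_ge c0); apply: nearW => k.
have r0 : 0 < 1 / k.+1%:R :> R by rewrite divr_gt0.
have iW := cintg_vallee_row n (lt0r_neq0 r0).
have := conv_shift_le 0 y uB iW (uW _ r0).
rewrite add0r -vallee_row_modulus// /shift_modulus => /le_trans; apply.
rewrite le_eqVlt; apply/orP; left; apply/eqP; congr (_ * _).
by apply: eq_Rintegral => x _; rewrite -rmorphB /= nrm1r.
Qed.

(** Each [f * K_l] is constant, with a value that might depend on [l]. Evaluating [f * K_l * K_1] in
    both orders shows that all these values agree, since all [K_l] have the same integral; dividing
    by this integral gives [c]. *)
Lemma conv_fejer_cst f M :
  bmeas f M ->
  (forall r b, 0 < r -> 0 < b -> exists g A, [/\ 0 <= A, cintg mu g,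
     conv f g =1 (fun=> 0) & fourier_bounded_below g A (r / 2) b]) ->
  exists c, forall l, 0 < l -> conv (fun x => f x - c) (fun x => (fejer_row l x)%:C) =1 (fun=> 0).
Proof.
move=> fM H.
have iK l : 0 < l -> cintg mu (fun x => (fejer_row l x)%:C).
  by move=> l0; apply: cintg_fejer_row; rewrite gt_eqF.
have cst l : 0 < l -> forall y, conv f (fun x => (fejer_row l x)%:C) y = conv f (fun x => (fejer_row l x)%:C) 0.
  move=> l0; apply: (conv_vallee_cst (bmeas_conv fM (iK _ l0))) => r r0.
  have [g [A [A0 ig fg gA]]] := H r l r0 l0.
  exact: (conv_fejer_vallee fM r0 l0 A0 ig fg gA).
have Cn0 : (C ^+ n)%:C != 0 :> R[i].
  by rewrite fmorph_eq0 expf_neq0// gt_eqF// fejer_mass_gt0.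
pose c0 := conv f (fun x => (fejer_row 1 x)%:C) 0.
have comp l s : 0 < l -> 0 < s ->
    conv (conv f (fun x => (fejer_row l x)%:C)) (fun x => (fejer_row s x)%:C) 0 =
    conv f (fun x => (fejer_row l x)%:C) 0 * (C ^+ n)%:C.
  move=> l0 s0; rewrite {1}/conv; under eq_cI do rewrite cst//.
  by rewrite cIZ ?integral_fejer_row//; exact: iK.
exists (c0 / (C ^+ n)%:C) => l l0 y.
transitivity (conv f (fun x => (fejer_row l x)%:C) y - c0 / (C ^+ n)%:C * (C ^+ n)%:C).
  rewrite -(integral_fejer_row n l0) /conv -cIZ; last exact: iK.
  rewrite -cIcB; [|exact: cintg_conv fM (iK _ l0)|by apply: cintgZ; exact: iK].
  by apply: eq_cI => x; rewrite mulrBl.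
rewrite divfK// cst//; apply/eqP; rewrite subr_eq0; apply/eqP.
apply: (mulIf Cn0); rewrite -(comp l 1)// -(comp 1 l)//.
by rewrite (conv_convC fM (iK _ l0) (iK _ ltr01)).
Qed.

(** [F] is merely bounded, so the smoothing is moved to [h] by Fubini: the average of the pairings
    of [F] with translates of [h], weighted by [K_l], is zero. For large [l] it approaches [C ^+ n]
    times the pairing with [h], because translation of [h] is continuous in [L^1]. *)
Lemma conv_fejer0_tensor (F : V -> R[i]) B (h : 'I_n -> R -> R) : bmeas F B ->
  (forall i, lorentz_dominated (h i)) ->
  (forall l, 0 < l -> conv F (fun x => (fejer_row l x)%:C) =1 (fun=> 0)) ->
  cI mu (fun y => F y * (rtensor h y)%:C) = 0.
Proof.
move=> FB dh F0; have [mF bF] := FB.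
have ih := cintg_real (integrable_dominated dh).
have Cn0 : (C ^+ n)%:C != 0 :> R[i].
  by rewrite fmorph_eq0 expf_neq0// gt_eqF// fejer_mass_gt0.
pose K l x := (@fejer_row R n l x)%:C.
have iK l : 0 < l -> cintg mu (K l).
  by move=> l0; apply: cintg_fejer_row; rewrite gt_eqF.
pose Om := shift_modulus (rtensor h).
have inner x : cI mu (fun y => F (y + x) * (rtensor h y)%:C) = cI mu (fun y => F y * (rtensor h (y - x))%:C).
  have i1 : cintg mu (fun y => F (y + x) * (rtensor h y)%:C).
    apply: (@cintgMb _ _ _ mu (fun y => F (y + x)) _ B) => //.
    by apply: (cmeas_comp mF); exact: measurable_addr.
  by rewrite (cI_shift (- x) i1); apply: eq_cI => y; rewrite subrK.
have swap l : 0 < l -> cI mu (fun x => K l x * cI mu (fun y => F y * (rtensor h (y - x))%:C)) = 0.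
  move=> l0.
  transitivity (cI mu (fun x => cI mu (fun y => F (y + x) * (K l x * (rtensor h y)%:C)))).
    apply: eq_cI => x; rewrite -inner -cIZ.
      by apply: eq_cI => y; rewrite mulrCA.
    apply: (@cintgMb _ _ _ mu (fun y => F (y + x)) _ B) => //.
    by apply: (cmeas_comp mF); exact: measurable_addr.
  rewrite (@cI_fubini _ _ _ _ _ mu mu (fun p : V * V => F (p.2 + p.1) * (K l p.1 * (rtensor h p.2)%:C))).
    rewrite -(@cI0 _ _ _ mu); apply: eq_cI => y /=.
    transitivity (cI mu (fun x => (rtensor h y)%:C * (F (y + x) * K l x))).
      by apply: eq_cI => x; ring.
    rewrite cIZ; last exact: cintg_conv FB (iK _ l0).
    by have := F0 l l0 y; rewrite /conv => ->; rewrite mulr0.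
  apply: (@cintgMb _ _ _ _ (fun p : V * V => F (p.2 + p.1)) _ B) => //.
    have := cmeas_comp mF (@measurable_row_add R n).
    by under eq_fun do rewrite addrC.
  apply: (cintg_dom _ (integrable_prodM (cintg_nrm1 (iK _ l0)) (cintg_nrm1 ih))).
    apply: cmeasM; first exact: (cmeas_comp (cintg_cmeas (iK _ l0)) measurable_fst).
    exact: (cmeas_comp (cintg_cmeas ih) measurable_snd).
  by move=> p; exact: nrm1M.
have ihs x : cintg mu (fun y => (rtensor h (y - x))%:C) by exact: (cintg_shift (- x) ih).
set J := cI mu (fun y => F y * (rtensor h y)%:C).
have mh := cintg_cmeas ih.
pose In x := cI mu (fun y => F y * (rtensor h (y - x))%:C).
have mIn : cmeas In.
  apply: (@cmeas_int_param _ _ _ _ _ mu (fun p : V * V => F p.2 * (rtensor h (p.2 - p.1))%:C)).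
  apply: cmeasM; first exact: (cmeas_comp mF measurable_snd).
  apply: (cmeas_comp mh); apply: measurable_rowP => i; under eq_fun do rewrite !mxE.
  have mc := @measurable_coord R n i.
  apply: measurable_funB; first exact: (measurableT_comp mc measurable_snd).
  exact: (measurableT_comp mc measurable_fst).
have dif x : nrm1 (J - In x) <= B * Om x.
  rewrite /J /In -cIcB.
  - under eq_cI do rewrite -mulrBr.
    apply: le_trans (nrm1_cI_bound FB (cintgB ih (ihs x))) _.
    rewrite le_eqVlt; apply/orP; left; apply/eqP; congr (_ * _).
    by apply: eq_Rintegral => y _; rewrite -rmorphB /= nrm1r.
  - exact: (cintgMb mF bF).
  - exact: (cintgMb mF bF).
have bIn x : nrm1 (In x) <= B * \int[mu]_x nrm1 (rtensor h x)%:C.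
  apply: le_trans (nrm1_cI_bound FB (ihs x)) _.
  have := Rintegral_scales (scales_row_shift (- x)) (cintg_nrm1 ih).
  by rewrite mul1r => ->.
have Om0 x : 0 <= Om x by exact: shift_modulus_ge0.
have fr0 l z : 0 <= l -> 0 <= @fejer_row R n l z.
  by move=> l0; apply: prodr_ge0 => i _; exact: fejer_scaled_ge0.
have i1 : mu.-integrable setT (EFin \o @fejer_row R n 1).
  by apply: integrable_rtensor => i; exact: integrable_fejer_scaled.
have [iO cO] := integral_shift_modulus_cvg0 dh ler01 (fun z => fr0 1 z ler01) i1.
have rowS (k : nat) x : fejer_row k.+1%:R x = k.+1%:R ^+ n * @fejer_row R n 1 (k.+1%:R *: x).
  rewrite /fejer_row /rtensor /fejer_scaled expr_prod_ord -big_split /=.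
  by apply: eq_bigr => i _; rewrite !mxE !mul1r.
have k0 (k : nat) : 0 < k.+1%:R :> R by [].
have scal k := scales_row_affine (0 : V) (lt0r_neq0 (k0 k)).
have simp k (x : V) : (1 / k.+1%:R) *: (k.+1%:R *: x + 0) = x.
  by rewrite addr0 scalerA mul1r mulVf ?scale1r// pnatr_eq0.
have iKO k : mu.-integrable setT (EFin \o (fun x => fejer_row k.+1%:R x * Om x)).
  have := integrableZl measurableT (k.+1%:R ^+ n) (integrable_scales (scal k) (iO k)).
  apply: eq_integrable => // x _; rewrite /= simp rowS addr0 -/(fejer_row 1 _).
  by rewrite -EFinM mulrA.
have eKO k : \int[mu]_x (fejer_row k.+1%:R x * Om x) =
    \int[mu]_x (fejer_row 1 x * Om ((1 / k.+1%:R) *: x)).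
  rewrite [RHS](Rintegral_scales (scal k) (iO k)) -RintegralZl//; last first.
    exact: (integrable_scales (scal k) (iO k)).
  apply: eq_Rintegral => x _; rewrite simp rowS addr0 -/(fejer_row 1 _) ger0_norm//.
  by rewrite mulrA.
have key k : nrm1 ((C ^+ n)%:C * J) <= B * \int[mu]_x (fejer_row 1 x * Om ((1 / k.+1%:R) *: x)).
  have -> : (C ^+ n)%:C * J = cI mu (fun x => (J - In x) * K k.+1%:R x).
    have -> : (C ^+ n)%:C * J = cI mu (fun x => J * K k.+1%:R x) - cI mu (fun x => In x * K k.+1%:R x).
      under [X in _ - X]eq_cI do rewrite mulrC.
      by rewrite swap// subr0 cIZ ?integral_fejer_row 1?mulrC//; exact: iK.
    rewrite -cIcB; [|by apply: cintgZ; exact: iK|exact: (cintgMb mIn bIn (iK _ (k0 k)))].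
    by apply: eq_cI => x; rewrite mulrBl.
  rewrite -eKO -RintegralZl//.
  apply: nrm1_cI_le.
  - apply: cmeasM; last exact: cintg_cmeas (iK _ (k0 k)).
    by apply: cmeasB => //; exact: cmeas_cst.
  - exact: (integrableZl measurableT B (iKO k)).
  - move=> x; apply: le_trans (nrm1M _ _) _.
    rewrite nrm1r ger0_norm; last exact: fr0.
    by rewrite [leRHS]mulrCA mulrC ler_wpM2l// fr0.
have : (C ^+ n)%:C * J = 0.
  apply: nrm1_eq0; apply/eqP; rewrite eq_le nrm1_ge0 andbT.
  have c0 : B * \int[mu]_x (fejer_row 1 x * Om ((1 / k.+1%:R) *: x)) @[k --> \oo] --> (0 : R).
    by rewrite -[X in _ --> X](mulr0 B); apply: cvgM; [exact: cvg_cst|exact: cO].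
  by apply: (cvgr_to_ge c0); apply: nearW => k; exact: key.
by move/eqP; rewrite mulf_eq0 (negbTE Cn0) /= => /eqP.
Qed.

End tauberian.

(** * Bounded functions orthogonal to tensor products vanish almost everywhere *)

Section orthants.
Context (R : realType) (n : nat).
Local Notation V := 'rV[R]_n.
Local Notation mu := (leb R n).

Definition orthant (a : 'I_n -> R) : set V := [set x | forall i, a i < x ord0 i].

(** An intersection-stable family generating the measurable sets, chosen because its indicators are
    limits of tensor products of continuous functions. *)
Definition orthants : set (set V) := range orthant.

Lemma orthants_setI_closed : setI_closed orthants.
Proof.
move=> _ _ [a _ <-] [b _ <-]; exists (fun i => Num.max (a i) (b i)) => //.
apply/seteqP; split => x /=.
  by move=> h; split=> i; have := h i; rewrite gt_max => /andP[].
by move=> [ha hb] i; rewrite gt_max ha hb.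
Qed.

Lemma measurable_orthant a : measurable (orthant a).
Proof.
rewrite (_ : orthant a = \bigcap_(i in [set: 'I_n]) ((fun x : V => x ord0 i) @^-1` `]a i, +oo[%classic)).
  apply: fin_bigcap_measurable => // i _.
  rewrite -[X in measurable X]setTI; exact: (@measurable_coord R n i).
apply/seteqP; split => x /= h i; first by move=> _ /=; rewrite in_itv/= andbT; exact: h.
by have := h i I; rewrite /= in_itv/= andbT.
Qed.

Lemma rowmeasurable_orthants : @measurable _ V = <<s orthants >>.
Proof.
rewrite eqEsubset; split; last first.
  apply: smallest_sub; first exact: sigma_algebra_measurable.
  by move=> _ [a _ <-]; exact: measurable_orthant.
pose T1 := g_sigma_algebraType orthants.
have mc i : measurable_fun (setT : set T1) (fun x : V => x ord0 i).
  apply: (@measurability _ _ T1 (measurableTypeR R) setT _ (@RGenOInfty.G R)).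
    exact: RGenOInfty.measurableE.
  move=> _ [_ [a ->] <-]; rewrite setTI.
  (* A half-space in one coordinate is exhausted by orthants whose other bounds tend to minus
     infinity. *)
  rewrite (_ : _ @^-1` _ = \bigcup_k orthant (fun j => if j == i then a else - k%:R)).
    by apply: bigcupT_measurable => k; apply: sub_sigma_algebra; exists (fun j => if j == i then a else - k%:R).
  apply/seteqP; split => [x|x [k _]] /=; last first.
    by move=> /(_ i); rewrite eqxx in_itv /= andbT.
  rewrite in_itv /= andbT => ax.
  exists (Num.bound (\sum_j `|x ord0 j|)) => // j.
  have S0 : 0 <= \sum_j `|x ord0 j| by apply: sumr_ge0.
  case: eqP => [->//|_]; rewrite ltrNl.
  apply: le_lt_trans (archi_boundP S0).
  apply: (@le_trans _ _ `|x ord0 j|); first by rewrite -normrN ler_norm.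
  by rewrite (bigD1 j)//= lerDl sumr_ge0.
have mt : measurable_fun (setT : set T1) (@tuple_of_row R n).
  apply/measurable_fun_tnthP => i; rewrite (_ : _ \o _ = fun x : V => x ord0 i)//.
  by apply/funext => x /=; rewrite tnth_mktuple.
move=> A mA; have := mt measurableT _ mA.
rewrite setTI -comp_preimage (_ : _ \o _ = id) ?preimage_id//.
by apply/funext => x /=; rewrite tuple_of_rowK.
Qed.

(** The sets over which [f] integrates to [0] form a Dynkin system; the vanishing of the total
    integral closes it under complements. *)
Lemma integral_orthants_eq0 (f : V -> R) : mu.-integrable setT (EFin \o f) ->
  (\int[mu]_x (f x)%:E = 0)%E ->
  (forall a, \int[mu]_(x in orthant a) (f x)%:E = 0)%E -> {ae mu, forall x, f x = 0}.
Proof.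
move=> fi fT fo.
have all0 A : measurable A -> (\int[mu]_(x in A) (f x)%:E = 0)%E.
  rewrite [X in X A -> _]rowmeasurable_orthants.
  apply: (dynkin_induction (P := fun A => (\int[mu]_(x in A) (f x)%:E = 0)%E)) => //.
  - exact: rowmeasurable_orthants.
  - exact: orthants_setI_closed.
  - by move=> _ [a _ <-].
  - move=> S mS S0; move: fT; rewrite -(setUv S) integral_setU_EFin//.
    + by rewrite S0 add0e.
    + exact: measurableC.
    + by rewrite setUv; have /measurable_EFinP := measurable_int _ fi.
    + by apply/disj_setPCl.
  - move=> F mF tF F0; rewrite integral_bigcup//.
      by rewrite eseries0// => k _ _; exact: F0.
    by apply: (integrableS measurableT _ _ fi) => //; exact: bigcupT_measurable.
have : ae_eq mu setT (EFin \o f) (cst 0%E).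
  apply: integral_ae_eq => // E _ mE; rewrite integral0; exact: all0.
by apply: filterS => x /(_ I) [].
Qed.

(** The clamp of [t] to the unit interval, written with absolute values so that its continuity is
    immediate. *)
Definition ramp (t : R) : R := (`|t| - `|t - 1| + 1) / 2.

Lemma ramp_le0 t : t <= 0 -> ramp t = 0.
Proof. by move=> t0; rewrite /ramp !ler0_norm; lra. Qed.

Lemma ramp_ge1 t : 1 <= t -> ramp t = 1.
Proof. by move=> t1; rewrite /ramp !ger0_norm; lra. Qed.

Lemma ramp01 t : 0 <= ramp t <= 1.
Proof.
rewrite /ramp; have [t0|t0] := leP 0 t; have [t1|t1] := leP 0 (t - 1).
- by rewrite !ger0_norm//; lra.
- by rewrite (ger0_norm t0) (ltr0_norm t1); lra.
- by rewrite (ltr0_norm t0) (ger0_norm t1); lra.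
- by rewrite (ltr0_norm t0) (ltr0_norm t1); lra.
Qed.

Lemma continuous_ramp : continuous ramp.
Proof.
move=> t; apply: cvgM; last exact: cvg_cst.
apply: cvgD; last exact: cvg_cst.
apply: cvgB; apply: cvg_norm; first exact: cvg_id.
by apply: cvgB; [exact: cvg_id|exact: cvg_cst].
Qed.

(** [f] is bounded but perhaps not integrable, so it is first multiplied by the positive integrable
    [L]. The indicator of an orthant times [L] is a limit of tensor products of ramps times
    [lorentz], which are admissible tests. *)
Lemma integral_tensor_eq0_ae (f : V -> R) B : measurable_fun setT f -> (forall x, `|f x| <= B) ->
  (forall h : 'I_n -> R -> R, (forall i, lorentz_dominated (h i)) ->
     \int[mu]_x (f x * rtensor h x) = 0) ->
  {ae mu, forall x, f x = 0}.
Proof.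
move=> mf fB f0.
pose L := @rtensor R n (fun=> @lorentz R).
have dL : lorentz_dominated (@lorentz R).
  split; first exact: continuous_lorentz.
  by exists 1; split=> // x; rewrite mul1r ger0_norm// ltW// lorentz_gt0.
have L0 x : 0 < L x by apply: prodr_gt0 => i _; exact: lorentz_gt0.
have iL : mu.-integrable setT (EFin \o L) by exact: (@integrable_dominated _ _ (fun=> @lorentz R)).
have mL : measurable_fun setT L by apply/measurable_EFinP; exact: measurable_int iL.
have iBL : mu.-integrable setT (EFin \o (fun x => B * L x)).
  by apply: eq_integrable (integrableZl measurableT B iL).
have fLB x : `|f x * L x| <= B * L x by rewrite normrM (gtr0_norm (L0 x)) ler_wpM2r// ltW.
have ifL : mu.-integrable setT (EFin \o (fun x => f x * L x)).
  apply: le_integrable iBL => //; first by apply/measurable_EFinP; exact: measurable_funM.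
  by move=> x _; rewrite /= lee_fin; apply: le_trans (fLB x) _; exact: ler_norm.
suff : {ae mu, forall x, f x * L x = 0}.
  apply: filterS => x /eqP; rewrite mulf_eq0 => /orP[/eqP//|/eqP Lx].
  by have := L0 x; rewrite Lx ltxx.
have fin0 (g : V -> R) (D : set V) : measurable D -> mu.-integrable D (EFin \o g) ->
    \int[mu]_(x in D) g x = 0 -> (\int[mu]_(x in D) (g x)%:E = 0)%E.
  move=> mD gi g0; rewrite -[LHS]fineK; last exact: integrable_fin_num gi.
  by rewrite -/(Rintegral mu D g) g0.
apply: integral_orthants_eq0 => //.
  by apply: fin0 => //; exact: (f0 (fun=> @lorentz R)).
move=> a; have mo := measurable_orthant a.
apply: fin0 => //; first exact: (integrableS measurableT mo _ ifL).
rewrite Rintegral_mkcond.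
pose h (k : nat) (i : 'I_n) x : R := ramp (k%:R * (x - a i)) * lorentz x.
have dh k i : lorentz_dominated (h k i).
  split.
    move=> x; apply: cvgM; last exact: continuous_lorentz.
    apply: (@continuous_comp _ _ _ (fun x => k%:R * (x - a i))); last exact: continuous_ramp.
    by apply: cvgM; [exact: cvg_cst|apply: cvgB; [exact: cvg_id|exact: cvg_cst]].
  exists 1; split => // x; have /andP[r0 r1] := ramp01 (k%:R * (x - a i)).
  have l0 := ltW (lorentz_gt0 x).
  by rewrite /h mul1r (ger0_norm (mulr_ge0 r0 l0)) ler_piMl.
have c1 : \int[mu]_x (f x * rtensor (h k) x) @[k --> \oo] -->
    \int[mu]_x ((fun x => f x * L x) \_ (orthant a)) x.
  apply: (@Rintegral_dct _ _ _ mu (fun k x => f x * rtensor (h k) x) _ (fun x => B * L x)) => //.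
  - move=> k; apply: measurable_funM => //; apply: measurable_rtensor => i.
    by apply: continuous_measurable_fun; have [] := dh k i.
  - by apply/measurable_restrict => //; rewrite setTI; apply: measurable_funS (measurable_funM mf mL).
  - move=> x.
    have hE k : rtensor (h k) x = (\prod_i ramp (k%:R * (x ord0 i - a i))) * L x.
      by rewrite /rtensor /h big_split.
    have lim01 : \prod_i ramp (k%:R * (x ord0 i - a i)) @[k --> \oo] --> (\1_(orthant a) x : R).
      have [xa|xa] := pselect (orthant a x).
        rewrite indicE mem_set//=.
        have c i : ramp (k%:R * (x ord0 i - a i)) @[k --> \oo] --> (1 : R).
          have d0 : 0 < x ord0 i - a i by rewrite subr_gt0.
          apply: cvg_near_cst; exists (Num.bound (x ord0 i - a i)^-1) => // k /= hk.
          rewrite ramp_ge1// -ler_pdivrMr// div1r.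
          apply: le_trans (ltW (archi_boundP _)) _; first by rewrite invr_ge0 ltW.
          by rewrite ler_nat.
        elim: (index_enum _) => [|i s ih].
          by under eq_fun do rewrite big_nil; exact: cvg_cst.
        rewrite -[X in _ --> X]mul1r; under eq_fun do rewrite big_cons.
        by apply: cvgM => //; exact: c.
      rewrite indicE memNset//=; move/existsNP: xa => [i /negP]; rewrite -leNgt => xa.
      apply: cvg_near_cst; apply: nearW => k.
      rewrite (bigD1 i)//= ramp_le0 ?mul0r//.
      by rewrite mulr_ge0_le0// subr_le0.
    rewrite (_ : (fun k => _) = (fun k => (f x * L x) * \prod_i ramp (k%:R * (x ord0 i - a i)))); last first.
      by apply/funext => k; rewrite hE; ring.
    rewrite patchE -[X in _ --> X](_ : f x * L x * \1_(orthant a) x = _); last first.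
      by rewrite indicE; case: ifPn => _; rewrite ?mulr1 ?mulr0.
    by apply: cvgM; [exact: cvg_cst|exact: lim01].
  - move=> k x; rewrite normrM; apply: ler_pM => //.
    rewrite /rtensor normr_prod; apply: ler_prod => i _; rewrite normr_ge0 /=.
    have /andP[r0 r1] := ramp01 (k%:R * (x ord0 i - a i)).
    have l0 := ltW (lorentz_gt0 (x ord0 i)).
    by rewrite /h (ger0_norm (mulr_ge0 r0 l0)) ler_piMl.
have c0 : \int[mu]_x (f x * rtensor (h k) x) @[k --> \oo] --> (0 : R).
  by under eq_fun do rewrite f0//; exact: cvg_cst.
exact: (cvg_unique _ c1 c0).
Qed.

Lemma cI_tensor_eq0_ae (F : V -> R[i]) B : bmeas F B ->
  (forall h : 'I_n -> R -> R, (forall i, lorentz_dominated (h i)) ->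
     cI mu (fun x => F x * (rtensor h x)%:C) = 0) ->
  {ae mu, forall x, F x = 0}.
Proof.
move=> [[mR mI] bF] F0.
have a1 : {ae mu, forall x, Re (F x) = 0}.
  apply: (integral_tensor_eq0_ae (B := B)) => // [x|h dh].
    exact: le_trans (Re_nrm1 _) (bF x).
  have /(congr1 (@complex.Re R)) /= <- := F0 h dh.
  by apply: eq_Rintegral => x _; rewrite cReM /= mulr0 subr0.
have a2 : {ae mu, forall x, Im (F x) = 0}.
  apply: (integral_tensor_eq0_ae (B := B)) => // [x|h dh].
    exact: le_trans (Im_nrm1 _) (bF x).
  have /(congr1 (@complex.Im R)) /= <- := F0 h dh.
  by apply: eq_Rintegral => x _; rewrite cImM /= mulr0 add0r.
by apply: filterS2 a1 a2 => x r i; exact: complexE2.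
Qed.

End orthants.

(** * Smooth bump functions *)

Section bump_line.
Context (R : realType).

(** Listing all successive derivatives explicitly lets [Ck], a recursive condition on partial
    derivatives, be proved by induction for functions of one coordinate. *)
Definition derive_chain (d : nat -> R -> R) := forall k (x : R), is_derive x 1 (d k) (d k.+1 x).

Lemma derive_chain_continuous d k : derive_chain d -> continuous (d k).
Proof.
move=> dd x; apply: differentiable_continuous; apply/derivable1_diffP.
by have [] := dd k x.
Qed.

Lemma derive_chain_affine d (s c : R) : derive_chain d ->
  derive_chain (fun k t => s ^+ k * d k (s * t + c)).
Proof.
move=> dd k x.
have h : is_derive x 1 (fun t : R => s * t + c) s.
  have -> : (fun t : R => s * t + c) = horner (s%:P * 'X + c%:P).
    by apply/funext => t; rewrite !hornerE.
  apply: is_derive_eq (is_derive_poly _ _) _.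
  by rewrite derivD derivM !derivC derivX !hornerE.
have h2 := @is_derive1_comp R (d k) (fun t => s * t + c) x _ _ (dd k _) h.
apply: (is_derive_eq (is_deriveZ (s ^+ k) h2)).
by rewrite /GRing.scale /= exprSr; ring.
Qed.

Lemma polyM_expRN_le (p : {poly R}) : exists K, 0 <= K /\
  forall y : R, 1 <= y -> `|p.[y]| * expR (- y) <= K / y.
Proof.
(* The exponent exceeds by one the power that bounds the polynomial, which leaves the factor
   [1 / y]. The bound on [expR] is the [m]-th power of [y / m <= expR (y / m)]. *)
pose m := (size p).+1.
pose S := \sum_(i < size p) `|p`_i|.
have S0 : 0 <= S by apply: sumr_ge0.
exists (S * m%:R ^+ m); split; first by rewrite mulr_ge0// exprn_ge0.
move=> y y1; have y0 : 0 < y by lra.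
have b1 : `|p.[y]| <= S * y ^+ size p.
  rewrite horner_coef mulr_suml; apply: le_trans (ler_norm_sum _ _ _) _.
  apply: ler_sum => i _; rewrite normrM ler_wpM2l// normrX gtr0_norm//.
  by apply: ler_weXn2l => //; exact: ltnW.
have m0 : 0 < m%:R :> R by rewrite ltr0n.
have b2 : y ^+ m / m%:R ^+ m <= expR y.
  rewrite -expr_div_n [in leRHS](_ : y = m%:R * (y / m%:R)); last by field; rewrite gt_eqF.
  rewrite expRM_natl lerXn2r ?nnegrE ?expR_ge0 ?divr_ge0 ?ler0n ?(ltW y0)//.
  by apply: le_trans (expR_ge1Dx _); rewrite lerDr.
rewrite expRN ler_pdivrMr ?expR_gt0// mulrAC ler_pdivlMr//.
apply: le_trans (ler_wpM2r (ltW y0) b1) _.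
rewrite -mulrA -exprSr -/m -mulrA ler_wpM2l//.
by rewrite mulrC -ler_pdivrMr// exprn_gt0.
Qed.

(** The functions [q (1/x) * exp (-1/x)], extended by [0], form a family closed under
    differentiation: the polynomial changes to [X^2 * (q - q')], which is [flat_exp_step]. *)
Definition flat_exp (q : {poly R}) (x : R) : R :=
  if 0 < x then q.[x^-1] * expR (- x^-1) else 0.

Definition flat_exp_step (q : {poly R}) : {poly R} := 'X ^+ 2 * (q - q^`()).

Lemma is_derive_flat_exp q (x : R) : is_derive x 1 (flat_exp q) (flat_exp (flat_exp_step q) x).
Proof.
have [x0|x0|->] := ltgtP x 0.
- rewrite {2}/flat_exp ltNge (ltW x0) /=.
  apply: (@near_eq_is_derive _ _ _ (cst 0)).
  near=> y; rewrite /flat_exp ltNge (_ : y <= 0)//; apply: ltW; near: y; exact: lt_nbhsl.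
- have xn0 : x != 0 by rewrite gt_eqF.
  have dV : is_derive x 1 (fun y : R => y^-1) (- x ^- 2).
    have := @is_deriveV R id x 1 1 xn0 (is_derive_id _ _).
    by rewrite /GRing.scale /= mulr1.
  have dq := @is_derive1_comp R (horner q) (fun y => y^-1) x _ _ (is_derive_poly q x^-1) dV.
  have dN : is_derive x 1 (fun y : R => - y^-1) (x ^- 2).
    by have := is_deriveN dV; rewrite opprK.
  have de := @is_derive1_comp R (@expR R) (fun y => - y^-1) x _ _ (is_derive_expR (- x^-1)) dN.
  have dm := is_deriveM dq de.
  apply: (@near_eq_is_derive _ _ _ ((fun y => q.[y^-1]) * (fun y => expR (- y^-1)))).
    near=> y; rewrite /flat_exp (_ : 0 < y)//; near: y; exact: lt_nbhsr.
  apply: is_derive_eq dm _.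
  rewrite /flat_exp x0 /flat_exp_step /= hornerM hornerXn hornerD hornerN /GRing.scale /=.
  by rewrite exprVn; ring.
- rewrite {2}/flat_exp ltxx.
  (* The extra factor ['X], evaluated at [h^-1], absorbs the division by [h] in the difference
     quotient at [0]. *)
  have [K [K0 KP]] := polyM_expRN_le ('X * q).
  have lim0 : (fun h : R => h^-1 *: ((flat_exp q \o shift 0) (h *: 1) - flat_exp q 0)) @ 0^' --> (0 : R).
    apply/cvgrPdist_le => e e0; near=> h.
    rewrite sub0r normrN /= addr0 /flat_exp ltxx subr0 /GRing.scale /= mulr1.
    case: ifPn => [h0|_]; last by rewrite mulr0 normr0 ltW.
    have h1 : 1 <= h^-1.
      rewrite invf_ge1//; apply: le_trans (ler_norm _) _; near: h; apply: dnbhs0_le => //.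
    have := KP _ h1; rewrite hornerM hornerX invrK => hK.
    rewrite !normrM (gtr0_norm (expR_gt0 _)) mulrA -normrM.
    apply: le_trans hK _.
    have : h <= e / (K + 1).
      apply: le_trans (ler_norm _) _; near: h; apply: dnbhs0_le.
      by rewrite divr_gt0// ltr_wpDl.
    rewrite ler_pdivlMr ?ltr_wpDl// => ?; nra.
  by apply: DeriveDef; [apply/cvg_ex; exists 0|apply/cvg_lim].
Unshelve. all: by end_near.
Qed.

Definition flat_exp_chain (k : nat) : R -> R := flat_exp (iter k flat_exp_step 1).

Lemma derive_chain_flat_exp : derive_chain flat_exp_chain.
Proof. by move=> k x; rewrite /flat_exp_chain iterS; exact: is_derive_flat_exp. Qed.

End bump_line.

Section smooth_closure.
Context (R : realType) (n : nat).
Local Notation V := 'rV[R]_n.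
Implicit Types f g : V -> R.

Lemma Ck_continuous k f : Ck k f -> continuous f.
Proof. by case: k => [[]|k []]. Qed.

Lemma Ck_pred k f : Ck k.+1 f -> Ck k f.
Proof.
elim: k f => [|k ih] f; first by move=> [cf _]; split.
move=> [cf df]; split=> // i; have [d c] := df i; split => //; exact: ih.
Qed.

Lemma Ck_cst k (c : R) : Ck k (fun _ : V => c).
Proof.
elim: k c => [|k ih] c; first by split=> //; exact: cst_continuous.
split=> [|i]; first exact: cst_continuous.
split=> [x|]; first exact: derivable_cst.
by rewrite [X in Ck _ X](_ : _ = fun=> 0); [exact: ih|apply/funext => x; exact: derive_cst].
Qed.

Lemma Ck_add k f g : Ck k f -> Ck k g -> Ck k (f + g).
Proof.
elim: k f g => [|k ih] f g hf hg.
  by split=> // x; apply: continuousD; [exact: (@Ck_continuous _ _ hf x)|exact: (@Ck_continuous _ _ hg x)].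
have cf := @Ck_continuous _ _ hf; have cg := @Ck_continuous _ _ hg.
move: hf hg => [_ df] [_ dg].
split=> [x|i]; first by apply: continuousD; [exact: (cf x)|exact: (cg x)].
have [df1 cdf] := df i; have [dg1 cdg] := dg i.
split=> [x|]; first exact: derivableD.
rewrite [X in Ck _ X](_ : _ = (fun x => 'D_(e_ R i) f x) + (fun x => 'D_(e_ R i) g x)).
  exact: ih.
by apply/funext => x; rewrite deriveD.
Qed.

Lemma Ck_mul k f g : Ck k f -> Ck k g -> Ck k (f * g).
Proof.
elim: k f g => [|k ih] f g hf hg.
  by split=> // x; apply: continuousM; [exact: (@Ck_continuous _ _ hf x)|exact: (@Ck_continuous _ _ hg x)].
have cf := @Ck_continuous _ _ hf; have cg := @Ck_continuous _ _ hg.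
have pf := Ck_pred hf; have pg := Ck_pred hg.
move: hf hg => [_ df] [_ dg].
split=> [x|i]; first by apply: continuousM; [exact: (cf x)|exact: (cg x)].
have [df1 cdf] := df i; have [dg1 cdg] := dg i.
split=> [x|]; first exact: derivableM.
rewrite [X in Ck _ X](_ : _ = f * (fun x => 'D_(e_ R i) g x) + g * (fun x => 'D_(e_ R i) f x)).
  by apply: Ck_add; exact: ih.
by apply/funext => x; rewrite deriveM.
Qed.

Lemma Ck_coord d (j : 'I_n) k l : derive_chain d -> Ck k (fun x : V => d l (x ord0 j)).
Proof.
move=> dd; elim: k l => [|k ih] l.
  split=> // x; apply: (@continuous_comp _ _ _ (fun y : V => y ord0 j) (d l)).
    exact: coord_continuous.
  exact: derive_chain_continuous.
split=> [x|i].
  apply: (@continuous_comp _ _ _ (fun y : V => y ord0 j) (d l)).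
    exact: coord_continuous.
  exact: derive_chain_continuous.
have D (x : V) : is_derive x (e_ R i) (fun x : V => d l (x ord0 j)) ((i == j)%:R * d l.+1 (x ord0 j)).
  have E : (fun h : R => h^-1 *: (((fun x : V => d l (x ord0 j)) \o shift x) (h *: e_ R i) - d l (x ord0 j)))
     = (fun h : R => h^-1 *: ((d l \o shift (x ord0 j)) (h *: ((i == j)%:R : R)) - d l (x ord0 j))).
    by apply/funext => h; rewrite /= !mxE eqxx /= eq_sym.
  have [d1 d2] := dd l (x ord0 j).
  have [ij|ij] := eqVneq i j.
    rewrite mul1r; split; first by rewrite /derivable E ij eqxx.
    by rewrite /derive E ij eqxx; exact: d2.
  rewrite mul0r.
  have E0 : (fun h : R => h^-1 *: (((fun x : V => d l (x ord0 j)) \o shift x) (h *: e_ R i) - d l (x ord0 j))) = cst 0.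
    by rewrite E; apply/funext => h; rewrite (negbTE ij) /= scaler0 add0r subrr scaler0.
  split; first by rewrite /derivable E0; exact: is_cvg_cst.
  by rewrite /derive E0; apply/cvg_lim => //; exact: cvg_cst.
split=> [x|]; first by have [] := D x.
rewrite [X in Ck _ X](_ : _ = (fun=> (i == j)%:R) * (fun x : V => d l.+1 (x ord0 j))).
  by apply: Ck_mul; [exact: Ck_cst|exact: ih].
by apply/funext => x; have [_ ->] := D x.
Qed.

Lemma smooth_prod I (r : seq I) (F : I -> V -> R) : (forall i, smooth (F i)) ->
  smooth (fun x => \prod_(i <- r) F i x).
Proof.
move=> sF k; elim: r => [|i r ih].
  by rewrite [X in Ck _ X](_ : _ = fun=> 1); [exact: Ck_cst|apply/funext => x; rewrite big_nil].
rewrite [X in Ck _ X](_ : _ = F i * (fun x => \prod_(j <- r) F j x)); first by apply: Ck_mul => //; exact: sF.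
by apply/funext => x; rewrite big_cons.
Qed.

End smooth_closure.

Section bump.
Context (R : realType).

Definition flat (x : R) : R := flat_exp_chain 0 x.

Lemma flatE x : flat x = if 0 < x then expR (- x^-1) else 0.
Proof. by rewrite /flat /flat_exp_chain /flat_exp /= hornerE mul1r. Qed.

Lemma flat_ge0 x : 0 <= flat x.
Proof. by rewrite flatE; case: ifP => // _; exact: expR_ge0. Qed.

Lemma flat_le1 x : flat x <= 1.
Proof.
by rewrite flatE; case: ifP => // x0; rewrite -expR0 ler_expR oppr_le0 invr_ge0 ltW.
Qed.

Lemma flat_gt0 x : 0 < x -> 0 < flat x.
Proof. by rewrite flatE => ->; exact: expR_gt0. Qed.

Definition bump (delta y x : R) : R := flat (x - y + delta) * flat (delta - (x - y)).

Lemma bump_shift delta y x : bump delta y x = bump delta 0 (x - y).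
Proof. by rewrite /bump subr0. Qed.

Lemma bump_ge0 delta y x : 0 <= bump delta y x.
Proof. by rewrite mulr_ge0// flat_ge0. Qed.

Lemma bump_le1 delta y x : bump delta y x <= 1.
Proof. by rewrite mulr_ile1// ?flat_ge0 ?flat_le1. Qed.

Lemma bump_support delta y x : bump delta y x != 0 -> `|x - y| < delta.
Proof.
rewrite mulf_eq0 negb_or !flatE => /andP[].
case: ifP => [h1 _|_ /eqP//]; case: ifP => [h2 _|_ /eqP//].
by rewrite ltr_norml; apply/andP; split; lra.
Qed.

Lemma continuous_flat : continuous flat.
Proof. exact: (derive_chain_continuous (@derive_chain_flat_exp R)). Qed.

Lemma continuous_bump delta y : continuous (bump delta y).
Proof.
move=> x; apply: cvgM.
  apply: (@continuous_comp _ _ _ (fun x => x - y + delta)); last exact: continuous_flat.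
  by apply: cvgD; [apply: cvgB; [exact: cvg_id|exact: cvg_cst]|exact: cvg_cst].
apply: (@continuous_comp _ _ _ (fun x => delta - (x - y))); last exact: continuous_flat.
by apply: cvgB; [exact: cvg_cst|apply: cvgB; [exact: cvg_id|exact: cvg_cst]].
Qed.

Lemma integrable_bump delta : (@lebesgue_measure R).-integrable setT (EFin \o bump delta 0).
Proof.
(* On the support [|x| < delta], so there [(1 + delta^2) * lorentz x] is at least [1], which bounds
   the bump. *)
apply: (integrable_le_lorentz (D := 1 + delta ^+ 2)).
  exact: continuous_measurable_fun (@continuous_bump delta 0).
move=> x; rewrite ger0_norm ?bump_ge0//.
have [->|/bump_support] := eqVneq (bump delta 0 x) 0.
  by rewrite mulr_ge0// ?(ltW (lorentz_gt0 _))// addr_ge0// sqr_ge0.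
rewrite subr0 => xd; apply: le_trans (bump_le1 _ _ _) _.
rewrite /lorentz ler_pdivlMr ?mul1r; last by rewrite ltr_pwDl// sqr_ge0.
rewrite lerD2l -(real_normK (num_real x)) lerXn2r ?nnegrE//; first by apply: le_trans (ltW xd).
exact: ltW.
Qed.

Lemma integral_bump_gt0 delta : 0 < delta -> 0 < \int[@lebesgue_measure R]_x bump delta 0 x.
Proof.
move=> d0; apply: (@integral_gt0_continuous _ _ 0).
- by move=> x; exact: bump_ge0.
- exact: integrable_bump.
- exact: continuous_bump.
- by rewrite /bump !subrr add0r subr0 mulr_gt0// flat_gt0.
Qed.

End bump.

Section bump_row.
Context (R : realType) (n : nat).
Local Notation V := 'rV[R]_n.
Local Notation mu := (leb R n).

Definition bump_row (delta : R) (y : V) : V -> R :=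
  fun x => \prod_i bump delta (y ord0 i) (x ord0 i).

Lemma smooth_bump_row delta y : smooth (bump_row delta y).
Proof.
apply: smooth_prod => i k.
rewrite [X in Ck _ X](_ : _ =
  (fun x : V => flat (1 * x ord0 i + (delta - y ord0 i))) *
  (fun x : V => flat (-1 * x ord0 i + (delta + y ord0 i)))); last first.
  by apply/funext => x; rewrite /bump /=; congr (flat _ * flat _); ring.
have c1 := @derive_chain_affine R _ 1 (delta - y ord0 i) (@derive_chain_flat_exp R).
have c2 := @derive_chain_affine R _ (-1) (delta + y ord0 i) (@derive_chain_flat_exp R).
apply: Ck_mul.
  by have := @Ck_coord R n _ i k 0%N c1; under eq_fun do rewrite expr0 mul1r.
by have := @Ck_coord R n _ i k 0%N c2; under eq_fun do rewrite expr0 mul1r.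
Qed.

Lemma bump_row_shift delta y x : bump_row delta y x = bump_row delta 0 (x - y).
Proof. by apply: eq_bigr => i _; rewrite bump_shift !mxE. Qed.

Lemma test_fun_bump_row delta y : test_fun (fun x => (bump_row delta y x)%:C).
Proof.
split.
- exact: smooth_bump_row.
- by move=> k; exact: Ck_cst.
- pose A := [set v : V | forall i, `[y ord0 i - delta, y ord0 i + delta]%classic (v ord0 i)].
  have cA : compact A.
    apply: (@rV_compact R n (fun i => `[y ord0 i - delta, y ord0 i + delta]%classic)) => i.
    exact: segment_compact.
  apply: (subclosed_compact _ cA); first exact: closed_closure.
  have clA : closed A by apply: compact_closed => //; exact: norm_hausdorff.
  rewrite ((closure_id A).1 clA); apply: closureS => x /= hx i; rewrite /= in_itv /=.
  have : bump delta (y ord0 i) (x ord0 i) != 0.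
    apply: contra_neq hx => h0; rewrite /bump_row (bigD1 i)//= h0 mul0r.
    by [].
  by move=> /bump_support; rewrite ltr_norml => /andP[? ?]; apply/andP; split; lra.
Qed.

Lemma bump_row_ge0 delta y x : 0 <= bump_row delta y x.
Proof. by apply: prodr_ge0 => i _; exact: bump_ge0. Qed.

Lemma bump_rowE delta : bump_row delta 0 = rtensor (fun _ : 'I_n => bump delta 0).
Proof. by apply/funext => x; apply: eq_bigr => i _; rewrite mxE. Qed.

Lemma integrable_bump_row delta : mu.-integrable setT (EFin \o bump_row delta 0).
Proof. by rewrite bump_rowE; apply: integrable_rtensor => i; exact: integrable_bump. Qed.

Lemma integral_bump_row_gt0 delta : 0 < delta -> 0 < \int[mu]_x bump_row delta 0 x.
Proof.
move=> d0; have : cI mu (fun x => (bump_row delta 0 x)%:C) =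
    \prod_(i < n) (\int[@lebesgue_measure R]_x bump delta 0 x)%:C.
  rewrite bump_rowE; under eq_cI do rewrite rtensorE.
  rewrite cI_tensor => [|i]; last exact: cintg_real (integrable_bump delta).
  by apply: eq_bigr => i _; rewrite cI_real.
rewrite cI_real -rmorph_prod /= => /complexI ->.
by apply: prodr_gt0 => i _; exact: integral_bump_gt0.
Qed.

(** From [1 - cos x = x^2 * fejer x] and [fejer x <= 1/2]. *)
Lemma cos_ge_half (x : R) : `|x| <= 1 -> 2^-1 <= cos x.
Proof.
move=> x1; have := fejerE x; have := fejer_le_half x; have := fejer_ge0 x.
have : x ^+ 2 <= 1 by rewrite -(real_normK (num_real x)) expr_le1.
have : 0 <= x ^+ 2 by rewrite sqr_ge0.
nra.
Qed.

(** On the support of the bump the phase is at most [n * (delta * b) <= 1] in absolute value, so its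
    cosine is at least [1/2]. Thus one narrow bump has a transform bounded away from [0] on the
    whole cube of half-width [b]. *)
Lemma Re_fourier_bump_row delta b (xi : V) : 0 < delta -> 0 <= b -> n%:R * (delta * b) <= 1 ->
  (forall i, `|xi ord0 i| <= b) ->
  (\int[mu]_x bump_row delta 0 x) / 2 <=
  Re (cI mu (fun z => expi (dotRn z xi) * (bump_row delta 0 z)%:C)).
Proof.
move=> d0 b0 nb xb.
rewrite -[leRHS]/(\int[mu]_z Re (expi (dotRn z xi) * (bump_row delta 0 z)%:C)).
have ib := integrable_bump_row delta.
have [me be] := bmeas_expi_dot xi.
have [iR _] : cintg mu (fun z => expi (dotRn z xi) * (bump_row delta 0 z)%:C).
  by apply: (cintgMb me be); exact: cintg_real.
rewrite mulrC -RintegralZl//; apply: le_Rintegral => //.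
  exact: (integrableZl measurableT 2^-1 ib).
move=> x _; rewrite cReM /= mulr0 subr0.
have [->|bx] := eqVneq (bump_row delta 0 x) 0; first by rewrite !mulr0.
rewrite ler_wpM2r ?bump_row_ge0//; apply: cos_ge_half.
apply: le_trans nb; rewrite /dotRn; apply: le_trans (ler_norm_sum _ _ _) _.
apply: (@le_trans _ _ (\sum_(i < n) delta * b)); last by rewrite sumr_const card_ord mulr_natl.
apply: ler_sum => i _; rewrite normrM; apply: ler_pM => //.
have : bump delta ((0 : V) ord0 i) (x ord0 i) != 0.
  by apply: contra_neq bx => h0; rewrite /bump_row (bigD1 i)//= h0 mul0r.
by move=> /bump_support; rewrite mxE subr0 => /ltW.
Qed.

(** [nrm1 z^-1] is [nrm1 z] divided by the squared modulus, and [nrm1 z ^+ 2] is at most twice that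
    square. *)
Lemma nrm1_inv (z : R[i]) : z != 0 -> nrm1 z^-1 <= 2 / nrm1 z.
Proof.
move=> z0; have nz : 0 < nrm1 z.
  by rewrite lt_neqAle nrm1_ge0 andbT eq_sym; apply: contra_neq z0; exact: nrm1_eq0.
have h : (nrm1 z) ^+ 2 <= 2 * (Re z ^+ 2 + Im z ^+ 2).
  rewrite /nrm1 -(real_normK (num_real (Re z))) -(real_normK (num_real (Im z))).
  have := sqr_ge0 (`|Re z| - `|Im z|); rewrite !expr2; nra.
have q0 : 0 < Re z ^+ 2 + Im z ^+ 2 by have := exprn_gt0 2 nz; lra.
have -> : z^-1 = ((Re z ^+ 2 + Im z ^+ 2)^-1)%:C * Complex (Re z) (- Im z).
  apply: (mulfI z0); rewrite divff//; apply: complexE2; rewrite !(cReM, cImM) /=.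
    by field; rewrite gt_eqF.
  by field; rewrite gt_eqF.
rewrite nrm1Z gtr0_norm ?invr_gt0// mulrC ler_pdivrMr// mulrAC ler_pdivlMr//.
rewrite (_ : nrm1 (Complex _ _) * nrm1 z = nrm1 z ^+ 2)//.
by rewrite expr2 /nrm1 /= normrN.
Qed.

End bump_row.

(** * Passing between the notions of the statement and integrals over [leb] *)

Section transfer.
Context (R : realType) (n : nat).
Local Notation V := 'rV[R]_n.
Local Notation mu := (leb R n).

Lemma Rmeasurable_RnP (g : V -> R) : Rmeasurable_Rn g <-> measurable_fun setT g.
Proof.
split=> mg; last exact: (measurableT_comp mg (@measurable_row_of_tuple R n)).
rewrite (_ : g = (fun t => g (row_of_tuple t)) \o @tuple_of_row R n).
  exact: (measurableT_comp mg (@measurable_tuple_of_row R n)).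
by apply/funext => v /=; rewrite tuple_of_rowK.
Qed.

Lemma integral_lebn (g : V -> R) : measurable_fun setT g ->
  (\int[@lebn R n]_t (g (row_of_tuple t))%:E = \int[mu]_v (g v)%:E)%E.
Proof.
move=> mg; rewrite lebnE.
have mg' : measurable_fun setT (fun t : n.-tuple R => (g (row_of_tuple t))%:E).
  by apply/measurable_EFinP; exact/Rmeasurable_RnP.
pose push := measure_function_pushforward__canonical__measure_function_Measure
  mu (@measurable_tuple_of_row R n).
rewrite -[LHS]/(\int[push]_t (g (row_of_tuple t))%:E)%E.
rewrite [LHS]integralE [RHS]integralE.
rewrite ge0_integral_pushforward//; [|exact: measurable_tuple_of_row|exact: measurable_funepos].
rewrite ge0_integral_pushforward//; [|exact: measurable_tuple_of_row|exact: measurable_funeneg].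
by congr (_ - _)%E; apply: eq_integral => v _; rewrite ?funeposE ?funenegE /= ?funeposE ?funenegE tuple_of_rowK.
Qed.

Lemma Rintegrable_RnP (g : V -> R) : Rintegrable_Rn g <-> mu.-integrable setT (EFin \o g).
Proof.
have abs (h : V -> R) : measurable_fun setT h ->
    (\int[@lebn R n]_t `|(h (row_of_tuple t))%:E| = \int[mu]_v `|(h v)%:E|)%E.
  by move=> mh; apply: (integral_lebn (g := fun v => `|h v|)); exact: measurableT_comp.
split=> /integrableP[/measurable_EFinP mg gi]; apply/integrableP; split.
- by apply/measurable_EFinP; exact/Rmeasurable_RnP.
- by rewrite -abs//; exact/Rmeasurable_RnP.
- by apply/measurable_EFinP; exact/Rmeasurable_RnP.
- by rewrite abs.
Qed.

Lemma L1P (h : V -> R[i]) : L1 h <-> cintg mu h.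
Proof. by split=> -[a b]; split; exact/Rintegrable_RnP. Qed.

Lemma cint_cI (h : V -> R[i]) : cmeas h -> cint h = cI mu h.
Proof.
move=> [a b]; congr Complex; first exact: (congr1 fine (integral_lebn a)).
exact: (congr1 fine (integral_lebn b)).
Qed.

Lemma ae_RnP (P : V -> Prop) : ae_Rn P <-> {ae mu, forall v, P v}.
Proof.
split=> -[A [mA A0 sA]].
  exists (@tuple_of_row R n @^-1` A); split.
  - by rewrite -[X in measurable X]setTI; exact: measurable_tuple_of_row.
  - by rewrite -A0 lebnE.
  - by move=> v nPv; apply: sA => /=; rewrite tuple_of_rowK.
exists (@row_of_tuple R n @^-1` A); split.
- by rewrite -[X in measurable X]setTI; exact: measurable_row_of_tuple.
- by rewrite -lebE.
- by move=> t nPt; exact: sA.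
Qed.

(** If [P] failed everywhere, every function would vanish almost everywhere, whereas a bump has a
    positive integral. *)
Lemma ae_leb_exists (P : V -> Prop) : {ae mu, forall v, P v} -> exists v, P v.
Proof.
move=> aP; apply: contrapT => /forallNP nP.
have P0 := @integral_bump_row_gt0 R n 1 ltr01.
suff : \int[mu]_x bump_row 1 0 x = 0 by move=> e; rewrite e ltxx in P0.
rewrite /Rintegral (ae_eq_integral (cst 0%E)) ?integral0//.
  exact: measurable_int (integrable_bump_row n 1).
by apply: filterS aP => x Px _; have := nP x.
Qed.

Lemma ae_leb_shift (P : V -> Prop) h : {ae mu, forall v, P v} -> {ae mu, forall v, P (v + h)}.
Proof.
move=> [A [mA A0 sA]].
have mA' : measurable ((fun v => v + h) @^-1` A).
  by rewrite -[X in measurable X]setTI; exact: measurable_addr.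
exists ((fun v => v + h) @^-1` A); split => //; last by move=> v; exact: sA.
have [_ _ H] := @scales_row_shift R n h.
have i0 : (\int[mu]_v (\1_A v)%:E = 0)%E by rewrite integral_indic// setIT; exact: A0.
have i1 : (\int[mu]_v (\1_A (v + h))%:E = mu ((fun v => (v + h)%R) @^-1` A))%E.
  rewrite -[X in _ = mu X]setIT -(integral_indic mu measurableT mA').
  by apply: eq_integral => v _; rewrite !indicE.
have m1 : measurable_fun setT (fun v : V => (\1_A v)%:E : \bar R) by exact/measurable_EFinP.
have := H (fun v => (\1_A v)%:E) m1 (fun v => ltac:(by rewrite lee_fin)).
by rewrite i0 mul1e i1 => <-.
Qed.

Lemma fourierE (h : V -> R[i]) xi : cintg mu h -> fourier h xi =
  Complex ((2 * pi) ^- n) 0 * cI mu (fun x => expi (- dotRn x xi) * h x).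
Proof.
move=> ih; rewrite /fourier cint_cI//; apply: cmeasM; last exact: cintg_cmeas ih.
by case: (bmeas_expiN_dot xi).
Qed.

Lemma fourier_shift (h : V -> R[i]) y xi : cintg mu h ->
  fourier (fun x => h (x - y)) xi = expi (- dotRn y xi) * fourier h xi.
Proof.
move=> ih; have ihs : cintg mu (fun x => h (x - y)) by exact: (cintg_shift (- y) ih).
have [me be] := bmeas_expiN_dot xi.
rewrite !fourierE// mulrCA; congr (_ * _).
rewrite (cI_shift y); last exact: cintgMb be ihs.
rewrite -cIZ; last exact: cintgMb be ih.
by apply: eq_cI => x; rewrite addrK dotRnDl opprD addrC expiD mulrA.
Qed.

Lemma is_mult_of_shift (m phi g : V -> R[i]) y : cintg mu phi -> is_mult_of m phi g ->
  is_mult_of m (fun x => phi (x - y)) (fun x => g (x - y)).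
Proof.
move=> ip [/L1P ig gm]; split; first by apply/L1P; exact: (cintg_shift (- y) ig).
by move=> xi; rewrite !fourier_shift// gm mulrCA.
Qed.

Lemma fourier_const_neq0 : Complex ((2 * pi) ^- n) 0 != 0 :> R[i].
Proof.
rewrite eq_complex /= eqxx andbT invr_eq0 expf_neq0//.
by rewrite mulf_neq0// ?pnatr_eq0// gt_eqF// pi_gt0.
Qed.

(* Up to the factor [(2 pi)^n], these are the Fourier transforms at [- xi]. *)
Lemma is_mult_of_cI (m phi g : V -> R[i]) xi : cintg mu phi -> is_mult_of m phi g ->
  cI mu (fun x => expi (dotRn x xi) * g x) = m xi * cI mu (fun x => expi (dotRn x xi) * phi x).
Proof.
move=> ip [/L1P ig gm]; have := gm (- xi); rewrite !fourierE// opprK mulrCA.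
have E (h : V -> R[i]) : cI mu (fun x => expi (- dotRn x (- xi)) * h x) =
    cI mu (fun x => expi (dotRn x xi) * h x).
  by apply: eq_cI => x; rewrite dotRnNr opprK.
by rewrite !E => /(mulfI fourier_const_neq0).
Qed.

End transfer.

(** * The two implications *)

Section theorem.
Context (R : realType) (n : nat).
Local Notation V := 'rV[R]_n.
Local Notation mu := (leb R n).

Lemma nrm1_inv_bounded_annulus (m : V -> R[i]) (a b : R) : ccontinuous m -> 0 < a ->
  [set eta | m eta = 0] `<=` [set 0] ->
  exists A, 0 <= A /\ forall xi : V, (forall i, `|xi ord0 i| <= b) -> (exists i, a <= `|xi ord0 i|) ->
    m xi != 0 /\ nrm1 (m xi)^-1 <= A.
Proof.
move=> [cR cI'] a0 m0.
have cm : continuous (fun xi => nrm1 (m xi)).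
  by move=> xi; exact: (cvgD (cvg_norm (cR xi)) (cvg_norm (cI' xi))).
(* The annulus in the maximum norm is the union over [i] of these products of compact sets. A bound
   is found on each piece, and the sum of these nonnegative bounds serves for all. *)
pose K i := [set xi : V | forall j, (if j == i then `[- b, b]%classic `&` [set x | a <= `|x|] else `[- b, b]%classic) (xi ord0 j)].
have cK i : compact (K i).
  apply: (@rV_compact R n (fun j => if j == i then `[- b, b]%classic `&` [set x | a <= `|x|] else `[- b, b]%classic)) => j.
  case: (j == i); last exact: segment_compact.
  apply: compact_closedI; first exact: segment_compact.
  apply: (@closed_comp _ _ (fun x : R => `|x|) [set y | a <= y]); last exact: closed_ge.
  by move=> x _; exact: norm_continuous.
have Kn0 i xi : K i xi -> m xi != 0.
  move=> Kx; apply/eqP => /m0 /= x0; have := Kx i; rewrite eqxx => -[_ /=].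
  by rewrite x0 mxE normr0 leNgt a0.
have bd i : exists A, 0 <= A /\ forall xi, K i xi -> nrm1 (m xi)^-1 <= A.
  have [[x0 Kx0]|/forallNP nK] := pselect (exists x, K i x); last by exists 0; split => // xi /nK.
  have [c cK' cmin] := @EVT_min_rV R n _ (K i) (ex_intro _ x0 Kx0) (cK i) (continuous_subspaceT cm).
  have c0 : 0 < nrm1 (m c).
    rewrite lt_neqAle nrm1_ge0 andbT eq_sym; apply: contra_neq (Kn0 i c (set_mem cK')).
    exact: nrm1_eq0.
  exists (2 / nrm1 (m c)); split=> [|xi Kxi]; first by rewrite divr_ge0// ltW.
  apply: le_trans (nrm1_inv (Kn0 _ _ Kxi)) _; rewrite ler_wpM2l//.
  have cx := cmin xi (mem_set Kxi).
  by rewrite lef_pV2 ?posrE// (lt_le_trans c0).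
have [A AP] : {A : 'I_n -> R & forall i, 0 <= A i /\ forall xi, K i xi -> nrm1 (m xi)^-1 <= A i}.
  exact: (@choice _ _ (fun i A => 0 <= A /\ forall xi, K i xi -> nrm1 (m xi)^-1 <= A)).
exists (\sum_i A i); split; first by apply: sumr_ge0 => i _; case: (AP i).
move=> xi xb [i xa].
have Kxi : K i xi.
  move=> j; have xj : `[- b, b]%classic (xi ord0 j) by rewrite /= in_itv /= -ler_norml.
  by case: eqP => [->|//]; split => //; have := xb i; rewrite ler_norml /= in_itv.
split; first exact: Kn0 Kxi.
apply: le_trans ((AP i).2 _ Kxi) _; rewrite (bigD1 i)//= lerDl sumr_ge0// => j _.
by case: (AP j).
Qed.

Lemma Linf_bmeas (f : V -> R[i]) : Linf f -> exists f0 M,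
  [/\ bmeas f0 M, cmeas f & {ae mu, forall x, f x = f0 x}].
Proof.
move=> [/Rmeasurable_RnP mR /Rmeasurable_RnP mI [M /ae_RnP fM]].
have mf : cmeas f by split.
have mc : measurable_fun setT (fun x => cmod (f x)).
  apply: (measurableT_comp (continuous_measurable_fun (@sqrt_continuous R))).
  by apply: measurable_funD; exact: measurable_funX.
pose f0 x := if cmod (f x) <= M then f x else 0.
have mb : measurable_fun setT (fun x => cmod (f x) <= M).
  by apply: measurable_fun_ler.
(* Each component is at most the modulus, hence the [2]; the absolute value is there because [M] is
   not assumed nonnegative. *)
exists f0, (2 * `|M|); split => //; last first.
  by apply: filterS fM => x; rewrite /f0 => ->.
split.
  split.
    rewrite (_ : (fun x => _) = (fun x => if cmod (f x) <= M then Re (f x) else 0)).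
      by apply: measurable_fun_ifT => //; exact: measurable_cst.
    by apply/funext => x; rewrite /f0; case: ifP.
  rewrite (_ : (fun x => _) = (fun x => if cmod (f x) <= M then Im (f x) else 0)).
    by apply: measurable_fun_ifT => //; exact: measurable_cst.
  by apply/funext => x; rewrite /f0; case: ifP.
move=> x; rewrite /f0; case: ifPn => [h|_]; last by rewrite nrm10 mulr_ge0.
have hM : cmod (f x) <= `|M| by apply: le_trans h (ler_norm _).
have r : `|Re (f x)| <= cmod (f x).
  by rewrite -sqrtr_sqr /cmod ler_wsqrtr// lerDl sqr_ge0.
have i : `|Im (f x)| <= cmod (f x).
  by rewrite -sqrtr_sqr /cmod ler_wsqrtr// lerDr sqr_ge0.
by rewrite /nrm1; lra.
Qed.

Lemma annihilates_ae_const (m f : V -> R[i]) : ccontinuous m -> mult_maps_Cc_L1 m ->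
  Linf f -> mD_annihilates m f -> [set eta | m eta = 0] `<=` [set 0] -> ae_const f.
Proof.
move=> cm mL1 fL fm m0; have [f0 [M [f0M mf ff0]]] := Linf_bmeas fL.
have [mf0 bf0] := f0M.
have [c cP] : exists c, forall l, 0 < l ->
    conv (fun x => f0 x - c) (fun x => (fejer_row l x)%:C) =1 (fun=> 0).
  apply: (conv_fejer_cst f0M) => r b r0 b0.
  (* Chosen so that [n * (delta * b) <= 1]; the successor keeps the denominator nonzero in dimension
     [0]. *)
  pose delta := (n.+1%:R * b)^-1.
  have d0 : 0 < delta by rewrite invr_gt0 mulr_gt0.
  have nb : n%:R * (delta * b) <= 1.
    rewrite /delta invfM mulfVK ?gt_eqF// ler_pdivrMr// mul1r ler_nat//.
  pose phi (y x : V) : R[i] := (bump_row delta y x)%:C.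
  have ip : cintg mu (phi 0) by apply: cintg_real; exact: integrable_bump_row.
  have [g gm] := mL1 _ (test_fun_bump_row delta (0 : V)).
  have ig : cintg mu g by case: gm => /L1P.
  have [A [A0 AP]] := nrm1_inv_bounded_annulus b cm (divr_gt0 r0 (ltr0Sn R 1)) m0.
  have P0 := @integral_bump_row_gt0 R n delta d0.
  set P := \int[mu]_x bump_row delta 0 x in P0.
  (* [A] bounds the inverse of [m]; the transform of the bump is at least [P / 2], and [nrm1_inv]
     adds the factor [2]. *)
  exists g, (A * (2 / (P / 2))); split => //.
  - by rewrite mulr_ge0// divr_ge0// divr_ge0// ltW.
  (* The value at [y] is the pairing of [f0] with a translate of [g], which belongs to the bump
     centred at [y]; the hypothesis on [f] applies since [f] and [f0] agree almost everywhere. *)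
  - move=> y; rewrite /conv (cI_shift (- y)); last exact: cintg_conv f0M ig.
    have gy := is_mult_of_shift y ip gm.
    have : is_mult_of m (phi y) (fun x => g (x - y)).
      rewrite (_ : phi y = (fun x => phi 0 (x - y)))//.
      by apply/funext => x; rewrite /phi bump_row_shift.
    move=> /(fm _ _ (test_fun_bump_row delta y)).
    have igy : cintg mu (fun x => g (x - y)) by exact: (cintg_shift (- y) ig).
    have mfg : cmeas (fun x => f x * g (x - y)) by apply: cmeasM => //; exact: cintg_cmeas igy.
    have mf0g : cmeas (fun x => f0 x * g (x - y)) by apply: cmeasM => //; exact: cintg_cmeas igy.
    rewrite cint_cI// => <-.
    transitivity (cI mu (fun x => f0 x * g (x - y))).
      by apply: eq_cI => x; rewrite addrCA subrr addr0.
    apply: complexE2 => /=; congr fine; apply: ae_eq_integral => //.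
    + by apply/measurable_EFinP; case: mf0g.
    + by apply/measurable_EFinP; case: mfg.
    + by apply: filterS ff0 => x -> _.
    + by apply/measurable_EFinP; case: mf0g.
    + by apply/measurable_EFinP; case: mfg.
    + by apply: filterS ff0 => x -> _.
  - move=> xi xb xa; have [mx mA] := AP xi xb xa.
    rewrite (is_mult_of_cI xi ip gm).
    have := Re_fourier_bump_row d0 (ltW b0) nb xb.
    set G := cI mu _ => G1.
    have G2 : P / 2 <= nrm1 G by apply: le_trans G1 (le_trans (ler_norm _) (Re_nrm1 _)).
    have P2 : 0 < P / 2 by rewrite divr_gt0.
    have Gn0 : G != 0.
      by apply: contraTneq G2 => ->; rewrite nrm10 -ltNge.
    split; first by rewrite mulf_neq0.
    rewrite invfM; apply: le_trans (nrm1M _ _) _.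
    apply: ler_pM => //; [exact: nrm1_ge0|exact: nrm1_ge0|].
    apply: le_trans (nrm1_inv Gn0) _; rewrite ler_wpM2l// lef_pV2 ?posrE//.
    exact: lt_le_trans G2.
exists c; apply/ae_RnP.
have FB : bmeas (fun x => f0 x - c) (M + nrm1 c).
  split; first by apply: cmeasB => //; exact: cmeas_cst.
  by move=> x; apply: le_trans (nrm1B _ _) _; rewrite lerD2r.
have := cI_tensor_eq0_ae FB (fun h dh => conv_fejer0_tensor FB dh cP).
apply: filterS2 ff0 => x -> /eqP; rewrite subr_eq0 => /eqP; exact.
Qed.

Lemma zeros_of_ae_const (m : V -> R[i]) :
  (forall f : V -> R[i], Linf f -> mD_annihilates m f -> ae_const f) ->
  [set eta | m eta = 0] `<=` [set 0].
Proof.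
move=> H eta /= meta.
pose f x : R[i] := expi (dotRn x eta).
have mf : cmeas f by case: (bmeas_expi_dot eta).
have [||c /ae_RnP fc] := H f.
- split; [by apply/Rmeasurable_RnP; case: mf|by apply/Rmeasurable_RnP; case: mf|].
  exists 1; apply/ae_RnP; apply: aeW => x.
  by rewrite /cmod /cre /cim /= cos2Dsin2 sqrtr1.
(* The pairing with the character is, up to a constant, the transform of [g] at [- eta], which
   contains the factor [m eta = 0]. *)
- move=> phi g phiT gm; have [/L1P ig /(_ (- eta))] := gm.
  rewrite opprK meta mul0r fourierE// => /eqP.
  rewrite mulf_eq0 (negbTE (fourier_const_neq0 _ _)) /= => /eqP e0.
  rewrite cint_cI; last by apply: cmeasM => //; exact: cintg_cmeas ig.
  by rewrite -[RHS]e0; apply: eq_cI => x; rewrite /f dotRnNr opprK.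
apply: contrapT => /eqP eta0.
have [i ei] : exists i, eta ord0 i != 0.
  apply: contrapT => /forallNP h; move/eqP: eta0; apply; apply/rowP => i.
  by rewrite mxE; apply/eqP/negPn/negP/h.
(* Translation by [h] changes the phase by [pi] and so reverses the sign of the character, whereas a
   function constant almost everywhere takes the same value at some [v] and [v + h]. *)
pose h : V := (pi / eta ord0 i) *: e_ R i.
have hE : dotRn h eta = pi.
  rewrite /dotRn (bigD1 i)//= big1 ?addr0; last first.
    by move=> j ji; rewrite !mxE eqxx /= (negbTE ji) mulr0 mul0r.
  by rewrite !mxE !eqxx /= mulr1 divfK.
have [v [v1 v2]] : exists v, f v = c /\ f (v + h) = c.
  by apply: ae_leb_exists; apply: filterS2 fc (ae_leb_shift h fc).
have : f v = - f v.
  rewrite {1}v1 -v2 /f dotRnDl hE expiD.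
  have -> : expi pi = -1 :> R[i] by apply: complexE2; rewrite ?cReN ?cImN /= ?cospi ?sinpi ?oppr0.
  by rewrite mulrN1.
have f1 : f v * expi (- dotRn v eta) = 1 by exact: expiK.
move=> /eqP; rewrite -addr_eq0 -mulr2n mulrn_eq0 /= => /eqP f0.
by move: f1; rewrite f0 mul0r => /eqP; rewrite eq_sym oner_eq0.
Qed.

End theorem.

Unset Implicit Arguments.

Theorem theorem1p4 (R : realType) (n : nat) (m : 'rV[R]_n -> R[i])
  (m_cont : ccontinuous m) (m_L1 : mult_maps_Cc_L1 m) :
  (forall f : 'rV[R]_n -> R[i], Linf f -> mD_annihilates m f ->
     [set eta | m eta = 0] `<=` [set 0] -> ae_const f)
  /\
  ((forall f : 'rV[R]_n -> R[i], Linf f -> mD_annihilates m f -> ae_const f) ->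
     [set eta | m eta = 0] `<=` [set 0]).
Proof.
split; last exact: zeros_of_ae_const.
by move=> f fL fm m0; exact: (annihilates_ae_const m_cont m_L1 fL fm m0).
Qed.
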